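(* Let $\pi=\sum_{i=1}^\infty p_i\delta_{\varphi_i}$ be a probability measure on $[0,\infty)$ with $\pi(\Phi_L)=1$, and let $\bar V^{(1)}_t=\sum_{i=1}^\infty p_iV_t^{\varphi_i}$, $t\ge0$, be a strictly stationary (a.s. finite) supCOGARCH 1 process, where the $V^{\varphi_i}$ are independent stationary COGARCH processes with parameters $\varphi_i$. (a) Suppose that $\pi(\Phi_L^{(1)})=1$. Then for every $t\ge0$, $$\mathbb E[\bar V_t^{(1)}]=\int_{\Phi_L}\mathbb E[V_0^\varphi]\,\pi(d\varphi)=\beta\sum_{i=1}^\infty\frac{p_i}{\eta-\varphi_i\mathbb E[S_1]} .$$ (b) Suppose that $\pi(\Phi_L^{(2)})=1$. Then for every $t\ge0$, $h\ge0$, $$\operatorname{Var}[\bar V_t^{(1)}]=\sum_{i=1}^\infty p_i^2\operatorname{Var}[V_0^{\varphi_i}],\qquad \operatorname{Cov}[\bar V_t^{(1)},\bar V_{t+h}^{(1)}]=\sum_{i=1}^\infty p_i^2\operatorname{Cov}[V_0^{\varphi_i},V_h^{\varphi_i}],$$ where $$\operatorname{Var}[V_0^{\varphi}]=\frac{\beta^2\varphi^2\operatorname{Var}[S_1]}{(\varphi\mathbb E[S_1]-\eta)^2(2\eta-2\varphi\mathbb E[S_1]-\varphi^2\operatorname{Var}[S_1])},\qquad \operatorname{Cov}[V_0^{\varphi},V_h^{\varphi}]=e^{h(\varphi\mathbb E[S_1]-\eta)}\operatorname{Var}[V_0^\varphi].$$ The mean, variance and covariances of $\bar V^{(1)}$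 in (a) and (b) may be infinite.
   Context: Constants $\beta>0$, $\eta>0$ are fixed. $L$ is a canonical real-valued Lévy process with Lévy measure $\nu_L$; $S_t=\sum_{0<s\le t}(\Delta L_s)^2$ is the associated driftless subordinator, with Lévy measure $\nu_S$ (image of $\nu_L$ under $y\mapsto y^2$). For $\pi=\sum_i p_i\delta_{\varphi_i}$ ($p_i\ge 0$, $\sum_i p_i=1$, the $\varphi_i\ge 0$ distinct), let $L^{\varphi_i}$ be i.i.d. copies of $L$, $S_t^{\varphi_i}=\sum_{0<s\le t}(\Delta L^{\varphi_i}_s)^2$, $$X_t^{\varphi_i}=\eta t-\sum_{0<s\le t}\log(1+\varphi_i\Delta S_s^{\varphi_i}),\qquad V_t^{\varphi_i}=e^{-X_t^{\varphi_i}}\Big(V_0^{\varphi_i}+\beta\int_{(0,t]}e^{X_s^{\varphi_i}}\,ds\Big),\quad t\ge0,$$ with nonnegative starting variables $V_0^{\varphi_i}$ independent over $i$ and independent of the Lévy processes. $\Phi_L:=\{\varphi\ge0:\int_{(0,\infty)}\log(1+\varphi y)\,\nu_S(dy)<\eta\}$. For $\varphi\in\Phi_L$ the COGARCH process is stationary when $V_0^\varphi$ is distributed as $V^\varphi_\infty=\beta\int_{(0,\infty)}e^{-X^\varphi_s}ds$; in the stationary supCOGARCH 1 process each $V^{\varphi_i}$ is started in this law, and $\sum_i p_iV_0^{\varphi_i}<\infty$ a.s. is assumed. For $\kappa>0$: $\Phi_L^{(\kappa)}:=[0,\varphi_{\max}^{(\kappa)})$ with $\varphi_{\max}^{(\kappa)}=\sup\{\varphi:\mathbb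 E[(V_0^\varphi)^\kappa]<\infty\}$, where $V_0^\varphi$ has the stationary law. *)

(* Defs.v *)
From HB Require Import structures.
From mathcomp Require Import all_boot all_order all_algebra.
From mathcomp Require Import all_classical all_reals all_analysis.
From mathcomp Require Import measurable_realfun.

Set Implicit Arguments.
Unset Strict Implicit.
Unset Printing Implicit Defensive.

Import Order.TTheory GRing.Theory Num.Theory.
Import numFieldNormedType.Exports.

Local Open Scope classical_set_scope.
Local Open Scope ring_scope.

(* Stochastic processes on [0, +oo[ are families indexed by the whole of R;
   every definition below only looks at times t >= 0. *)

Section Paths.
Context {R : realType}.
Implicit Types (f : R -> R) (t s : R).

Definition cadlag f :=
  (forall t, 0 <= t -> f s @[s --> t^'+] --> f t) /\
  (forall t, 0 < t -> cvg (f s @[s --> t^'-])).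

Definition jump f t : R := f t - lim (f s @[s --> t^'-]).

(* S as a functional of the path of L. The sum of the squared jumps is a.s.
   finite whenever S is a (real-valued) subordinator; [fine] replaces the value
   +oo, on the exceptional null set, by 0. The same remark applies to
   [cogarch_X]. *)
Definition sub_path f t : R :=
  fine (\esum_(s in `]0, t]) ((jump f s) ^+ 2)%:E).

Definition cogarch_X (eta phi : R) f t : R :=
  eta * t -
  fine (\esum_(s in `]0, t]) (ln (1 + phi * jump (sub_path f) s))%:E).

Definition cogarch_V (beta eta phi v0 : R) f t : R :=
  expR (- cogarch_X eta phi f t) *
  (v0 + beta * \int[lebesgue_measure]_(s in `]0, t])
                 expR (cogarch_X eta phi f s)).

Definition cogarch_Vinf (beta eta phi : R) f : \bar R :=
  (beta%:E * \int[lebesgue_measure]_(s in `]0%R, +oo[)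
               (expR (- cogarch_X eta phi f s))%:E)%E.

End Paths.

Section Independence.
Local Open Scope ereal_scope.
Context {d} {T : measurableType d} {R : realType}.

(* Mutual independence of a family (F i) of sigma-algebras on T. *)
Definition independent_sigma (P : probability T R) (I : eqType)
    (F : I -> set (set T)) :=
  forall (J : seq I) (E : I -> set T), uniq J ->
    (forall j, j \in J -> F j (E j)) ->
    P (\bigcap_(j in [set` J]) E j) = \big[*%E/1]_(j <- J) P (E j).

End Independence.

(* The sigma-algebra generated by a process (X t)_{t >= 0}. Applied to the
   coordinate process on R -> R it is the product sigma-algebra of the path
   space. *)
Definition sigma_process {R : realType} {T : pointedType} (X : R -> T -> R) :
    set (set T) :=
  <<s \bigcup_(t in `[0, +oo[) g_sigma_algebra_preimage (X t) >>.

Definition path_measurable (R : realType) : set (set (R -> R)) :=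
  sigma_process (fun t (f : R -> R) => f t).

Section Levy.
Context {R : realType} {d} {T : measurableType d} (P : probability T R).

Definition levy_process (L : R -> {RV P >-> R}) :=
  [/\ forall w, L 0 w = 0,
      forall w, cadlag (L ^~ w),
      forall t : nat -> R, 0 <= t 0%N -> {homo t : m n / (m <= n)%N >-> m <= n} ->
        independent_sigma P
          (fun k => g_sigma_algebra_preimage
                      (fun w => L (t k.+1) w - L (t k) w)) &
      forall s t, 0 <= s -> 0 <= t -> forall A : set R, measurable A ->
        P [set w | A (L (s + t) w - L s w)] = P [set w | A (L t w)]].

(* The Levy measure of B (away from 0) is the expected number of jumps in B
   per unit of time. *)
Definition levy_measure (L : R -> {RV P >-> R})
    (nu : {measure set R -> \bar R}) :=
  nu [set 0] = 0%E /\
  forall B : set R, measurable B -> ~ B 0 ->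
    nu B = (\int[P]_w \esum_(s in [set s : R | (0 < s <= 1)%R /\
                                               B (jump (L ^~ w) s)]) 1)%E.

Definition subordinator (L : R -> {RV P >-> R}) (t : R) (w : T) : R :=
  sub_path (L ^~ w) t.

End Levy.

Definition same_process_law {R : realType}
    {d0} {T0 : measurableType d0} (P0 : probability T0 R) (X : R -> T0 -> R)
    {d1} {T1 : measurableType d1} (P1 : probability T1 R) (Y : R -> T1 -> R) :=
  forall E, path_measurable E ->
    P0 [set w | E (X ^~ w)] = P1 [set w | E (Y ^~ w)].

Definition levy_copy {R : realType}
    {d0} {T0 : measurableType d0} (P0 : probability T0 R)
    (L : R -> {RV P0 >-> R})
    {d1} {T1 : measurableType d1} (P1 : probability T1 R)
    (M : R -> {RV P1 >-> R}) :=
  levy_process M /\ same_process_law P1 M P0 L.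

Section Cogarch.
Context {R : realType} (beta eta : R).
Context {d0} {T0 : measurableType d0} (P0 : probability T0 R).
Context (L : R -> {RV P0 >-> R}) (nuL : {measure set R -> \bar R}).
Local Open Scope ereal_scope.

Definition nuS : set R -> \bar R := pushforward nuL (fun y : R => (y ^+ 2)%R).

Definition Phi_L : set R :=
  [set phi | (0 <= phi)%R /\
     \int[nuS]_(y in `]0%R, +oo[) (ln (1 + phi * y))%:E < eta%:E].

(* A random variable whose law is the stationary law for the parameter phi. *)
Definition Vinf (phi : R) (w : T0) : \bar R :=
  cogarch_Vinf beta eta phi (L ^~ w).

Definition Vmoment (kappa phi : R) : \bar R :=
  \int[P0]_w (Vinf phi w) `^ kappa.

(* The stationary law is only available for phi in Phi_L. *)
Definition phi_max (kappa : R) : \bar R :=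
  ereal_sup [set phi%:E | phi in [set phi | Phi_L phi /\
                                            Vmoment kappa phi < +oo]].

Definition Phi_L_kappa (kappa : R) : set R :=
  [set phi | (0 <= phi)%R /\ phi%:E < phi_max kappa].

Definition stationary_law (phi : R) {d1} {T1 : measurableType d1}
    (P1 : probability T1 R) (v0 : T1 -> R) :=
  forall A : set (\bar R), measurable A ->
    P1 [set w | A (v0 w)%:E] = P0 [set w | A (Vinf phi w)].

(* (v0, M) are the starting variable and the driving process of a stationary
   COGARCH process with parameter phi. *)
Definition stationary_cogarch (phi : R) {d1} {T1 : measurableType d1}
    (P1 : probability T1 R) (M : R -> {RV P1 >-> R}) (v0 : {RV P1 >-> R}) :=
  [/\ levy_copy L M,
      forall w, (0 <= v0 w)%R,
      independent_sigma P1
        (fun b : bool => if b then sigma_process M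
                         else g_sigma_algebra_preimage v0) &
      stationary_law phi P1 v0].

End Cogarch.

Definition cogarch {R : realType} (beta eta phi : R)
    {d} {T : measurableType d} {P : probability T R}
    (v0 : {RV P >-> R}) (M : R -> {RV P >-> R}) (t : R) (w : T) : R :=
  cogarch_V beta eta phi (v0 w) (M ^~ w) t.

(* The supCOGARCH 1 process, with values in [0, +oo]. *)
Definition supcogarch1 {R : realType} (beta eta : R) (p phi : nat -> R)
    {d} {T : measurableType d} {P : probability T R}
    (v0 : nat -> {RV P >-> R}) (M : nat -> R -> {RV P >-> R})
    (t : R) (w : T) : \bar R :=
  (\sum_(0 <= i <oo) (p i * cogarch beta eta (phi i) (v0 i) (M i) t w)%:E)%E.

(* Main.v *)
Require Import Defs.
From HB Require Import structures.
From mathcomp Require Import all_boot all_order all_algebra.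
From mathcomp Require Import all_classical all_reals all_analysis.
From mathcomp Require Import measurable_realfun.
From mathcomp Require Import ring lra.

Set Implicit Arguments.
Unset Strict Implicit.
Unset Printing Implicit Defensive.

Import Order.TTheory GRing.Theory Num.Theory.
Import numFieldNormedType.Exports.

Local Open Scope classical_set_scope.
Local Open Scope ring_scope.

(** Fix one parameter [x] and put Y = exp(-X). From time s to time t, Y is multiplied by exp(-eta (t
    - s)) and by the product of 1 + x Delta S over the jumps in between. Hence the ratios of Y over
    disjoint intervals are independent, and E[(Y_t / Y_s)^e] = exp(r_e (t - s)) with r_1 = x E[S_1]
    - eta and r_2 = 2 x E[S_1] + x^2 Var[S_1] - 2 eta ([moment_Y], [gam_rate2]). By Tonelli, V_inf =
    beta int Y_s ds has mean - beta / r_1 and second moment 2 beta^2 / (r_1 r_2), and these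
    integrals are finite only if the rates are negative. Membership in [Phi_L_kappa] provides a
    larger parameter at which V_inf has a finite moment. Since V_inf dominates a multiple of S_1,
    the moments of S_1 are finite and the rates at [x] are negative ([kappa1_facts],
    [kappa2_facts]).

    The equation V_t = Y_t V_0 + beta int_0^t (Y_t / Y_s) ds, its square written as a similar
    integral ([Vol_square]), and the independence of V_0 and L express E[V_t] and E[V_s V_t] through
    the moments of V_0 and the rates. The moments of V_inf are the constants for which the time
    dependence cancels ([E_V], [E_VV]); the closed forms of variance and covariance follow.

    For the superposition, (a) is monotone convergence for the series. For (b), distinct components
    are uncorrelated ([integral_cogarch_cross]), so only the diagonal of the double series survives.
    Subtracting the product of the means requires the sum of the p_i E[V_0] to be finite, which
    holds because the mean is bounded on [Phi_L_kappa] of order 2 ([statmean_bound]). The diagonal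
    sum itself may be infinite.

    What has to be built is the bridge from the increments of L, whose independence is assumed, to
    functionals of its jumps. For a continuous [g] vanishing near 0, the sum of [g] over the jumps
    is a limit of sums of [g] over increments on a grid ([bsum_cvg]). So Laplace functionals of jump
    sums factor over consecutive intervals ([lap_jsum]), hence so do polynomials in them
    ([poly_jsum]) and increasing limits of such polynomials ([integral_jfunct_prod]), among which
    are S and the exponential of the logarithmic jump sum. The moments of the latter come from
    refining the product of the 1 + x (S_v - S_u) over a grid ([integral_gam]). The condition
    [Phi_L] makes the squared jumps summable almost surely ([ae_finite_jumps]). *)

(** * Oscillation of cadlag paths on compact intervals *)

Section Cadlag.
Context {R : realType}.
Implicit Types (f g : R -> R) (a b s t : R).

Lemma at_right_delta (t : R) (P : R -> Prop) :
  (\forall s \near t^'+, P s) -> exists2 d : R, 0 < d & forall s, t < s < t + d -> P s.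
Proof.
case/nbhs_ballP => d /= d0 H; exists d => // s /andP[ts sd].
apply: H => //; rewrite /ball/= distrC ger0_norm; lra.
Qed.

Lemma at_left_delta (t : R) (P : R -> Prop) :
  (\forall s \near t^'-, P s) -> exists2 d : R, 0 < d & forall s, t - d < s < t -> P s.
Proof.
case/nbhs_ballP => d /= d0 H; exists d => // s /andP[ts sd].
apply: H => //; rewrite /ball/= ger0_norm; lra.
Qed.

Lemma cadlag_left f s : cadlag f -> 0 < s -> f t @[t --> s^'-] --> lim (f t @[t --> s^'-]).
Proof. by move=> [_ fl] s0; exact: (fl _ s0). Qed.

(** Each clause compares points on one side of [s] only, so the jump at [s] is never crossed. At
    [s = 0] the left clause is vacuous. *)
Lemma cadlag_local f s (e : R) : cadlag f -> 0 <= s -> 0 < e ->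
  exists2 d : R, 0 < d & forall u v,
    (s <= u -> s <= v -> u < s + d -> v < s + d -> `|f u - f v| <= e) /\
    (0 <= u < s -> 0 <= v < s -> s - d < u -> s - d < v -> `|f u - f v| <= e).
Proof.
move=> cf s0 e0.
have e20 : 0 < e / 2 by lra.
have [dr dr0 Hr] : exists2 d : R, 0 < d & forall u, s < u < s + d -> `|f s - f u| <= e / 2.
  apply: at_right_delta; have /cvgrPdist_le/(_ _ e20) := cf.1 _ s0; exact.
have [dl dl0 Hl] : exists2 d : R, 0 < d & forall u, 0 <= u -> s - d < u < s ->
    `|lim (f t @[t --> s^'-]) - f u| <= e / 2.
  have [s00|s00] := eqVneq s 0.
    by exists 1 => // u; rewrite s00 => u0; rewrite (le_gtF u0) andbF.
  have sp : 0 < s by rewrite lt_neqAle eq_sym s00.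
  have /cvgrPdist_le/(_ _ e20) := cadlag_left cf sp.
  by move=> /at_left_delta [d d0 H]; exists d => // u _ /H.
have Hr' u : s <= u -> u < s + dr -> `|f s - f u| <= e / 2.
  rewrite le_eqVlt => /orP[/eqP <-|su ud]; first by rewrite subrr normr0; lra.
  by apply: Hr; rewrite su.
exists (Num.min dr dl); first by rewrite lt_min dr0.
have m1 : Num.min dr dl <= dr by rewrite ge_min lexx.
have m2 : Num.min dr dl <= dl by rewrite ge_min lexx orbT.
move=> u v; split.
- move=> su sv us vs; have := Hr' u su; have := Hr' v sv.
  have -> : f u - f v = - (f s - f u) + (f s - f v) by ring.
  move=> A B; rewrite (le_trans (ler_normD _ _))// normrN.
  have := A ltac:(lra); have := B ltac:(lra); lra.
- move=> /andP[u0 us] /andP[v0 vs] su sv.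
  have A := Hl u u0 ltac:(apply/andP; split; lra).
  have B := Hl v v0 ltac:(apply/andP; split; lra).
  have -> : f u - f v = - (lim (f t @[t --> s^'-]) - f u) + (lim (f t @[t --> s^'-]) - f v) by ring.
  rewrite (le_trans (ler_normD _ _))// normrN; lra.
Qed.

Lemma seq_pos_lower (T : eqType) (s : seq T) (F : T -> R) :
  (forall x, x \in s -> 0 < F x) ->
  exists2 d : R, 0 < d & forall x, x \in s -> d <= F x.
Proof.
elim: s => [_|x s IH H]; first by exists 1.
have [d d0 Hd] : exists2 d : R, 0 < d & forall y, y \in s -> d <= F y.
  by apply: IH => y ys; apply: H; rewrite inE ys orbT.
exists (Num.min d (F x)); first by rewrite lt_min d0 H// mem_head.
move=> y; rewrite inE => /orP[/eqP ->|ys]; first by rewrite ge_min lexx orbT.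
by rewrite ge_min Hd.
Qed.

(* Away from the finitely many points of [s], a cadlag path oscillates little
   on short intervals. *)
Lemma cadlag_cover f a b (e : R) : cadlag f -> 0 <= a -> 0 < e ->
  exists (s : seq R) (d : R), [/\ uniq s, forall x, x \in s -> a <= x <= b, 0 < d &
   forall u v, a <= u -> u <= v -> v <= b -> v - u < d ->
     (forall x, x \in s -> ~~ (u < x <= v)) -> `|f v - f u| <= e].
Proof.
move=> cf a0 e0.
have /choice [dl Hdl] : forall x : R, exists d : R, 0 <= x -> 0 < d /\ forall u v,
    (x <= u -> x <= v -> u < x + d -> v < x + d -> `|f u - f v| <= e) /\
    (0 <= u < x -> 0 <= v < x -> x - d < u -> x - d < v -> `|f u - f v| <= e).
  move=> x; have [x0|x0] := lerP 0 x; last by exists 0.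
  by have [d d0 Hd] := cadlag_local cf x0 e0; exists d.
(* Cover by balls of half the local radius. If [u] lies in the half ball around [x] and [v - u] is
   below every half radius, both points lie in the full ball, and on one side of [x] unless
   [u < x <= v]. The exceptional points are the centres. *)
have := @segment_compact R a b; rewrite compact_cover.
move=> /(_ R `[a, b]%classic (fun x => ball x (dl x / 2))) [||D' D'D cov].
- by move=> x _; exact: ball_open.
- move=> x xab; exists x => //; apply: ballxx.
  have /andP[ax xb] := xab; have [] := Hdl x (le_trans a0 ax); lra.
have ab (x : R) : x \in finmap.enum_fset D' -> a <= x <= b by move=> /D'D/set_mem/=; rewrite in_itv.
have [d d0 Hd] : exists2 d : R, 0 < d & forall x, x \in finmap.enum_fset D' -> d <= dl x / 2.
  apply: seq_pos_lower => x /ab/andP[ax _].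
  have [] := Hdl x (le_trans a0 ax); lra.
exists (finmap.enum_fset D'), d.
split => //; first exact: finmap.fset_uniq.
move=> u v au uv vb vud nx.
have uab : `[a, b]%classic u by rewrite /= in_itv/= au (le_trans uv).
have [x /= xD xu] := cov u uab.
have /andP[ax xb] := ab x xD.
have [dx0 Hx] := Hdl x (le_trans a0 ax).
have vux : v - u < dl x / 2.
  by exact: (lt_le_trans vud (Hd x xD)).
move: xu; rewrite /ball/= ltr_norml => /andP[xu1 xu2].
have := nx x xD; rewrite negb_and -!leNgt -ltNge => /orP[xleu|vltx].
- by apply: (Hx v u).1; lra.
- by apply: (Hx v u).2; try (apply/andP; split); lra.
Qed.

End Cadlag.

(** * Sums over jumps as limits of sums over increments *)

Section JumpSums.
Context {R : realType}.
Implicit Types (f g : R -> R) (a b s t x : R).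

Definition jsum g f a b : \bar R := \esum_(s in `]a, b]) (g (jump f s))%:E.

Definition grid a b (N k : nat) : R := a + k%:R * ((b - a) / N%:R).

(** Such a [g] sees only jumps of size above [e], of which a cadlag path has finitely many on a
    bounded interval. Its jump sums are therefore finite sums. *)
Definition away g := [/\ continuous g, forall x, 0 <= g x &
  exists2 e : R, 0 < e & forall x, `|x| <= e -> g x = 0].

Lemma grid0 a b N : grid a b N 0 = a.
Proof. by rewrite /grid mul0r addr0. Qed.

Lemma gridN a b N : grid a b N.+1 N.+1 = b.
Proof. rewrite /grid mulrC divfK ?pnatr_eq0//; ring. Qed.

Lemma gridS a b N k : grid a b N k.+1 = grid a b N k + (b - a) / N%:R.
Proof. by rewrite /grid -natr1 mulrDl mul1r addrA. Qed.

Lemma grid_le a b N (k l : nat) : a <= b -> (k <= l)%N -> grid a b N k <= grid a b N l.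
Proof.
move=> ab kl; rewrite /grid lerD2l ler_wpM2r ?ler_nat// divr_ge0//; lra.
Qed.

Lemma grid_ex a b N s : a < s <= b ->
  exists k, (k < N.+1)%N /\ grid a b N.+1 k < s <= grid a b N.+1 k.+1.
Proof.
move=> /andP[as_ sb].
have ex : exists k, s <= grid a b N.+1 k.+1 by exists N; rewrite gridN.
case: (ex_minnP ex) => k Hk mk; exists k.
have kN : (k <= N)%N by apply: mk; rewrite gridN.
split; first by rewrite ltnS.
rewrite Hk andbT; case: k Hk mk kN => [|k] Hk mk kN; first by rewrite grid0.
by rewrite ltNge; apply/negP => /mk; rewrite ltnn.
Qed.

Lemma mesh_near a b (d : R) : 0 < d -> \forall N \near \oo, (b - a) / N.+1%:R < d.
Proof.
move=> d0.
near=> N.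
rewrite ltr_pdivrMr// mulrC -ltr_pdivrMr//.
have : (b - a) / d < N%:R by near: N; exact: nbhs_infty_gtr.
move=> H; apply: (lt_trans H); by rewrite ltr_nat.
Unshelve. all: by end_near.
Qed.

Lemma right_seq f (x : R) (v : nat -> R) (m : nat -> R) : cadlag f -> 0 <= x ->
  (forall N, x <= v N < x + m N) -> (forall d : R, 0 < d -> \forall N \near \oo, m N < d) ->
  f (v N) @[N --> \oo] --> f x.
Proof.
move=> cf x0 Hv Hm; apply/cvgrPdist_le => e e0.
have /cvgrPdist_le/(_ _ e0) := cf.1 _ x0 => /at_right_delta[d d0 Hd].
near=> N.
have /andP[] := Hv N; rewrite le_eqVlt => /orP[/eqP <- _|xv vm].
  by rewrite subrr normr0 ltW.
apply: Hd; rewrite xv (lt_trans vm)// ltrD2l.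
by near: N; exact: Hm.
Unshelve. all: by end_near.
Qed.

Lemma left_seq f (x : R) (v : nat -> R) (m : nat -> R) : cadlag f -> 0 < x ->
  (forall N, x - m N <= v N < x) -> (forall d : R, 0 < d -> \forall N \near \oo, m N < d) ->
  f (v N) @[N --> \oo] --> lim (f t @[t --> x^'-]).
Proof.
move=> cf x0 Hv Hm; apply/cvgrPdist_le => e e0.
have /cvgrPdist_le/(_ _ e0) := cadlag_left cf x0 => /at_left_delta[d d0 Hd].
near=> N.
have /andP[xv vx] := Hv N.
apply: Hd; rewrite vx andbT (lt_le_trans _ xv)// ltrD2l ltrN2.
by near: N; exact: Hm.
Unshelve. all: by end_near.
Qed.

Lemma jump_small f (x e d : R) : cadlag f -> 0 < x -> 0 < d ->
  (forall u, x - d < u < x -> `|f x - f u| <= e) -> `|jump f x| <= e.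
Proof.
move=> cf x0 d0 H.
have cvl : (fun u => `|f x - f u|) u @[u --> x^'-] --> `|jump f x|.
  apply: cvg_norm; apply: cvgB; [exact: cvg_cst|exact: cadlag_left].
apply: (cvgr_to_le cvl).
rewrite /=; near=> u; apply: H; apply/andP; split.
- near: u; apply: nbhs_left_gt; lra.
- by near: u; exact: nbhs_left_lt.
Unshelve. all: by end_near.
Qed.

(** A short left neighbourhood of [x] avoids the finitely many points of [s0], so the oscillation
    bound applies up to [x] itself and passes to the left limit. *)
Lemma cover_jump_small f a b (e d : R) (s0 : seq R) x : cadlag f -> 0 <= a -> 0 < d ->
  (forall u v, a <= u -> u <= v -> v <= b -> v - u < d ->
     (forall x, x \in s0 -> ~~ (u < x <= v)) -> `|f v - f u| <= e) ->
  a < x <= b -> x \notin s0 -> `|jump f x| <= e.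
Proof.
move=> cf a0 d0 Hd axb xs0.
have /andP[ax xb] := axb.
have [d1 d10 Hd1] : exists2 d : R, 0 < d & forall y, y \in s0 ->
    d <= (if y < x then x - y else 1).
  by apply: seq_pos_lower => y _; case: ifP => // ?; lra.
apply: (@jump_small f x e (Num.min (Num.min d d1) (x - a))) => //.
- exact: le_lt_trans ax.
- by rewrite !lt_min d0 d10 subr_gt0.
- move=> u /andP[]; rewrite ltrBlDr -ltrBlDl !lt_min => /andP[/andP[A B] C] ux.
  apply: Hd; [lra|lra|done|lra|].
  move=> y ys; have := Hd1 _ ys; case: ifP => yx dy.
    by apply/negP => /andP[]; lra.
  rewrite negb_and -!leNgt -ltNge; apply/orP; right.
  rewrite lt_neqAle; move/negbT: yx; rewrite -leNgt => ->; rewrite andbT.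
  by apply: contraNneq xs0 => ->.
Qed.

Lemma esum_seq (A : set R) (h : R -> \bar R) (s : seq R) : uniq s ->
  (forall x, 0 <= h x)%E -> (forall x, x \in s -> A x) ->
  (forall x, A x -> x \notin s -> h x = 0)%E ->
  \esum_(x in A) h x = (\sum_(x <- s) h x)%E.
Proof.
move=> us h0 sA Hz.
rewrite fsbig_seq// -esum_fset//.
rewrite esum_mkcond [RHS]esum_mkcond; apply: eq_esum => x _.
case: ifPn => [|/negP]; rewrite inE => Ax; case: ifPn => [|/negP]; rewrite inE/= => xs //.
  by apply: Hz => //; apply/negP.
by case: Ax; apply: sA.
Qed.

Lemma bigE_inj (N : nat) (c : nat -> R) (s : seq R) (k : R -> nat) :
  uniq s -> {in s &, injective k} -> (forall x, x \in s -> (k x < N)%N) ->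
  (forall j, (j < N)%N -> (forall x, x \in s -> k x <> j) -> c j = 0) ->
  \sum_(j < N) c j = \sum_(x <- s) c (k x).
Proof.
move=> us ki kN cz.
rewrite -(big_map k xpredT c) -(big_mkord xpredT c).
have um : uniq [seq k x | x <- s] by rewrite map_inj_in_uniq.
rewrite (bigID (mem [seq k x | x <- s]))/= [X in _ + X]big_seq_cond [X in _ + X]big1; last first.
  move=> j /andP[]; rewrite mem_index_iota => jN /negP jn; apply: cz => // x xs kx.
  by apply: jn; rewrite -kx map_f.
rewrite addr0 -big_filter; apply: perm_big; apply: uniq_perm => //.
  by rewrite filter_uniq// iota_uniq.
move=> j; rewrite mem_filter mem_index_iota/=.
case: (boolP (j \in _)) => //= /mapP[x xs ->].
by rewrite kN.
Qed.

Lemma cvg_sum_seq (I : eqType) (s : seq I) (u : I -> nat -> R) (l : I -> R) :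
  (forall i, i \in s -> u i N @[N --> \oo] --> l i) ->
  \sum_(i <- s) u i N @[N --> \oo] --> \sum_(i <- s) l i.
Proof.
elim: s => [_|i s IH H].
  by rewrite big_nil; under eq_cvg do rewrite big_nil; exact: cvg_cst.
rewrite big_cons; under eq_cvg do rewrite big_cons.
apply: cvgD; first by apply: H; rewrite inE eqxx.
by apply: IH => j js; apply: H; rewrite inE js orbT.
Qed.

(** A function of finitely many values of the path: measurability and laws of jump sums are read off
    from it in the limit. *)
Definition bsum g f a b (N : nat) : R :=
  \sum_(k < N.+1) g (f (grid a b N.+1 k.+1) - f (grid a b N.+1 k)).

(** By [cadlag_cover] only finitely many points matter. On a fine grid they lie in different cells,
    and the increment over the cell of [x] tends to the jump at [x], since the left end of the cell
    stays strictly below [x]. The other cells contribute nothing. *)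
Lemma bsum_cvg f g a b : cadlag f -> 0 <= a -> a <= b -> away g ->
  jsum g f a b \is a fin_num /\ bsum g f a b N @[N --> \oo] --> fine (jsum g f a b).
Proof.
move=> cf a0 ab [gc g0 [e e0 ge]].
have [s0 [d [us sab d0 Hd]]] := cadlag_cover b cf a0 e0.
set s := [seq x <- s0 | a < x <= b].
have uS : uniq s by rewrite filter_uniq.
have Ss x : x \in s -> a < x <= b by rewrite mem_filter => /andP[].
have smalljump x : a < x <= b -> x \notin s -> g (jump f x) = 0.
  move=> axb xs; apply: ge; apply: (cover_jump_small cf a0 d0 Hd axb).
  by move: xs; rewrite mem_filter axb.
have Jeq : jsum g f a b = (\sum_(x <- s) g (jump f x))%:E.
  rewrite /jsum (@esum_seq _ _ s)//; first by rewrite sumEFin.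
  - by move=> x; rewrite lee_fin.
  - by move=> x; rewrite /= in_itv/= => ax xs; rewrite smalljump.
split; first by rewrite Jeq.
rewrite Jeq/=.
have /choice [kk Hkk] : forall Nx : nat * R, exists k, a < Nx.2 <= b ->
   (k < Nx.1.+1)%N /\ grid a b Nx.1.+1 k < Nx.2 <= grid a b Nx.1.+1 k.+1.
  move=> [N x] /=; have [axb|naxb] := boolP (a < x <= b); last by exists 0%N.
  by have [k Hk] := grid_ex N axb; exists k.
(* Below this mesh two exceptional points cannot share a cell, so [kk] is injective on [s]. *)
have [d2 d20 Hd2] : exists2 d : R, 0 < d & forall z, z \in [seq (x, y) | x <- s, y <- s] ->
      d <= (if z.1 == z.2 then 1 else `|z.1 - z.2|).
  apply: seq_pos_lower => y _; case: ifPn => // yn.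
  by rewrite normr_gt0 subr_eq0.
have cN : \sum_(x <- s) g (f (grid a b N.+1 (kk (N, x)).+1) - f (grid a b N.+1 (kk (N, x))))
    @[N --> \oo] --> \sum_(x <- s) g (jump f x).
  apply: (@cvg_sum_seq _ s (fun x N => g (f (grid a b N.+1 (kk (N, x)).+1) -
    f (grid a b N.+1 (kk (N, x))))) (fun x => g (jump f x))) => x xs.
  have axb := Ss _ xs; have /andP[ax xb] := axb.
  have x0 : 0 < x by exact: le_lt_trans ax.
  have HN N : grid a b N.+1 (kk (N, x)) < x <= grid a b N.+1 (kk (N, x)).+1.
    by have [] := Hkk (N, x) axb.
  have gcx : {for jump f x, continuous g} by exact: gc.
  apply: (@continuous_cvg _ _ _ _ _ (fun N => f (grid a b N.+1 (kk (N, x)).+1) -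
    f (grid a b N.+1 (kk (N, x)))) g _ gcx).
  apply: cvgB.
  - apply: (@right_seq _ _ _ (fun N => (b - a) / N.+1%:R)) => //; first exact: ltW.
    + by move=> N; have /andP[A ->] := HN N; rewrite gridS /= ltrD2r.
    + exact: mesh_near.
  - apply: (@left_seq _ _ _ (fun N => (b - a) / N.+1%:R)) => //.
    + by move=> N; have /andP[-> B] := HN N; move: B; rewrite gridS /= andbT lerBlDr.
    + exact: mesh_near.
apply: cvg_trans cN; apply: near_eq_cvg; near=> N.
have mN : (b - a) / N.+1%:R < d by near: N; exact: mesh_near.
have mN2 : (b - a) / N.+1%:R < d2 by near: N; exact: mesh_near.
have HN x : x \in s -> (kk (N, x) < N.+1)%N /\
    grid a b N.+1 (kk (N, x)) < x <= grid a b N.+1 (kk (N, x)).+1.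
  by move=> xs; have := Hkk (N, x) (Ss _ xs).
rewrite /bsum; apply/esym.
apply: (@bigE_inj N.+1 (fun j => g (f (grid a b N.+1 j.+1) - f (grid a b N.+1 j))) s
  (fun x => kk (N, x))) => //.
- move=> x y xs ys kxy.
  have /andP[A B] := (HN _ xs).2; have /andP[C D] := (HN _ ys).2.
  apply/eqP/negPn/negP => xy.
  have := Hd2 (x, y) (allpairs_f (fun x y => (x, y)) xs ys); rewrite /= (negbTE xy).
  move: A B C D; rewrite -kxy gridS => A B C D.
  move: mN2 A B C D; set mesh := (b - a) / N.+1%:R => mN2 A B C D.
  have : `|x - y| <= mesh by rewrite ler_norml; apply/andP; split; lra.
  lra.
- by move=> x /HN[].
(* A cell without exceptional point has an increment of size at most [e], where [g] vanishes. *)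
- move=> j jN jn; apply: ge; apply: Hd.
  + by rewrite -[X in X <= _](grid0 a b N.+1); exact: grid_le.
  + exact: grid_le.
  + by rewrite -[X in _ <= X](gridN a b N); exact: grid_le.
  + by rewrite gridS addrC addKr.
  + move=> x xs0; apply/negP => xj.
    have axb : a < x <= b.
      have /andP[A B] := xj; apply/andP; split.
        by apply: le_lt_trans A; rewrite -[X in X <= _](grid0 a b N.+1); exact: grid_le.
      by apply: (le_trans B); rewrite -[X in _ <= X](gridN a b N); exact: grid_le.
    have xs : x \in s by rewrite mem_filter axb.
    apply: (jn x xs).
    have /andP[A B] := (HN _ xs).2; have /andP[C D] := xj.
    apply/eqP; rewrite eqn_leq; apply/andP; split; rewrite leqNgt; apply/negP => lt.
      by have := grid_le N.+1 ab lt; lra.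
    by have := grid_le N.+1 ab lt; lra.
Unshelve. all: by end_near.
Qed.

End JumpSums.

(** * Additivity and monotone approximation of jump sums *)

Section JsumTheory.
Context {R : realType}.
Implicit Types (f g : R -> R) (a b s t x phi : R).

Lemma jsum_ge0 f g a b : (forall x, 0 <= g x) -> (0 <= jsum g f a b)%E.
Proof. by move=> g0; apply: esum_ge0 => x _; rewrite lee_fin. Qed.

Lemma jsum_nil f g a : jsum g f a a = 0%E.
Proof. by rewrite /jsum set_itv_ge ?esum_set0// bnd_simp ltxx. Qed.

Lemma jsumD f g a b c : (forall x, 0 <= g x) -> a <= b -> b <= c ->
  jsum g f a c = (jsum g f a b + jsum g f b c)%E.
Proof.
move=> g0 ab bc; rewrite /jsum (esumID `]a, b]%classic); last first.
  by move=> x _; rewrite lee_fin.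
have -> : `]a, c]%classic `&` `]a, b]%classic = `]a, b]%classic.
  apply/seteqP; split => x /=; rewrite !in_itv/=; first by case.
  by move=> /andP[ax xb]; rewrite ax xb (le_trans xb).
have -> : `]a, c]%classic `&` ~` `]a, b]%classic = `]b, c]%classic.
  apply/seteqP; split => x /=; rewrite !in_itv/=.
    by move=> [/andP[ax xc]]; rewrite ax/= xc andbT => /negP; rewrite -ltNge.
  move=> /andP[bx xc]; rewrite (le_lt_trans ab bx) xc; split => //=.
  by apply/negP; rewrite -ltNge.
by [].
Qed.

Lemma le_jsum f g a a' b b' : (forall x, 0 <= g x) -> a' <= a -> b <= b' ->
  (jsum g f a b <= jsum g f a' b')%E.
Proof.
move=> g0 aa bb; apply: le_ereal_sup => _ [F [fF FI] <-]; exists F => //; split => //.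
move=> x /FI; rewrite /= !in_itv/= => /andP[ax xb].
by rewrite (le_lt_trans aa ax) (le_trans xb bb).
Qed.

Lemma le_jsum_fun f (g h : R -> R) a b : (forall x, g x <= h x) ->
  (jsum g f a b <= jsum h f a b)%E.
Proof. by move=> gh; apply: le_esum => x _; rewrite lee_fin. Qed.

Lemma jsum_ge1 f g a b x : (forall x, 0 <= g x) -> a < x <= b ->
  ((g (jump f x))%:E <= jsum g f a b)%E.
Proof.
move=> g0 axb; apply: esum_ge; exists [set x]; last by rewrite fsbig_set1.
by split => // y ->; rewrite /= in_itv.
Qed.

Definition approx (gm : nat -> R -> R) g := [/\ forall m, away (gm m),
  forall x, nondecreasing_seq (gm ^~ x) & forall x, gm m x @[m --> \oo] --> g x].

Lemma approx_le gm g m x : approx gm g -> gm m x <= g x.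
Proof.
move=> [_ ndg cg]; have <- : lim (gm ^~ x @ \oo) = g x by apply/cvg_lim => //; exact: cg.
by apply: nondecreasing_cvgn_le; [exact: ndg|apply/cvg_ex; exists (g x); exact: cg].
Qed.

Lemma approx_ge0 gm g x : approx gm g -> 0 <= g x.
Proof.
move=> H; apply: le_trans (approx_le 0 x H).
by case: H => /(_ 0%N)[].
Qed.

Lemma jsum_nd gm g f a b : approx gm g ->
  nondecreasing_seq (fun m => jsum (gm m) f a b).
Proof. by move=> [_ ndg _] m n mn; apply: le_jsum_fun => x; exact: ndg. Qed.

(** A jump sum is a supremum of finite sums and the limit in [m] is a supremum as well; the two
    commute. The limit may be infinite. *)
Lemma jsum_cvg gm g f a b : approx gm g ->
  jsum (gm m) f a b @[m --> \oo] --> jsum g f a b.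
Proof.
move=> H.
have /ereal_nondecreasing_cvgn := jsum_nd f a b H.
set l := ereal_sup _ => cl; suff -> : jsum g f a b = l by [].
have lub m : (jsum (gm m) f a b <= l)%E by apply: ereal_sup_ubound; exists m.
apply/eqP; rewrite eq_le; apply/andP; split; last first.
  apply: (cvge_to_le cl); apply: nearW => m; apply: le_jsum_fun => x.
  exact: approx_le H.
apply: ge_ereal_sup => _ [F [fF FI] <-].
have cF : (\sum_(x \in F) (gm m (jump f x))%:E)%E @[m --> \oo] -->
    (\sum_(x \in F) (g (jump f x))%:E)%E.
  rewrite fsbig_finite//= sumEFin.
  under eq_cvg do rewrite fsbig_finite//= sumEFin.
  apply: cvg_EFin; first by apply: nearW.
  by apply: cvg_sum_seq => x _; case: H => _ _; exact.
apply: (cvge_to_le cF); apply: nearW => m; apply: le_trans (lub m).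
by apply: ereal_sup_ubound; exists F.
Qed.

(** By right continuity the increments in a right neighbourhood of [s] are at most [e], hence so are
    the jumps. This is what makes such jump sums right continuous in their endpoint. *)
Lemma jsum_small f g s : cadlag f -> away g -> 0 <= s ->
  exists2 d : R, 0 < d & forall u, u < s + d -> jsum g f s u = 0%E.
Proof.
move=> cf [_ g0 [e e0 ge]] s0.
have [d d0 Hd] := cadlag_local cf s0 e0; exists d => // u ud.
apply: esum1 => x; rewrite /= in_itv/= => /andP[sx xu]; congr EFin.
apply: ge; apply: (@jump_small _ f x e (x - s)) => //; [lra|lra|].
by move=> v /andP[v1 v2]; apply: (Hd x v).1; lra.
Qed.

Lemma away_nneg g : away g -> forall x, 0 <= g x.
Proof. by case. Qed.

Lemma jsum_away_fin f g a b : cadlag f -> away g -> 0 <= a ->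
  jsum g f a b \is a fin_num.
Proof.
move=> cf ag a0; have [ab|/ltW ba] := lerP a b; first by have [] := bsum_cvg cf a0 ab ag.
by rewrite /jsum set_itv_ge ?esum_set0// bnd_simp -leNgt.
Qed.

Definition trunc g (m : nat) (x : R) : R := Num.max 0 (g x - m.+1%:R^-1).

Lemma approx_trunc g : continuous g -> (forall x, 0 <= g x) -> g 0 = 0 ->
  approx (trunc g) g.
Proof.
move=> gc g0 g00; split.
- move=> m; split.
  + move=> x; apply: (@continuous_max _ _ (cst 0) (fun x => g x - m.+1%:R^-1)).
      exact: cvg_cst.
    by apply: cvgB; [exact: gc|exact: cvg_cst].
  + by move=> x; rewrite /trunc le_max lexx.
  + have m0 : 0 < m.+1%:R^-1 :> R by rewrite invr_gt0.
    have /cvgrPdist_le/(_ _ m0)/nbhs_ballP[d /= d0 Hd] := gc 0.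
    exists (d / 2); first by lra.
    move=> x xd; have := Hd x; rewrite /ball/= g00 !sub0r !normrN (ger0_norm (g0 x)).
    have xd' : `|x| < d by apply: (le_lt_trans xd); lra.
    move=> /(_ xd') H; apply/max_idPl; rewrite subr_le0; exact: H.
- move=> x m n mn; rewrite /trunc ge_max le_max lexx/= le_max.
  by apply/orP; right; rewrite lerD2l lerN2 lef_pV2 ?posrE// ler_nat.
- move=> x; have -> : g x = Num.max 0 (g x - 0) by rewrite subr0; apply/esym/max_idPr.
  apply: (@cvg_comp _ _ _ (fun m => g x - m.+1%:R^-1) (Num.max 0) _ (nbhs (g x - 0)) _).
    by apply: cvgB; [exact: cvg_cst|exact: cvg_harmonic].
  apply: (@continuous_max _ _ (cst 0) id); [exact: cvg_cst|exact: cvg_id].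
Qed.

Definition sqj (x : R) : R := x ^+ 2.

Lemma sqr_continuous : continuous (sqj : R -> R).
Proof. exact: (@exprn_continuous R 2%N). Qed.

Lemma approx_sq : approx (trunc sqj) sqj.
Proof.
apply: approx_trunc; [exact: sqr_continuous|by move=> x; exact: sqr_ge0|].
by rewrite /sqj expr0n.
Qed.

(** A jump of S is a squared jump of L, so this is the summand log(1 + phi Delta S) of X as a
    function of the jump of L. *)
Definition lnj (phi x : R) : R := ln (1 + phi * x ^+ 2).

Lemma lnj_arg phi x : 0 <= phi -> 1 <= 1 + phi * x ^+ 2.
Proof. by move=> p0; rewrite lerDl mulr_ge0// sqr_ge0. Qed.

Lemma lnj_ge0 phi x : 0 <= phi -> 0 <= lnj phi x.
Proof. by move=> p0; apply: ln_ge0; exact: lnj_arg. Qed.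

Lemma lnj_continuous phi : 0 <= phi -> continuous (lnj phi).
Proof.
move=> p0 x.
have cl : {for 1 + phi * x ^+ 2, continuous (@ln R)}.
  by apply: continuous_ln; apply: lt_le_trans (lnj_arg x p0).
apply: (@continuous_cvg _ _ _ _ _ (fun y => 1 + phi * y ^+ 2) (@ln R) _ cl).
apply: cvgD; first exact: cvg_cst.
by apply: cvgM; [exact: cvg_cst|exact: sqr_continuous].
Qed.

Lemma approx_lnj phi : 0 <= phi -> approx (trunc (lnj phi)) (lnj phi).
Proof.
move=> p0; apply: approx_trunc; first exact: lnj_continuous.
- by move=> x; exact: lnj_ge0.
- by rewrite /lnj expr0n mulr0 addr0 ln1.
Qed.

(* Increasing continuous approximations of the indicator of [h > c]. *)
Definition indj (h : R -> R) (c : R) (x : R) : R := (c < h x)%R%:R.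

Definition indm (h : R -> R) (c : R) (m : nat) (x : R) : R :=
  Num.min 1 (Num.max 0 (m%:R * (h x - c))).

Lemma approx_ind h c : continuous h -> h 0 = 0 -> 0 < c ->
  approx (indm h c) (indj h c).
Proof.
move=> hc h0 c0; split.
- move=> m; split.
  + move=> x.
    apply: (@continuous_min _ _ (cst 1) (fun x => Num.max 0 (m%:R * (h x - c)))).
      exact: cvg_cst.
    apply: (@continuous_max _ _ (cst 0) (fun x => m%:R * (h x - c))).
      exact: cvg_cst.
    apply: cvgM; first exact: cvg_cst.
    by apply: cvgB; [exact: hc|exact: cvg_cst].
  + by move=> x; rewrite /indm le_min ler01 le_max lexx.
  + have /cvgrPdist_le/(_ _ c0)/nbhs_ballP[d /= d0 Hd] := hc 0.
    exists (d / 2); first by lra.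
    move=> x xd; have := Hd x; rewrite /ball/= h0 !sub0r !normrN.
    have xd' : `|x| < d by apply: (le_lt_trans xd); lra.
    move=> /(_ xd') H; have hx : h x - c <= 0 by rewrite subr_le0; apply: le_trans (ler_norm _) H.
    rewrite /indm (max_idPl _); first by apply/min_idPr.
    by rewrite mulr_ge0_le0.
- move=> x m n mn; rewrite /indm le_min ge_min lexx/= ge_min; apply/orP; right.
  have [hx|hx] := lerP 0 (h x - c).
    by rewrite ge_max le_max lexx/= le_max ler_wpM2r ?orbT// ler_nat.
  by rewrite ge_max le_max lexx/= le_max mulr_ge0_le0// ltW.
- move=> x; rewrite /indj; have [hx|hx] := ltrP c (h x).
    apply: cvg_near_cst; near=> m; rewrite /indm.
    have m1 : 1 <= m%:R * (h x - c).
      rewrite -ler_pdivrMr ?subr_gt0// mul1r.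
      by near: m; exact: nbhs_infty_ger.
    apply/min_idPl; rewrite le_max m1 orbT//.
  apply: cvg_near_cst; apply: nearW => m; rewrite /indm.
  rewrite (max_idPl _); first by apply/min_idPr.
  by rewrite mulr_ge0_le0// subr_le0.
Unshelve. all: by end_near.
Qed.

End JsumTheory.

Local Notation sub_path := Defs.sub_path.

(** * Jumps of the subordinator and of [cogarch_X], explosion included *)

Section SubPath.
Context {R : realType}.
Implicit Types (f g : R -> R) (a b s t x phi : R).

Lemma sub_pathE f t : sub_path f t = fine (jsum sqj f 0 t).
Proof. by []. Qed.

Lemma sqj_ge0 x : 0 <= sqj x.
Proof. exact: sqr_ge0. Qed.

Lemma esum_open_right f g s : (forall x, 0 <= g x) -> 0 < s ->
  jsum g f 0 s = (\esum_(x in `]0%R, s[) (g (jump f x))%:E + (g (jump f s))%:E)%E.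
Proof.
move=> g0 s0; rewrite /jsum (esumID `]0, s[%classic `]0, s]%classic); last first.
  by move=> x _; rewrite lee_fin.
have -> : `]0, s]%classic `&` `]0, s[%classic = `]0, s[%classic.
  apply/seteqP; split => x /=; rewrite !in_itv/=; first by case.
  by move=> /andP[-> xs]; rewrite xs ltW.
have -> : `]0, s]%classic `&` ~` `]0, s[%classic = [set s].
  apply/seteqP; split => x /=; rewrite !in_itv/=.
    move=> [/andP[-> xs]]/= /negP; rewrite -leNgt => sx.
    by apply/eqP; rewrite eq_le xs.
  by move=> ->; rewrite s0 lexx ltxx.
by rewrite esum_set1// lee_fin.
Qed.

(** A finite subset of the open interval that nearly exhausts the sum lies in []0, r]] as soon as
    [r] is close to [s]. *)
Lemma jsum_left_lim f g s : (forall x, 0 <= g x) -> 0 < s ->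
  (\esum_(x in `]0%R, s[) (g (jump f x))%:E < +oo)%E ->
  fine (jsum g f 0 r) @[r --> s^'-] -->
    fine (\esum_(x in `]0%R, s[) (g (jump f x))%:E)%E.
Proof.
move=> g0 s0; set A := (esum _ _) => Aoo.
have A0 : (0 <= A)%E by apply: esum_ge0 => x _; rewrite lee_fin.
have Af : A \is a fin_num by rewrite ge0_fin_numE.
apply/cvgrPdist_le => e e0.
have [_ [F [fF FI] <-] HF] : exists2 x, [set (\sum_(x \in F) (g (jump f x))%:E)%E |
     F in fsets `]0%R, s[%classic] x & (A - e%:E < x)%E.
  apply: ereal_sup_gt; rewrite -/A.
  by rewrite lteBlDr// lteDl// lte_fin.
have /finite_seqP[l Fl] := fF.
have [d d0 Hd] : exists2 d : R, 0 < d & forall y, y \in l -> d <= s - y.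
  apply: seq_pos_lower => y yl; have /FI : F y by rewrite Fl.
  by rewrite /= in_itv/= subr_gt0 => /andP[].
near=> r.
have rs : r < s by near: r; exact: nbhs_left_lt.
have sr : s - d < r by near: r; apply: nbhs_left_gt; lra.
have jA : (jsum g f 0 r <= A)%E.
  apply: ereal_sup_le => _ [G [fG GI] <-]; exists G => //; split => // x /GI.
  by rewrite /= !in_itv/= => /andP[-> /le_lt_trans]; apply.
have Fj : (\sum_(x \in F) (g (jump f x))%:E <= jsum g f 0 r)%E.
  apply: ereal_sup_ubound; exists F => //; split => // x Fx.
  have := FI _ Fx; rewrite /= !in_itv/= => /andP[-> _]/=.
  have : x \in l by move: Fx; rewrite Fl.
  by move=> /Hd; lra.
have jf : jsum g f 0 r \is a fin_num.
  by rewrite ge0_fin_numE ?jsum_ge0//; exact: (le_lt_trans jA Aoo).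
have h1 : fine (jsum g f 0 r) <= fine A by rewrite fine_le.
rewrite ger0_norm ?subr_ge0// lerBlDr -lerBlDl.
rewrite -lee_fin EFinB !fineK//.
exact: le_trans (ltW HF) Fj.
Unshelve. all: by end_near.
Qed.

Lemma jump_sub_path f s : 0 < s -> (jsum sqj f 0 s < +oo)%E ->
  jump (sub_path f) s = (jump f s) ^+ 2.
Proof.
move=> s0 Soo; have E := esum_open_right f sqj_ge0 s0.
have Aoo : (\esum_(x in `]0%R, s[) (sqj (jump f x))%:E < +oo)%E.
  by apply: le_lt_trans Soo; rewrite E leeDl// lee_fin sqj_ge0.
have Af : \esum_(x in `]0%R, s[) (sqj (jump f x))%:E \is a fin_num.
  by rewrite ge0_fin_numE//; apply: esum_ge0 => x _; rewrite lee_fin sqj_ge0.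
have /cvg_lim := jsum_left_lim sqj_ge0 s0 Aoo.
move=> /(_ (@Rhausdorff R)) L.
rewrite /jump; rewrite [X in _ - X]L sub_pathE E fineD// addrAC subrr add0r.
by [].
Qed.

(** Meant for times after an explosion of the squared jumps, where [fine] makes [sub_path] vanish
    identically. *)
Lemma jump_sub_path0 f r s : r < s ->
  (forall u, r < u <= s -> sub_path f u = 0) -> jump (sub_path f) s = 0.
Proof.
move=> rs H; rewrite /jump H ?rs ?lexx// sub0r; apply/eqP; rewrite oppr_eq0; apply/eqP.
apply/cvg_lim => //; apply: cvg_near_cst; near=> u.
apply: H; apply/andP; split; near: u; first exact: nbhs_left_gt.
exact: nbhs_left_le.
Unshelve. all: by end_near.
Qed.

Lemma cadlag_jump_bound f b : cadlag f ->
  exists2 K : R, 0 <= K & forall x, 0 < x <= b -> `|jump f x| <= K.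
Proof.
move=> cf; have [s [d [us sab d0 Hd]]] := cadlag_cover b cf (lexx 0) ltr01.
have [K K0 HK] : exists2 K : R, 0 <= K & forall x, x \in s -> `|jump f x| <= K.
  elim: (s) => [|x l [K K0 HK]]; first by exists 0.
  exists (Num.max K `|jump f x|); first by rewrite le_max K0.
  move=> y; rewrite inE => /orP[/eqP ->|/HK yl]; first by rewrite le_max lexx orbT.
  by rewrite le_max yl.
exists (Num.max K 1); first by rewrite le_max K0.
move=> x x0b; have [xs|xs] := boolP (x \in s); first by rewrite le_max HK.
by rewrite le_max; apply/orP; right; exact: (cover_jump_small cf (lexx 0) d0 Hd x0b).
Qed.

Lemma ln1D_ge (u : R) : 0 <= u -> u / (1 + u) <= ln (1 + u).
Proof.
move=> u0; have u1 : 0 < 1 + u by lra.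
have : ln (1 + u)^-1 <= (1 + u)^-1 - 1.
  rewrite -{1}[(1 + u)^-1](subrK 1) addrC; apply: le_ln1Dx.
  by rewrite ltrBrDl subrr invr_gt0.
rewrite lnV ?posrE// => H.
have -> : u / (1 + u) = 1 - (1 + u)^-1.
  by apply: (mulIf (lt0r_neq0 u1)); rewrite mulfVK ?lt0r_neq0// mulrBl mulVf ?lt0r_neq0//; lra.
lra.
Qed.

(** From ln (1 + u) >= u / (1 + u) with u at most [phi * K ^+ 2]. Jumps of a cadlag path are locally
    bounded, so summability of [lnj] over the jumps forces that of the squares. *)
Lemma sq_le_lnj phi (K : R) : 0 < phi -> 0 <= K ->
  exists2 C : R, 0 < C & forall x, `|x| <= K -> sqj x <= C * lnj phi x.
Proof.
move=> p0 K0; have K1 : 0 < 1 + phi * K ^+ 2.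
  by rewrite ltr_pwDl// mulr_ge0 ?sqr_ge0// ltW.
exists ((1 + phi * K ^+ 2) / phi); first by rewrite divr_gt0.
move=> x xK; rewrite /sqj /lnj.
have x2 : x ^+ 2 <= K ^+ 2.
  by rewrite -(@ger0_norm _ (x ^+ 2)) ?sqr_ge0// normrX lerXn2r ?nnegrE.
have u0 : 0 <= phi * x ^+ 2 by rewrite mulr_ge0 ?sqr_ge0// ltW.
have u1 : 0 < 1 + phi * x ^+ 2 by lra.
have := ln1D_ge u0; set l := ln _ => Hl.
have l0 : 0 <= l by apply: le_trans Hl; rewrite divr_ge0// ltW.
have H1 : phi * x ^+ 2 <= l * (1 + phi * x ^+ 2) by rewrite -ler_pdivrMr.
have H2 : l * (1 + phi * x ^+ 2) <= l * (1 + phi * K ^+ 2).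
  by rewrite ler_wpM2l// lerD2l ler_wpM2l// ltW.
rewrite -(ler_pM2l p0) (le_trans H1)// (le_trans H2)//.
by rewrite mulrA mulrC mulrA [phi * (_ / _)]mulrC divfK ?gt_eqF// mulrC.
Qed.

Lemma mem_enum_fset_set (F : set R) x : finite_set F ->
  x \in finmap.enum_fset (fset_set F) -> F x.
Proof. by move=> fF xF; apply/set_mem; rewrite -(in_fset_set fF). Qed.

Lemma esum_le_mul (A : set R) (g h : R -> R) (C : R) : 0 <= C ->
  (forall x, A x -> 0 <= h x) -> (forall x, A x -> g x <= C * h x) ->
  (\esum_(x in A) (h x)%:E < +oo)%E -> (\esum_(x in A) (g x)%:E < +oo)%E.
Proof.
move=> C0 h0 gh hoo.
have hf : \esum_(x in A) (h x)%:E \is a fin_num.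
  by rewrite ge0_fin_numE//; apply: esum_ge0 => x /h0; rewrite lee_fin.
apply: (@le_lt_trans _ _ (C * fine (\esum_(x in A) (h x)%:E))%:E); last by rewrite ltry.
apply: ge_ereal_sup => _ [F [fF FA] <-].
rewrite fsbig_finite//= sumEFin lee_fin.
apply: (@le_trans _ _ (\sum_(x <- finmap.enum_fset (fset_set F)) C * h x)).
  rewrite big_seq [leRHS]big_seq; apply: ler_sum => x.
  by move=> /(mem_enum_fset_set fF)/FA/gh.
rewrite -mulr_sumr ler_wpM2l// -lee_fin fineK//.
by apply: ereal_sup_ubound; exists F => //; rewrite fsbig_finite//= sumEFin.
Qed.

(* A dense sequence of times, used to take countable infima. *)
Definition ratseq (n : nat) : R := ratr (odflt 0%R (unpickle n : option rat)).

Lemma ratseq_dense x (y : R) : x < y -> exists n, x < ratseq n < y.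
Proof.
move=> /rat_in_itvoo[q]; rewrite in_itv/= => H.
by exists (pickle q); rewrite /ratseq pickleK.
Qed.

(* The value of the sum of [ln (1 + phi * jump)] over the jumps of [sub_path f],
   also when the sum of the squared jumps of [f] explodes at some time tau: then
   it is the sum up to tau, recovered from the rational times after tau. *)
Definition lnsum f phi t : \bar R :=
  if (jsum sqj f 0 t < +oo)%E then jsum (lnj phi) f 0 t
  else esups (fun m => einfs (fun n =>
    if (jsum sqj f 0 (ratseq n) < +oo)%E then +oo%E
    else jsum (trunc (lnj phi) m) f 0 (ratseq n)) 0%N) 0%N.

Lemma esups0E (u : nat -> \bar R) : esups u 0%N = ereal_sup (range u).
Proof. by rewrite /esups/= /sdrop; congr ereal_sup; apply/seteqP; split => x [n _ <-]; exists n => //. Qed.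

Lemma einfs0E (u : nat -> \bar R) : einfs u 0%N = ereal_inf (range u).
Proof. by rewrite /einfs/= /sdrop; congr ereal_inf; apply/seteqP; split => x [n _ <-]; exists n => //. Qed.

Lemma jsum_sup gm g f a b : approx gm g ->
  jsum g f a b = ereal_sup (range (fun m => jsum (gm m) f a b)).
Proof.
move=> H; apply/(@cvg_unique _ (@ereal_hausdorff R) (jsum (gm m) f a b @[m --> \oo])).
  exact: jsum_cvg.
by apply: ereal_nondecreasing_cvgn; exact: (jsum_nd f a b H).
Qed.

(** Let [tau] be the infimum of the times at which the squared jumps have infinite sum. Before [tau]
    the jumps of [sub_path] are the squared jumps of [f], after [tau] there are none. The cases are:
    no explosion up to [t], explosion right after [tau], explosion at [tau]. *)
Lemma lnsumE f phi t : cadlag f -> 0 < phi -> 0 <= t ->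
  fine (\esum_(s in `]0%R, t]) (ln (1 + phi * jump (sub_path f) s))%:E) =
  fine (lnsum f phi t).
Proof.
move=> cf p0 t0; rewrite /lnsum.
have pp := ltW p0.
have [Soo|] := boolP (jsum sqj f 0 t < +oo)%E.
  congr fine; apply: eq_esum => s; rewrite /= in_itv/= => /andP[s0 st].
  rewrite jump_sub_path//; apply: le_lt_trans Soo; apply: le_jsum => //; exact: sqj_ge0.
rewrite -leNgt leye_eq => /eqP St.
pose U : set R := [set u | 0 <= u /\ jsum sqj f 0 u = +oo%E].
have Ut : U t by [].
have hU : has_inf U by split; [exists t|exists 0 => u []].
pose tau := inf U.
have tau0 : 0 <= tau by apply: lb_le_inf; [exists t|move=> u []].
have taut : tau <= t by apply: ge_inf => //; case: hU.
have below u : u < tau -> (jsum sqj f 0 u < +oo)%E.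
  move=> ut; have [u0|u0] := lerP 0 u; last first.
    by rewrite /jsum set_itv_ge ?esum_set0// bnd_simp -leNgt ltW.
  rewrite ltNge leye_eq; apply/negP => /eqP uo.
  have : tau <= u by apply: ge_inf => //; case: hU.
  by rewrite leNgt ut.
have above u : tau < u -> jsum sqj f 0 u = +oo%E.
  move=> tu; have [v [v0 vo] vu] : exists2 v, U v & v < u.
    have [v Uv vu] := inf_adherent (eps := u - tau) ltac:(lra) hU.
    by exists v => //; move: vu; rewrite -/tau addrC subrK.
  apply/eqP; rewrite -leye_eq -vo; apply: le_jsum => //; [exact: sqj_ge0|exact: ltW].
have lz x : 0 <= lnj phi x by exact: lnj_ge0.
(* If the sum at [tau] is still finite, the explosion is produced by jumps accumulating at [tau]
   from the right, and the logarithmic sum stops at [tau]. *)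
have [Stau|] := boolP (jsum sqj f 0 tau < +oo)%E.
  have tt : tau < t.
    by rewrite lt_neqAle taut andbT; apply/eqP => tE; move: Stau; rewrite tE St.
  have -> : \esum_(s in `]0%R, t]) (ln (1 + phi * jump (sub_path f) s))%:E =
     jsum (lnj phi) f 0 tau.
    rewrite /jsum esum_mkcond [RHS]esum_mkcond; apply: eq_esum => s _.
    have [stau|taus] := lerP s tau.
      have -> : (s \in `]0, tau]%classic) = (s \in `]0, t]%classic).
        by apply/idP/idP; rewrite !inE/= !in_itv/= stau (le_trans stau taut).
      case: ifPn => // /set_mem/=; rewrite in_itv/= => /andP[s0 st].
      rewrite jump_sub_path//; apply: le_lt_trans Stau.
      by apply: le_jsum => //; exact: sqj_ge0.
    have -> : (s \in `]0, tau]%classic) = false.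
      by apply/negP; rewrite inE/= in_itv/= leNgt taus andbF.
    case: ifPn => // _.
    rewrite (@jump_sub_path0 f tau s)//; first by rewrite mulr0 addr0 ln1.
    by move=> u /andP[tu _]; rewrite sub_pathE above.
  congr fine; rewrite (jsum_sup f 0 tau (approx_lnj pp)) esups0E; congr ereal_sup.
  apply: eq_imagel => m _; rewrite einfs0E.
  have am : away (trunc (lnj phi) m) by case: (approx_lnj pp).
  have am0 := away_nneg am.
  apply/eqP; rewrite eq_le; apply/andP; split.
    apply: le_ereal_inf_tmp => _ [n _ <-]; case: ifPn => [_|]; first exact: leey.
    rewrite -leNgt leye_eq => /eqP So; apply: le_jsum => //.
    rewrite leNgt; apply/negP => qt.
    by have := below _ qt; rewrite So ltxx.
  (* A rational time just after [tau] has already exploded but adds no jump that the truncation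
     counts, so the infimum is attained there. *)
  have [d d0 Hd] := jsum_small cf am tau0.
  have [n /andP[n1 n2]] := @ratseq_dense tau (tau + d) ltac:(lra).
  apply: ge_ereal_inf; exists (jsum (trunc (lnj phi) m) f 0 (ratseq n)).
    by exists n => //; rewrite above// ltxx.
  by rewrite (@jsumD _ f _ 0 tau)// ?Hd ?adde0// ltW.
rewrite -leNgt leye_eq => /eqP Stau.
have taup : 0 < tau.
  rewrite lt_neqAle tau0 andbT; apply/eqP => t00.
  by move: Stau; rewrite -t00 jsum_nil.
(* The jump at [tau] is one finite term, so the squares already have infinite sum before [tau];
   bounded jumps transfer this to [lnj]. Both sides of the goal are then [fine] of an infinite
   sum. *)
have Aoo : \esum_(x in `]0%R, tau[) (lnj phi (jump f x))%:E = +oo%E.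
  apply/eqP/negPn/negP => Hn.
  have [K K0 HK] := cadlag_jump_bound tau cf.
  have [C C0 HC] := sq_le_lnj p0 K0.
  have : (\esum_(x in `]0%R, tau[) (sqj (jump f x))%:E < +oo)%E.
    apply: (@esum_le_mul _ _ (fun x => lnj phi (jump f x)) C) => //; first exact: ltW.
    + move=> x; rewrite /= in_itv/= => /andP[x0 xt]; apply: HC; apply: HK.
      by rewrite x0 ltW.
    + by rewrite ltey.
  move: Stau; rewrite (esum_open_right f sqj_ge0 taup).
  by case: (\esum_(x in _) _).
have -> : \esum_(s in `]0%R, t]) (ln (1 + phi * jump (sub_path f) s))%:E = +oo%E.
  apply/eqP; rewrite -leye_eq -Aoo; apply: ge_ereal_sup => _ [F [fF FI] <-].
  apply: ereal_sup_ubound; exists F.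
    split => // x /FI; rewrite /= !in_itv/= => /andP[-> /ltW xt].
    exact: le_trans xt taut.
  apply: eq_fsbigr => x /set_mem/FI; rewrite /= in_itv/= => /andP[x0 xt].
  by rewrite jump_sub_path// below.
suff -> : esups (fun m => einfs (fun n =>
    if (jsum sqj f 0 (ratseq n) < +oo)%E then +oo%E
    else jsum (trunc (lnj phi) m) f 0 (ratseq n)) 0%N) 0%N = +oo%E by [].
apply/eqP; rewrite -leye_eq.
apply: (@le_trans _ _ (jsum (lnj phi) f 0 tau)).
  by rewrite (esum_open_right f lz taup) Aoo.
rewrite (jsum_sup f 0 tau (approx_lnj pp)) esups0E.
apply: ge_ereal_sup => _ [m _ <-].
apply: le_ereal_sup_tmp.
eexists; first by exists m.
have am : away (trunc (lnj phi) m) by case: (approx_lnj pp).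
rewrite einfs0E; apply: le_ereal_inf_tmp => _ [n _ <-]; case: ifPn => [_|]; first exact: leey.
rewrite -leNgt leye_eq => /eqP So; apply: le_jsum => //; first exact: away_nneg.
rewrite leNgt; apply/negP => qt.
by have := below _ qt; rewrite So ltxx.
Qed.

End SubPath.

(** * Joint measurability in the path and in time *)

Section Measurability.
Context {R : realType} {d : measure_display} {T : measurableType d}.
Context (M : R -> T -> R).
Hypothesis mM : forall t, 0 <= t -> measurable_fun setT (M t).
Hypothesis cM : forall w, cadlag (M ^~ w).
Implicit Types (g : R -> R) (a b s t x phi : R).

Lemma measurable_bsum g a b N : continuous g -> 0 <= a -> a <= b ->
  measurable_fun setT (fun w => bsum g (M ^~ w) a b N).
Proof.
move=> gc a0 ab; rewrite /bsum.
apply: measurable_sum => k.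
have gr j : 0 <= grid a b N.+1 j.
  by rewrite (le_trans a0)// -[X in X <= _](grid0 a b N.+1) grid_le.
apply: (measurableT_comp (continuous_measurable_fun gc)).
by apply: measurable_funB; exact: mM.
Qed.

Lemma measurable_jsum_away g a b : away g -> 0 <= a ->
  measurable_fun setT (fun w => jsum g (M ^~ w) a b).
Proof.
move=> ag a0; have [ab|ba] := lerP a b; last first.
  rewrite [X in measurable_fun _ X](_ : _ = cst 0%E); first exact: measurable_cst.
  by apply/funext => w; rewrite /jsum set_itv_ge ?esum_set0// bnd_simp -leNgt ltW.
rewrite [X in measurable_fun _ X](_ : _ = (fun w => (fine (jsum g (M ^~ w) a b))%:E)); last first.
  by apply/funext => w; rewrite fineK// jsum_away_fin.
apply/measurable_EFinP.
apply: (@measurable_fun_cvg _ _ _ _ (fun N w => bsum g (M ^~ w) a b N)).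
  by move=> N; apply: measurable_bsum => //; case: ag.
by move=> w _; have [] := bsum_cvg (cM w) a0 ab ag.
Qed.

Lemma measurable_jsum gm g a b : approx gm g -> 0 <= a ->
  measurable_fun setT (fun w => jsum g (M ^~ w) a b).
Proof.
move=> H a0; apply: (@emeasurable_fun_cvg _ _ _ _ (fun m w => jsum (gm m) (M ^~ w) a b)).
  by move=> m; apply: measurable_jsum_away => //; case: H.
by move=> w _; exact: jsum_cvg.
Qed.

Lemma jsum_neg g f s : s <= 0 -> jsum g f 0 s = 0%E.
Proof. by move=> s0; rewrite /jsum set_itv_ge ?esum_set0// bnd_simp -leNgt. Qed.

(** The sum is nondecreasing and right continuous in its endpoint, so it is below [r] at time [s]
    exactly when it is below [r] at some rational time after [s]: a countable union of
    rectangles. *)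
Lemma measurable_jsum_away2 g : away g ->
  measurable_fun setT (fun ws : T * R => jsum g (M ^~ ws.1) 0 ws.2).
Proof.
move=> ag; have g0 := away_nneg ag.
apply: (measurability _ (ErealGenInftyO.measurableE R)) => _ /= -[_ [r ->] <-].
rewrite setTI.
rewrite [X in measurable X](_ : _ = \bigcup_n
  ([set w | (jsum g (M ^~ w) 0 (ratseq n) < r%:E)%E] `*` `]-oo, ratseq n[%classic)).
  apply: bigcup_measurable => n _; apply: measurableX; last exact: measurable_itv.
  have := measurable_jsum_away (ratseq n) ag (lexx 0).
  by move=> /emeasurable_fun_infty_o -/(_ measurableT r%:E); rewrite setTI.
apply/seteqP; split => [[w s]|[w s] [n _ []]] /=; rewrite !in_itv/=.
  move=> jr; have [s0|s0] := ltrP s 0.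
    have [n /andP[n1 n2]] := ratseq_dense s0; exists n => //; split => /=.
      by move: jr; rewrite !jsum_neg// ltW.
    by rewrite in_itv.
  have [dd d0 Hd] := jsum_small (cM w) ag s0.
  have [n /andP[n1 n2]] := @ratseq_dense R s (s + dd) ltac:(lra).
  exists n => //; split => /=; last by rewrite in_itv.
  by rewrite (@jsumD _ _ _ 0 s)// ?Hd ?adde0// ltW.
move=> jr sn; apply: le_lt_trans jr; apply: le_jsum => //; exact: ltW.
Qed.

Lemma measurable_jsum2 gm g : approx gm g ->
  measurable_fun setT (fun ws : T * R => jsum g (M ^~ ws.1) 0 ws.2).
Proof.
move=> H; apply: (@emeasurable_fun_cvg _ _ _ _ (fun m ws => jsum (gm m) (M ^~ ws.1) 0 ws.2)).
  by move=> m; apply: measurable_jsum_away2 => //; case: H.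
by move=> w _; exact: jsum_cvg.
Qed.

Lemma measurable_lnsum2 phi : 0 <= phi ->
  measurable_fun setT (fun ws : T * R => lnsum (M ^~ ws.1) phi ws.2).
Proof.
move=> p0; rewrite /lnsum; apply: measurable_fun_ifT.
- by apply: measurable_fun_lte; [exact: (measurable_jsum2 approx_sq)|exact: measurable_cst].
- exact: (measurable_jsum2 (approx_lnj p0)).
- apply: measurable_fun_esups => m; apply: measurable_fun_einfs => n.
  rewrite -[X in measurable_fun _ X]/((fun w : T =>
    if (jsum sqj (M ^~ w) 0 (ratseq n) < +oo)%E then +oo%E
    else jsum (trunc (lnj phi) m) (M ^~ w) 0 (ratseq n)) \o fst).
  apply: measurableT_comp => //; apply: measurable_fun_ifT => //.
  + by apply: measurable_fun_lte; [exact: (measurable_jsum _ approx_sq (lexx 0))|exact: measurable_cst].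
  + by apply: measurable_jsum_away => //; case: (approx_lnj p0).
Qed.

(** [phi = 0] is set apart because [lnsumE] bounds squares by multiples of [lnj phi], which takes
    [phi > 0]. *)
Lemma cogarch_XE eta phi s f : cadlag f -> 0 <= phi ->
  cogarch_X eta phi f s = eta * s - (if phi == 0 then 0 else fine (lnsum f phi s)).
Proof.
move=> cf; rewrite le_eqVlt eq_sym => /orP[/eqP ->|p0].
  rewrite eqxx /cogarch_X esum1//= => x _.
  by rewrite mul0r addr0 ln1.
rewrite gt_eqF// /cogarch_X; congr (_ - _).
have [s0|s0] := lerP 0 s; first exact: lnsumE.
have e0 : `]0, s]%classic = set0 :> set R by rewrite set_itv_ge// bnd_simp -leNgt ltW.
by rewrite e0 esum_set0 /lnsum !jsum_neg ?ltW//= ltry.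
Qed.

Lemma measurable_cogarch_X2 eta phi : 0 <= phi ->
  measurable_fun setT (fun ws : T * R => cogarch_X eta phi (M ^~ ws.1) ws.2).
Proof.
move=> p0; rewrite [X in measurable_fun _ X](_ : _ = (fun ws : T * R =>
   eta * ws.2 - (if phi == 0 then 0 else fine (lnsum (M ^~ ws.1) phi ws.2)))); last first.
  by apply/funext => ws; exact: cogarch_XE.
apply: measurable_funB; first by apply: measurable_funM => //; exact: measurable_cst.
case: (phi == 0); first exact: measurable_cst.
by apply: measurableT_comp; [exact: fine_measurable|exact: measurable_lnsum2].
Qed.

End Measurability.

Import HBNNSimple.

(** * Monotone convergence and integrals of products of independent variables *)

Section MonotoneReal.
Context {R : realType} {d : measure_display} {T : measurableType d}.
Context (P : {measure set T -> \bar R}).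

Lemma cvg_monotone_real (D : set T) (u : nat -> T -> R) (v : T -> R) : measurable D ->
  (forall n, measurable_fun D (u n)) -> (forall n w, 0 <= u n w) ->
  (forall w, nondecreasing_seq (u ^~ w)) ->
  (forall w, D w -> u n w @[n --> \oo] --> v w) ->
  (\int[P]_(w in D) (u n w)%:E @[n --> \oo] --> \int[P]_(w in D) (v w)%:E)%E.
Proof.
move=> mD mu u0 und uv.
have -> : (\int[P]_(w in D) (v w)%:E = \int[P]_(w in D) limn (fun n => (u n w)%:E))%E.
  apply: eq_integral => w /set_mem Dw; apply/esym/cvg_lim => //.
  by apply: cvg_EFin; [exact: nearW|exact: uv].
apply: cvg_monotone_convergence => //.
- by move=> n; apply/measurable_EFinP.
- by move=> n w _; rewrite lee_fin.
- by move=> w _ m n mn; rewrite lee_fin und.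
Qed.

End MonotoneReal.

Section IndepProduct.
Context {R : realType} {d : measure_display} {T : measurableType d}.
Context (P : probability T R).

Lemma integral_mul_nnsfun (h f : T -> R) (g : {nnsfun R >-> R}) :
  (forall w, 0 <= h w) -> measurable_fun setT h -> measurable_fun setT f ->
  (\int[P]_w (h w * g (f w))%:E =
   \sum_(r \in range g) (r%:E * \int[P]_w (h w * \1_(f @^-1` (g @^-1` [set r])) w)%:E))%E.
Proof.
move=> h0 mh mf.
have mA r : measurable (f @^-1` (g @^-1` [set r])).
  by rewrite -[X in measurable X]setTI; apply: mf => //; rewrite -[X in measurable X]setTI; exact: measurable_funPT.
transitivity (\int[P]_w \sum_(r \in range g)
    (r * (h w * \1_(f @^-1` (g @^-1` [set r])) w))%:E)%E.
  apply: eq_integral => w _; rewrite fimfunE !fsbig_finite//= sumEFin mulr_sumr.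
  by congr EFin; apply: eq_bigr => r _; rewrite mulrCA.
rewrite ge0_integral_fsum//.
- apply: eq_fsbigr => r /set_mem[y _ <-].
  under eq_integral do rewrite EFinM.
  rewrite ge0_integralZl_EFin//.
  + by move=> w _; rewrite lee_fin mulr_ge0.
  + apply/measurable_EFinP; apply: measurable_funM => //.
- move=> r; apply/measurable_EFinP; apply: measurable_funM => //.
  by apply: measurable_funM.
- move=> r w _; rewrite lee_fin; have [rg|] := boolP (r \in range g).
    by move/set_mem: rg => [y _ <-]; rewrite !mulr_ge0.
  move=> /negP rg; rewrite indicE memNset ?mulr0//= => gr.
  by apply: rg; apply/mem_set; exists (f w).
Qed.

(** Factorization for indicators of [f] extends to simple functions of [f] by linearity and to [f]
    by monotone convergence. *)
Lemma integral_mul_indep (h f : T -> R) (c : \bar R) :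
  (forall w, 0 <= h w) -> measurable_fun setT h ->
  (forall w, 0 <= f w) -> measurable_fun setT f ->
  c \is a fin_num -> (0 <= c)%E ->
  (forall B, measurable B ->
    \int[P]_w (h w * \1_(f @^-1` B) w)%:E = c * P (f @^-1` B))%E ->
  (\int[P]_w (h w * f w)%:E = c * \int[P]_w (f w)%:E)%E.
Proof.
move=> h0 mh f0 mf cf c0 H.
(* The identity is cut at 0 because the approximation by simple functions is for nonnegative
   functions; on the values of [f] nothing changes. *)
have mid : measurable_fun setT (fun x : R => (Num.max 0 x)%:E).
  by apply/measurable_EFinP; apply: measurable_maxr.
pose g := nnsfun_approx measurableT mid.
have gcvg x : 0 <= x -> g n x @[n --> \oo] --> x.
  move=> x0.
  have g0 (y : R) : [set: R] y -> (0 <= (Num.max 0 y)%:E)%E by rewrite lee_fin le_max lexx.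
  have := cvg_nnsfun_approx measurableT mid g0 (x := x) I.
  by rewrite (max_idPr _)// => /fine_cvgP[_].
have gnd x : nondecreasing_seq (fun n => g n x).
  by move=> m n mn; have /lefP := nd_nnsfun_approx measurableT mid mn; exact.
have mgf n : measurable_fun setT (fun w => g n (f w)) by exact: measurableT_comp.
have cvgh : (\int[P]_w (h w * g n (f w))%:E @[n --> \oo] --> \int[P]_w (h w * f w)%:E)%E.
  apply: (cvg_monotone_real measurableT).
  - by move=> n; apply: measurable_funM.
  - by move=> n w; rewrite mulr_ge0.
  - by move=> w m n mn; rewrite ler_wpM2l// gnd.
  - by move=> w _; apply: cvgM; [exact: cvg_cst|exact: gcvg].
have cvg1 : (\int[P]_w (1 * g n (f w))%:E @[n --> \oo] --> \int[P]_w (1 * f w)%:E)%E.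
  apply: (cvg_monotone_real measurableT).
  - by move=> n; apply: measurable_funM.
  - by move=> n w; rewrite mulr_ge0.
  - by move=> w m n mn; rewrite ler_wpM2l// gnd.
  - by move=> w _; apply: cvgM; [exact: cvg_cst|exact: gcvg].
have mA n r : measurable (f @^-1` (g n @^-1` [set r])).
  by rewrite -[X in measurable X]setTI; apply: mf => //; rewrite -[X in measurable X]setTI; exact: measurable_funPT.
have E n : (\int[P]_w (h w * g n (f w))%:E = c * \int[P]_w (1 * g n (f w))%:E)%E.
  rewrite !(integral_mul_nnsfun (f := f) _)//.
  rewrite ge0_mule_fsumr; last first.
    move=> r; have [rg|] := boolP (r \in range (g n)).
      move/set_mem: rg => [y _ <-]; rewrite mule_ge0 ?lee_fin//.
      by apply: integral_ge0 => w _; rewrite lee_fin mul1r.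
    move=> /negP rg; rewrite (_ : (\int[P]_w _)%E = 0%E) ?mule0//.
    apply: integral0_eq => w _; rewrite indicE memNset ?mulr0//= => gr.
    by apply: rg; apply/mem_set; exists (f w).
  apply: eq_fsbigr => r _; rewrite muleCA; congr (_ * _)%E.
  rewrite H; last by rewrite -[X in measurable X]setTI; exact: measurable_funPT.
  under eq_integral do rewrite mul1r.
  by rewrite integral_indic// setIT.
have c2 : (\int[P]_w (h w * g n (f w))%:E @[n --> \oo] --> c * \int[P]_w (f w)%:E)%E.
  under eq_cvg do rewrite E.
  have -> : (\int[P]_w (f w)%:E = \int[P]_w (1 * f w)%:E)%E.
    by apply: eq_integral => w _; rewrite mul1r.
  by apply: cvgeZl.
exact: (cvg_unique (@ereal_hausdorff R) cvgh c2).
Qed.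

Lemma prod_indic (I : eqType) (s : seq I) (A : I -> set T) w :
  \prod_(j <- s) (\1_(A j) w : R) = \1_(\bigcap_(j in [set` s]) A j) w.
Proof.
elim: s => [|i s IH].
  rewrite big_nil (_ : \bigcap_(j in _) _ = setT) ?indicT//.
  by apply/seteqP; split.
rewrite big_cons IH (_ : \bigcap_(j in [set` i :: s]) A j =
    A i `&` \bigcap_(j in [set` s]) A j); first by rewrite indicI.
apply/seteqP; split => [v Hv|v [Hi Hs] j /=].
  by split; [apply: Hv; rewrite /= mem_head|move=> j /= js; apply: Hv; rewrite /= inE js orbT].
by rewrite inE => /orP[/eqP -> //|]; exact: Hs.
Qed.

(** Indicators are exchanged for functions one index at a time, by [integral_mul_indep]. *)
Lemma integral_prod_indep (I : eqType) (J : seq I) (f : I -> T -> R) : uniq J ->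
  (forall j, measurable_fun setT (f j)) -> (forall j w, 0 <= f j w) ->
  (forall j, j \in J -> \int[P]_w (f j w)%:E < +oo)%E ->
  (forall B : I -> set R, (forall j, measurable (B j)) ->
    P (\bigcap_(j in [set` J]) f j @^-1` B j) = \big[*%E/1%E]_(j <- J) P (f j @^-1` B j)) ->
  (\int[P]_w (\prod_(j <- J) f j w)%:E = \big[*%E/1%E]_(j <- J) \int[P]_w (f j w)%:E)%E.
Proof.
move=> uJ mf f0 foo H.
have mfB j (B : set R) : measurable B -> measurable (f j @^-1` B).
  by move=> mB; rewrite -[X in measurable X]setTI; exact: mf.
(* Mixed form for the induction: functions on [J1], indicators on [J2]. For [J1] empty it is the
   independence of the events. *)
suff K (J1 J2 : seq I) : perm_eq (J1 ++ J2) J -> forall B, (forall j, measurable (B j)) ->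
    (\int[P]_w ((\prod_(j <- J1) f j w) * \prod_(j <- J2) \1_(f j @^-1` B j) w)%:E =
    \big[*%E/1%E]_(j <- J1) \int[P]_w (f j w)%:E * \big[*%E/1%E]_(j <- J2) P (f j @^-1` B j))%E.
  have := K J [::]; rewrite cats0 => /(_ (perm_refl _) (fun=> setT) (fun=> measurableT)).
  rewrite big_nil mule1 => <-; apply: eq_integral => w _.
  by rewrite big_nil mulr1.
elim: J1 J2 => [|i J1 IH] J2 pJ B mB.
  rewrite big_nil mul1e; transitivity (P (\bigcap_(j in [set` J2]) f j @^-1` B j)).
    under eq_integral do rewrite big_nil mul1r prod_indic.
    rewrite integral_indic// ?setIT//.
    by apply: fin_bigcap_measurable => // j _; exact: mfB.
  rewrite (perm_big _ pJ) /= -H//; congr (P _).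
  by apply/seteqP; split => w Hw j /= jJ; apply: Hw => /=; rewrite ?(perm_mem pJ)// -(perm_mem pJ).
have iJ2 : i \notin J2.
  have : uniq ((i :: J1) ++ J2) by rewrite (perm_uniq pJ).
  by rewrite /= mem_cat negb_or => /andP[/andP[]].
have J1J : {subset (i :: J1) <= J}.
  by move=> j jJ; rewrite -(perm_mem pJ) mem_cat jJ.
have mP : measurable_fun setT (fun w => (\prod_(j <- J1) f j w) *
    \prod_(j <- J2) \1_(f j @^-1` B j) w).
  apply: measurable_funM; first by apply: measurable_prod.
  by apply: measurable_prod => j _; apply: measurable_indic; exact: mfB.
have P0 w : 0 <= (\prod_(j <- J1) f j w) * \prod_(j <- J2) \1_(f j @^-1` B j) w.
  by rewrite mulr_ge0// prodr_ge0.
have Hc : (\big[*%E/1%E]_(j <- J1) \int[P]_w (f j w)%:E * \big[*%E/1%E]_(j <- J2) P (f j @^-1` B j))%E \is a fin_num.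
  rewrite fin_numM//.
    rewrite big_seq prode_fin_num// => j jJ; rewrite ge0_fin_numE ?foo//.
      by apply: J1J; rewrite inE jJ orbT.
    by apply: integral_ge0 => w _; rewrite lee_fin.
  by rewrite prode_fin_num// => j jJ; apply: fin_num_measure; exact: mfB.
have Hc0 : (0 <= \big[*%E/1%E]_(j <- J1) \int[P]_w (f j w)%:E * \big[*%E/1%E]_(j <- J2) P (f j @^-1` B j))%E.
  rewrite mule_ge0//; last by rewrite prode_ge0.
  by rewrite prode_ge0// => j _; apply: integral_ge0 => w _; rewrite lee_fin.
have := integral_mul_indep P0 mP (f0 i) (mf i) Hc Hc0.
move=> K; rewrite big_cons -muleA muleC -K.
  by apply: eq_integral => w _; rewrite big_cons -mulrA mulrC.
move=> B' mB'.
(* The indicator of [f i] in [B'] joins those of [J2]; the induction hypothesis then gives the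
   premise of [integral_mul_indep]. *)
have p2 : perm_eq (J1 ++ i :: J2) J.
  by apply: perm_trans pJ; rewrite (perm_catCA J1 [:: i] J2).
have mB2 j : measurable (if j == i then B' else B j) by case: ifP.
have := IH (i :: J2) p2 (fun j => if j == i then B' else B j) mB2.
rewrite big_cons eqxx => E.
have B2 (A : Type) (op : A -> A -> A) (x : A) (F : I -> set R -> A) :
    \big[op/x]_(j <- J2) F j (if j == i then B' else B j) = \big[op/x]_(j <- J2) F j (B j).
  apply: eq_big_seq => j jJ; case: eqP => // ji.
  by move: iJ2; rewrite -ji jJ.
rewrite (B2 _ _ _ (fun j C => P (f j @^-1` C))) in E.
rewrite -muleA [X in _ = (_ * X)%E]muleC -E; apply: eq_integral => w _.
rewrite big_cons eqxx (B2 _ _ _ (fun j C => \1_(f j @^-1` C) w)).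
by rewrite -mulrA; congr (_ * _)%:E; rewrite mulrC.
Qed.

End IndepProduct.

(** * Integrals of functions equal almost everywhere *)

Section AeIntegral.
Import HBNNSimple.
Context {R : realType} {d : measure_display} {T : measurableType d}.
Context (mu : {measure set T -> \bar R}).
Local Open Scope ereal_scope.

(* No measurability is needed: the integral of a nonnegative function is a
   supremum over the simple functions below it, which can be truncated to the
   complement of a null set. *)
Lemma ae_integral (D : set T) (f g : T -> \bar R) :
  {ae mu, forall x, D x -> f x = g x} ->
  \int[mu]_(x in D) f x = \int[mu]_(x in D) g x.
Proof.
have key (u v : T -> \bar R) : (forall x, 0 <= u x) -> (forall x, 0 <= v x) ->
    {ae mu, forall x, u x = v x} ->
    \int[mu]_x u x <= \int[mu]_x v x.
  move=> u0 v0 [N [mN N0 HN]].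
  rewrite !ge0_integralTE//; apply: ge_ereal_sup => _ [h /= hu <-].
  have mNC : measurable (~` N) by exact: measurableC.
  apply: le_ereal_sup_tmp.
  exists (sintegral mu (mul_nnsfun h (indic_nnsfun R mNC))).
    exists (mul_nnsfun h (indic_nnsfun R mNC)) => // x.
    have -> : mul_nnsfun h (indic_nnsfun R mNC) x = (h x * \1_(~` N) x)%R by [].
    have [xN|xN] := pselect (N x).
      rewrite (_ : \1_(~` N) x = 0%R :> R) ?mulr0//.
      by rewrite indicE memNset// => /(_ xN).
    rewrite indicE mem_set// mulr1; suff <- : u x = v x by exact: hu.
    by apply: contrapT => uv; apply: xN; exact: HN.
  rewrite -!integralT_nnsfun le_eqVlt; apply/orP; left; apply/eqP.
  apply: ge0_ae_eq_integral => //.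
  - by apply/measurable_EFinP.
  - by apply/measurable_EFinP.
  - by move=> x _; rewrite lee_fin.
  - move=> x _; rewrite lee_fin; suff: (0 <= h x * \1_(~` N) x)%R by [].
    by rewrite mulr_ge0.
  - exists N; split => // x /= Hx; apply: contrapT => xN; apply: Hx => _.
    suff E : h x = (h x * \1_(~` N) x)%R by congr EFin; exact: E.
    by rewrite indicE mem_set ?mulr1.
move=> fg.
have fgD : {ae mu, forall x, (f \_ D) x = (g \_ D) x}.
  apply: filterS fg => x fgx; rewrite /patch; case: ifPn => // /set_mem; exact: fgx.
have gfD : {ae mu, forall x, (g \_ D) x = (f \_ D) x} by apply: filterS fgD.
rewrite integral_mkcond [RHS]integral_mkcond integralE [RHS]integralE.
have pos u v : {ae mu, forall x, u x = v x} -> \int[mu]_x (u^\+ x) <= \int[mu]_x (v^\+ x).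
  by move=> uv; apply: key => //; apply: filterS uv => x; rewrite !funeposE => ->.
have neg u v : {ae mu, forall x, u x = v x} -> \int[mu]_x (u^\- x) <= \int[mu]_x (v^\- x).
  by move=> uv; apply: key => //; apply: filterS uv => x; rewrite !funenegE => ->.
by congr (_ - _); apply/eqP; rewrite eq_le ?pos ?neg.
Qed.

End AeIntegral.

(** * Products over the increments of a Levy process *)

Section JumpLaw.
Context {R : realType}.
Implicit Types (g : R -> R) (f : R -> R) (a b s t x : R).

Lemma awayZ (c : R) g : 0 <= c -> away g -> away (fun x => c * g x).
Proof.
move=> c0 [gc g0 [e e0 ge]]; split.
- by move=> x; apply: cvgM; [exact: cvg_cst|exact: gc].
- by move=> x; rewrite mulr_ge0.
- by exists e => // x /ge ->; rewrite mulr0.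
Qed.

Lemma fine_jsumZ (c : R) g f a b : cadlag f -> 0 <= c -> away g -> 0 <= a -> a <= b ->
  fine (jsum (fun x => c * g x) f a b) = c * fine (jsum g f a b).
Proof.
move=> cf c0 ag a0 ab.
have [_ c1] := bsum_cvg cf a0 ab (awayZ c0 ag).
have [_ c2] := bsum_cvg cf a0 ab ag.
have c3 : bsum (fun x => c * g x) f a b N @[N --> \oo] --> c * fine (jsum g f a b).
  rewrite [X in X @ _ --> _](_ : _ = (fun N => c * bsum g f a b N)).
    by apply: cvgM; [exact: cvg_cst|exact: c2].
  by apply/funext => N; rewrite /bsum mulr_sumr.
exact: (cvg_unique (@Rhausdorff R) c1 c3).
Qed.

Lemma bsum_ge0 g f a b N : (forall x, 0 <= g x) -> 0 <= bsum g f a b N.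
Proof. by move=> g0; rewrite /bsum; apply: sumr_ge0. Qed.

Lemma fine_jsum_ge0 g f a b : (forall x, 0 <= g x) -> 0 <= fine (jsum g f a b).
Proof. by move=> g0; apply: fine_ge0; exact: jsum_ge0. Qed.

Lemma integral_le1 d (T : measurableType d) (P : probability T R) (f : T -> R) :
  measurable_fun setT f -> (forall w, 0 <= f w <= 1) ->
  (\int[P]_w (f w)%:E <= 1)%E.
Proof.
move=> mf f01; have f0 w : 0 <= f w by have /andP[] := f01 w.
have f1 w : f w <= 1 by have /andP[] := f01 w.
apply: (@le_trans _ _ (\int[P]_w (cst 1%E w))%E).
  apply: ge0_le_integral => //; [by move=> w _; rewrite lee_fin|exact/measurable_EFinP|
       by move=> w _; rewrite lee_fin].
by rewrite integral_cst// mul1e; exact: probability_le1.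
Qed.

Section OneProcess.
Context {d} {T : measurableType d} (P : probability T R) (M : R -> {RV P >-> R}).
Context {d0} {T0 : measurableType d0} (P0 : probability T0 R) (L : R -> {RV P0 >-> R}).
Hypothesis levyM : levy_process M.
Hypothesis margM : forall h, 0 <= h -> forall A : set R, measurable A ->
  P [set w | A (M h w)] = P0 [set w | A (L h w)].

Lemma measurable_levy t : measurable_fun setT (M t).
Proof. by []. Qed.

Lemma levy_cadlag w : cadlag (M ^~ w).
Proof. by case: levyM. Qed.

Lemma incr_law s h A : 0 <= s -> 0 <= h -> measurable A ->
  P [set w | A (M (s + h) w - M s w)] = P0 [set w | A (L h w)].
Proof.
move=> s0 h0 mA; case: levyM => _ _ _ /(_ s h s0 h0 A mA) ->.
exact: margM.
Qed.

Lemma incr_integral s h (u : R -> R) : 0 <= s -> 0 <= h ->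
  measurable_fun setT u -> (forall x, 0 <= u x) ->
  (\int[P]_w (u (M (s + h) w - M s w))%:E = \int[P0]_w (u (L h w))%:E)%E.
Proof.
move=> s0 h0 mu u0.
have mD : measurable_fun setT (fun w => M (s + h) w - M s w) by exact: measurable_funB.
have mE : measurable_fun setT (EFin \o u) by exact/measurable_EFinP.
have e1 := ge0_integral_pushforward mD P measurableT mE (fun y _ => u0 y).
have e2 := ge0_integral_pushforward (measurable_funPT (L h)) P0 measurableT mE
  (fun y _ => u0 y).
rewrite !preimage_setT in e1 e2.
rewrite -[LHS]e1 -[RHS]e2; apply: eq_measure_integral => A mA _.
exact: incr_law.
Qed.

(** Independence and stationarity of the increments of [M] reduce everything to its one-dimensional
    marginals, which are those of [L]. *)
Lemma incr_prod (t : nat -> R) n (u : nat -> R -> R) : 0 <= t 0%N ->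
  {homo t : m n / (m <= n)%N >-> m <= n} ->
  (forall k, measurable_fun setT (u k)) -> (forall k x, 0 <= u k x <= 1) ->
  (\int[P]_w (\prod_(0 <= k < n) u k (M (t k.+1) w - M (t k) w))%:E =
   \big[*%E/1%E]_(0 <= k < n) \int[P0]_w (u k (L (t k.+1 - t k) w))%:E)%E.
Proof.
move=> t0 tm mu u01.
have u0 k x : 0 <= u k x by have /andP[] := u01 k x.
have u1 k x : u k x <= 1 by have /andP[] := u01 k x.
have tk k : 0 <= t k by rewrite (le_trans t0)// tm.
have mf k : measurable_fun setT (fun w => u k (M (t k.+1) w - M (t k) w)).
  by apply: measurableT_comp => //; exact: measurable_funB.
rewrite (@integral_prod_indep _ _ _ P nat (index_iota 0 n)
  (fun k w => u k (M (t k.+1) w - M (t k) w)))//.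
- apply: eq_bigr => k _.
  have {1}-> : t k.+1 = t k + (t k.+1 - t k) by rewrite addrC subrK.
  by rewrite incr_integral// subr_ge0 tm.
- exact: iota_uniq.
- by move=> k _; apply: (le_lt_trans (integral_le1 P (mf k) _) (ltry _)).
- move=> B mB; case: levyM => _ _ ind _.
  apply: (ind t t0 tm (index_iota 0 n) (fun k => (fun w => u k (M (t k.+1) w - M (t k) w)) @^-1` B k)).
    exact: iota_uniq.
  move=> k _; exists (u k @^-1` B k) => //=; last by rewrite setTI.
  by rewrite -[X in measurable X]setTI; exact: mu.
Qed.

End OneProcess.
End JumpLaw.

(** * Laplace functionals of jump sums over consecutive intervals *)

Section Laplace.
Context {R : realType}.
Implicit Types (g : R -> R) (f : R -> R) (a b s x : R).

(** All the subdivisions of the intervals between consecutive [t k] in one sequence of times, so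
    that independence of increments is applied once. Index [i] is point [i %% N] of block
    [i %/ N]. *)
Definition flat (t : nat -> R) N i := grid (t (i %/ N)%N) (t (i %/ N).+1) N (i %% N)%N.

Lemma flatS (t : nat -> R) N i :
  flat t N.+1 i.+1 = grid (t (i %/ N.+1)%N) (t (i %/ N.+1).+1) N.+1 (i %% N.+1).+1.
Proof.
rewrite /flat modnS divnS//; case: ifPn => [dv|_]; last by rewrite add0n.
have -> : (i %% N.+1).+1 = N.+1.
  apply/eqP; rewrite eqn_leq ltn_mod/=; apply: dvdn_leq => //.
  have := dv; rewrite {1}(divn_eq i N.+1) -addnS dvdn_addr//.
  exact: dvdn_mull.
by rewrite gridN grid0 add1n.
Qed.

Lemma flat_homo (t : nat -> R) N : {homo t : m n / (m <= n)%N >-> m <= n} ->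
  {homo flat t N.+1 : m n / (m <= n)%N >-> m <= n}.
Proof.
move=> tm; apply: homo_leq => //; first by move=> ? ? ?; exact: le_trans.
by move=> i; rewrite flatS; apply: grid_le => //; exact: tm.
Qed.

Lemma flatB (t : nat -> R) N i : flat t N.+1 i.+1 - flat t N.+1 i =
  (t (i %/ N.+1).+1 - t (i %/ N.+1)%N) / N.+1%:R.
Proof. by rewrite flatS gridS /flat addrC addKr. Qed.

Lemma big_flat (I : Type) (idx : I) (op : Monoid.law idx) K N (F : nat -> nat -> I) :
  \big[op/idx]_(0 <= i < K * N.+1) F (i %/ N.+1)%N (i %% N.+1)%N =
  \big[op/idx]_(0 <= k < K) \big[op/idx]_(0 <= j < N.+1) F k j.
Proof.
rewrite big_nat_mul; apply: eq_bigr => k _.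
rewrite -{1}[(k * N.+1)%N]add0n mulSn big_addn addnK.
apply: eq_big_nat => j jN.
by rewrite addnC divnMDl// divn_small// addn0 modnMDl modn_small.
Qed.

Section Lap1.
Context {d} {T : measurableType d} (P : probability T R) (M : R -> {RV P >-> R}).
Context {d0} {T0 : measurableType d0} (P0 : probability T0 R) (L : R -> {RV P0 >-> R}).
Hypothesis levyM : levy_process M.
Hypothesis margM : forall h, 0 <= h -> forall A : set R, measurable A ->
  P [set w | A (M h w)] = P0 [set w | A (L h w)].

Lemma lap_blocks (t : nat -> R) K N (u : nat -> R -> R) : 0 <= t 0%N ->
  {homo t : m n / (m <= n)%N >-> m <= n} ->
  (forall k, measurable_fun setT (u k)) -> (forall k x, 0 <= u k x <= 1) ->
  (\int[P]_w (\prod_(0 <= k < K) \prod_(0 <= j < N.+1)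
     u k (M (grid (t k) (t k.+1) N.+1 j.+1) w - M (grid (t k) (t k.+1) N.+1 j) w))%:E =
   \big[*%E/1%E]_(0 <= k < K) \big[*%E/1%E]_(0 <= j < N.+1)
     \int[P0]_w (u k (L ((t k.+1 - t k) / N.+1%:R) w))%:E)%E.
Proof.
move=> t0 tm mu u01.
have := @incr_prod R _ _ P M _ _ P0 L levyM margM (flat t N.+1) (K * N.+1)
  (fun i => u (i %/ N.+1)%N).
rewrite {1}/flat div0n mod0n grid0 => /(_ t0 (flat_homo _ tm) (fun=> mu _) (fun=> u01 _)).
under eq_integral do under eq_bigr do rewrite flatS /flat.
under [in RHS]eq_bigr do rewrite flatB.
rewrite (big_flat _ K N (fun k j => \int[P0]_w (u k (L ((t k.+1 - t k) / N.+1%:R) w))%:E)%E) => <-.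
apply: eq_integral => w _; congr EFin.
by rewrite -(big_flat _ K N (fun k j => u k (M (grid (t k) (t k.+1) N.+1 j.+1) w - M (grid (t k) (t k.+1) N.+1 j) w))).
Qed.

End Lap1.

Lemma expR_bsum g f a b N : expR (- bsum g f a b N) =
  \prod_(0 <= j < N.+1) expR (- g (f (grid a b N.+1 j.+1) - f (grid a b N.+1 j))).
Proof. by rewrite /bsum -sumrN expR_sum big_mkord. Qed.

Lemma expRN_01 x : 0 <= x -> 0 <= expR (- x) <= 1.
Proof. by move=> x0; rewrite expR_ge0/= -expR0 ler_expR oppr_le0. Qed.

Lemma measurable_expN d (T : measurableType d) (D : set T) (f : T -> R) :
  measurable_fun D f -> measurable_fun D (fun w => expR (- f w)).
Proof.
move=> mf; apply: (measurableT_comp (@measurable_expR R)).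
exact: (measurableT_comp (@oppr_measurable R setT)).
Qed.

Lemma prod_01 (K : nat) (F : nat -> R) : (forall k, 0 <= F k <= 1) ->
  0 <= \prod_(0 <= k < K) F k <= 1.
Proof.
move=> F01; apply/andP; split; first by apply: prodr_ge0 => k _; case/andP: (F01 k).
by apply: prodr_ile1 => k _; exact: F01.
Qed.

Lemma cvg_bounded d (T : measurableType d) (P : probability T R)
    (u : nat -> T -> R) (v : T -> R) :
  (forall n, measurable_fun setT (u n)) -> measurable_fun setT v ->
  (forall n w, 0 <= u n w <= 1) -> (forall w, u n w @[n --> \oo] --> v w) ->
  (\int[P]_w (u n w)%:E @[n --> \oo] --> \int[P]_w (v w)%:E)%E.
Proof.
move=> mu mv u01 uv.
apply: (@dominated_cvg _ _ _ P setT measurableT (fun n w => (u n w)%:E)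
  (fun w => (v w)%:E) (cst 1%E)) => //.
- by move=> n; exact/measurable_EFinP.
- by move=> w _; apply: cvg_EFin; [exact: nearW|exact: uv].
- exact: finite_measure_integrable_cst.
- by move=> n w _; rewrite lee_fin ger0_norm; case/andP: (u01 n w).
Qed.

Lemma cvg_prod_seq (I : eqType) (s : seq I) (u : I -> nat -> R) (l : I -> R) :
  (forall i, i \in s -> u i N @[N --> \oo] --> l i) ->
  \prod_(i <- s) u i N @[N --> \oo] --> \prod_(i <- s) l i.
Proof.
elim: s => [_|i s IH H].
  by rewrite big_nil; under eq_cvg do rewrite big_nil; exact: cvg_cst.
rewrite big_cons; under eq_cvg do rewrite big_cons.
apply: cvgM; first by apply: H; rewrite inE eqxx.
by apply: IH => j js; apply: H; rewrite inE js orbT.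
Qed.

Lemma fine_prode (I : Type) (s : seq I) (F : I -> \bar R) :
  (forall i, F i \is a fin_num) ->
  (\big[*%E/1]_(i <- s) F i = (\prod_(i <- s) fine (F i))%:E)%E.
Proof.
move=> Ff; elim: s => [|i s IH]; first by rewrite !big_nil.
by rewrite !big_cons IH EFinM fineK.
Qed.

Lemma int01_fin d (T : measurableType d) (P : probability T R) (f : T -> R) :
  measurable_fun setT f -> (forall w, 0 <= f w <= 1) ->
  (\int[P]_w (f w)%:E)%E \is a fin_num.
Proof.
move=> mf f01; rewrite ge0_fin_numE.
  exact: le_lt_trans (integral_le1 P mf f01) (ltry _).
by apply: integral_ge0 => w _; rewrite lee_fin; case/andP: (f01 w).
Qed.

Section Lap2.
Context {d} {T : measurableType d} (P : probability T R) (M : R -> {RV P >-> R}).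
Context {d0} {T0 : measurableType d0} (P0 : probability T0 R) (L : R -> {RV P0 >-> R}).
Hypothesis levyM : levy_process M.
Hypothesis levyL : levy_process L.
Hypothesis margM : forall h, 0 <= h -> forall A : set R, measurable A ->
  P [set w | A (M h w)] = P0 [set w | A (L h w)].

Lemma lap_bsum (t : nat -> R) K N (G : nat -> R -> R) : 0 <= t 0%N ->
  {homo t : m n / (m <= n)%N >-> m <= n} ->
  (forall k, continuous (G k)) -> (forall k x, 0 <= G k x) ->
  (\int[P]_w (\prod_(0 <= k < K) expR (- bsum (G k) (M ^~ w) (t k) (t k.+1) N))%:E =
   \big[*%E/1%E]_(0 <= k < K) \int[P0]_w
      (expR (- bsum (G k) (L ^~ w) 0 (t k.+1 - t k) N))%:E)%E.
Proof.
move=> t0 tm Gc G0.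
pose u k x := expR (- G k x).
have mu k : measurable_fun setT (u k).
  by apply: measurable_expN; exact: continuous_measurable_fun.
have u01 k x : 0 <= u k x <= 1 by exact: expRN_01.
under eq_integral do under eq_bigr do rewrite expR_bsum.
rewrite (lap_blocks levyM margM K N t0 tm mu u01).
apply: eq_big_nat => k _.
under [in RHS]eq_integral do rewrite expR_bsum.
set h := t k.+1 - t k; have h0 : 0 <= h by rewrite subr_ge0 tm.
(* A single interval from 0 to [h], as a sequence of times that stays at [h]. Here [L] is taken as
   its own copy. *)
have tm' : {homo (fun n => if n is 0%N then 0 else h) : m n / (m <= n)%N >-> m <= n}.
  by move=> [|m] [|n].
have := @lap_blocks _ _ P0 L _ _ P0 L levyL (fun _ _ _ _ => erefl)
  (fun n => if n is 0%N then 0 else h) 1 N (fun=> u k) (lexx 0) tm' (fun=> mu k) (fun=> u01 k).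
rewrite big_nat1 /= subr0 => <-; apply: eq_integral => w _.
by rewrite big_nat1.
Qed.

(** The identity [lap_bsum] on grids passes to the limit on both sides by [bsum_cvg] and bounded
    convergence, all factors being between 0 and 1. *)
Lemma lap_jsum (t : nat -> R) K (G : nat -> R -> R) : 0 <= t 0%N ->
  {homo t : m n / (m <= n)%N >-> m <= n} -> (forall k, away (G k)) ->
  (\int[P]_w (\prod_(0 <= k < K) expR (- fine (jsum (G k) (M ^~ w) (t k) (t k.+1))))%:E =
   \big[*%E/1%E]_(0 <= k < K) \int[P0]_w
      (expR (- fine (jsum (G k) (L ^~ w) 0 (t k.+1 - t k))))%:E)%E.
Proof.
move=> t0 tm aG.
have Gc k : continuous (G k) by case: (aG k).
have G0 k x : 0 <= G k x by case: (aG k).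
have tk k : 0 <= t k by rewrite (le_trans t0)// tm.
have tS k : t k <= t k.+1 by rewrite tm.
have cM w : cadlag (M ^~ w) by case: levyM.
have cL w : cadlag (L ^~ w) by case: levyL.
have mMb k N : measurable_fun setT (fun w => expR (- bsum (G k) (M ^~ w) (t k) (t k.+1) N)).
  apply: measurable_expN.
  by apply: (@measurable_bsum _ _ _ (fun t => M t : T -> R)) => //.
have mLb k N : measurable_fun setT (fun w => expR (- bsum (G k) (L ^~ w) 0 (t k.+1 - t k) N)).
  apply: measurable_expN.
  by apply: (@measurable_bsum _ _ _ (fun t => L t : T0 -> R)) => //; rewrite subr_ge0.
have mMj k : measurable_fun setT (fun w => expR (- fine (jsum (G k) (M ^~ w) (t k) (t k.+1)))).
  apply: measurable_expN.
  apply: measurableT_comp => //.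
  exact: (@measurable_jsum_away _ _ _ (fun t => M t : T -> R)).
have mLj k : measurable_fun setT (fun w => expR (- fine (jsum (G k) (L ^~ w) 0 (t k.+1 - t k)))).
  apply: measurable_expN.
  apply: measurableT_comp => //.
  exact: (@measurable_jsum_away _ _ _ (fun t => L t : T0 -> R)).
have cvg1 : (\int[P]_w (\prod_(0 <= k < K) expR (- bsum (G k) (M ^~ w) (t k) (t k.+1) N))%:E
    @[N --> \oo] --> \int[P]_w (\prod_(0 <= k < K) expR (- fine (jsum (G k) (M ^~ w) (t k) (t k.+1))))%:E)%E.
  apply: cvg_bounded.
  - by move=> N; apply: measurable_prod.
  - by apply: measurable_prod.
  - by move=> N w; apply: prod_01 => k; apply: expRN_01; exact: bsum_ge0.
  - move=> w; apply: cvg_prod_seq => k _.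
    apply: (continuous_cvg _ (@continuous_expR R _)); apply: cvgN.
    by have [] := bsum_cvg (cM w) (tk k) (tS k) (aG k).
have cvg2 : (\big[*%E/1%E]_(0 <= k < K) \int[P0]_w
      (expR (- bsum (G k) (L ^~ w) 0 (t k.+1 - t k) N))%:E
    @[N --> \oo] --> \big[*%E/1%E]_(0 <= k < K) \int[P0]_w
      (expR (- fine (jsum (G k) (L ^~ w) 0 (t k.+1 - t k))))%:E)%E.
  have fb N k : (\int[P0]_w
      (expR (- bsum (G k) (L ^~ w) 0 (t k.+1 - t k) N))%:E)%E \is a fin_num.
    by apply: int01_fin => // w; apply: expRN_01; exact: bsum_ge0.
  have fj k : (\int[P0]_w
      (expR (- fine (jsum (G k) (L ^~ w) 0 (t k.+1 - t k))))%:E)%E \is a fin_num.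
    by apply: int01_fin => // w; apply: expRN_01; exact: fine_jsum_ge0.
  rewrite (fine_prode _ fj).
  under eq_cvg do rewrite (fine_prode _ (fb _)).
  apply: cvg_EFin; first exact: nearW.
  apply: (@cvg_prod_seq _ _ (fun k N => fine (\int[P0]_w
      (expR (- bsum (G k) (L ^~ w) 0 (t k.+1 - t k) N))%:E)%E)
     (fun k => fine (\int[P0]_w (expR (- fine (jsum (G k) (L ^~ w) 0 (t k.+1 - t k))))%:E)%E)) => k _.
  apply: fine_cvg; rewrite fineK//.
  apply: cvg_bounded => //.
  - by move=> N w; apply: expRN_01; exact: bsum_ge0.
  - move=> w.
    apply: (continuous_cvg _ (@continuous_expR R _)); apply: cvgN.
    have h0 : 0 <= t k.+1 - t k by rewrite subr_ge0.
    by have [] := bsum_cvg (cL w) (lexx 0) h0 (aG k).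
have E : (fun N => \int[P]_w (\prod_(0 <= k < K) expR (- bsum (G k) (M ^~ w) (t k) (t k.+1) N))%:E)%E =
   (fun N => \big[*%E/1%E]_(0 <= k < K) \int[P0]_w
      (expR (- bsum (G k) (L ^~ w) 0 (t k.+1 - t k) N))%:E)%E.
  by apply/funext => N; exact: lap_bsum.
by rewrite -E in cvg2; exact: (cvg_unique (@ereal_hausdorff R) cvg1 cvg2).
Qed.

End Lap2.
End Laplace.

(** * Polynomials in Laplace variables *)

Section PolyJump.
Context {R : realType}.
Implicit Types (g : R -> R) (f : R -> R) (a b s x : R).

Lemma integral_lin01 d (T : measurableType d) (P : probability T R) (I : Type) (s : seq I)
    (c : I -> R) (F : I -> T -> R) :
  (forall i, measurable_fun setT (F i)) -> (forall i w, 0 <= F i w <= 1) ->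
  (\int[P]_w (\sum_(i <- s) c i * F i w)%:E =
   (\sum_(i <- s) c i * fine (\int[P]_w (F i w)%:E)%E)%:E)%E.
Proof.
move=> mF F01.
have mcF i : measurable_fun setT (fun w => c i * F i w) by exact: measurable_funM.
have iF i : P.-integrable setT (EFin \o F i).
  apply: (@le_integrable _ _ _ P setT measurableT _ (cst 1%E)).
  - exact/measurable_EFinP.
  - by move=> w _ /=; rewrite normr1 lee_fin ger0_norm; case/andP: (F01 i w).
  - exact: finite_measure_integrable_cst.
have icF i : P.-integrable setT (fun w => (c i * F i w)%:E).
  by have := integrableZl measurableT (c i) (iF i).
have isF l : P.-integrable setT (fun w => (\sum_(i <- l) c i * F i w)%:E).
  elim: l => [|i l IH]; first by under eq_fun do rewrite big_nil; exact: integrable0.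
  by under eq_fun do rewrite big_cons EFinD; exact: integrableD.
elim: s => [|i s IH]; first by rewrite big_nil; under eq_integral do rewrite big_nil; exact: integral0.
rewrite big_cons; under eq_integral do rewrite big_cons EFinD.
rewrite integralD//; rewrite IH EFinD; congr (_ + _)%E.
have -> : (\int[P]_w (c i * F i w)%:E = \int[P]_w ((c i)%:E * (F i w)%:E))%E.
  by apply: eq_integral.
rewrite (integralZl measurableT (iF i)); have Ifin := int01_fin P (mF i) (F01 i).
by rewrite -{1}(fineK Ifin).
Qed.

Section Poly.
Context {d} {T : measurableType d} (P : probability T R) (M : R -> {RV P >-> R}).
Context {d0} {T0 : measurableType d0} (P0 : probability T0 R) (L : R -> {RV P0 >-> R}).
Hypothesis levyM : levy_process M.
Hypothesis levyL : levy_process L.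
Hypothesis margM : forall h, 0 <= h -> forall A : set R, measurable A ->
  P [set w | A (M h w)] = P0 [set w | A (L h w)].

Definition expj g f a b : R := expR (- fine (jsum g f a b)).

Lemma expj_01 g f a b : (forall x, 0 <= g x) -> 0 <= expj g f a b <= 1.
Proof. by move=> g0; apply: expRN_01; exact: fine_jsum_ge0. Qed.

Lemma expjX g f a b n : cadlag f -> away g -> 0 <= a -> a <= b ->
  expj g f a b ^+ n = expj (fun x => n%:R * g x) f a b.
Proof.
move=> cf ag a0 ab; rewrite /expj fine_jsumZ// -mulrN expRM_natl//.
Qed.

Lemma measurable_expj d' (T' : measurableType d') (X : R -> T' -> R) g a b :
  (forall t, 0 <= t -> measurable_fun setT (X t)) -> (forall w, cadlag (X ^~ w)) ->
  away g -> 0 <= a -> measurable_fun setT (fun w => expj g (X ^~ w) a b).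
Proof.
move=> mX cX ag a0; apply: measurable_expN; apply: measurableT_comp => //.
exact: measurable_jsum_away.
Qed.

(** Expanding the product of polynomials gives a linear combination of monomials. A power of [expj]
    is again an [expj] ([expjX]), so each monomial is covered by [lap_jsum]. *)
Lemma poly_jsum (t : nat -> R) K (G : nat -> R -> R) (p : nat -> {poly R}) : 0 <= t 0%N ->
  {homo t : m n / (m <= n)%N >-> m <= n} -> (forall k, away (G k)) ->
  (\int[P]_w (\prod_(0 <= k < K) (p k).[expj (G k) (M ^~ w) (t k) (t k.+1)])%:E =
   (\prod_(0 <= k < K) fine (\int[P0]_w
      ((p k).[expj (G k) (L ^~ w) 0 (t k.+1 - t k)])%:E))%:E)%E.
Proof.
move=> t0 tm aG.
have G0 k x : 0 <= G k x by case: (aG k).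
have tk k : 0 <= t k by rewrite (le_trans t0)// tm.
have tS k : t k <= t k.+1 by rewrite tm.
have cM w : cadlag (M ^~ w) by case: levyM.
have cL w : cadlag (L ^~ w) by case: levyL.
pose D := \max_(k < K) size (p k).
have pD (k : 'I_K) : (size (p k) <= D)%N by exact: (leq_bigmax (F := fun k : 'I_K => size (p k))).
pose Y k w := expj (G k) (M ^~ w) (t k) (t k.+1).
pose Z k w := expj (G k) (L ^~ w) 0 (t k.+1 - t k).
have mY k : measurable_fun setT (Y k).
  by apply: (@measurable_expj _ T (fun t => M t : T -> R)).
have mZ k : measurable_fun setT (Z k).
  by apply: (@measurable_expj _ T0 (fun t => L t : T0 -> R)).
have Y01 k w : 0 <= Y k w <= 1 by exact: expj_01.
have Z01 k w : 0 <= Z k w <= 1 by exact: expj_01.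
have X01 (y : R) n : 0 <= y <= 1 -> 0 <= y ^+ n <= 1.
  by move=> /andP[y0 y1]; rewrite exprn_ge0// exprn_ile1.
transitivity (\int[P]_w (\sum_(f : {ffun 'I_K -> 'I_D})
    (\prod_(k < K) (p k)`_(f k)) * \prod_(k < K) Y k w ^+ f k)%:E)%E.
  apply: eq_integral => w _; congr EFin; rewrite big_mkord.
  transitivity (\prod_(k < K) \sum_(i < D) (p k)`_i * Y k w ^+ i).
    by apply: eq_bigr => k _; rewrite (horner_coef_wide _ (pD k)).
  rewrite bigA_distr_bigA; apply: eq_bigr => f _.
  by rewrite big_split.
rewrite integral_lin01; last 2 first.
- by move=> f; apply: measurable_prod => k _; exact: measurable_funX.
- move=> f w; apply/andP; split.
    by apply: prodr_ge0 => k _; case/andP: (X01 _ (f k) (Y01 k w)).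
  by apply: prodr_ile1 => k _; exact: X01.
congr EFin; rewrite big_mkord.
transitivity (\prod_(k < K) \sum_(i < D) (p k)`_i * fine (\int[P0]_w (Z k w ^+ i)%:E)%E); last first.
  apply: eq_bigr => k _.
  have -> : (\int[P0]_w ((p k).[expj (G k) (L ^~ w) 0 (t k.+1 - t k)])%:E =
     \int[P0]_w (\sum_(i < D) (p k)`_i * Z k w ^+ i)%:E)%E.
    by apply: eq_integral => w _; rewrite (horner_coef_wide _ (pD k)).
  rewrite integral_lin01// => [i|i w]; first exact: measurable_funX.
  exact: X01.
rewrite bigA_distr_bigA; apply: eq_bigr => f _; rewrite big_split /=; congr (_ * _).
(* The exponents of the monomial, extended by 0 beyond [K]. *)
pose e k := if insub k is Some i then f i : nat else 0%N.
have eE (k : 'I_K) : e k = f k by rewrite /e valK.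
have aG' k : away (fun x => (e k)%:R * G k x) by apply: awayZ.
have -> : (\int[P]_w (\prod_(k < K) Y k w ^+ f k)%:E)%E =
   (\int[P]_w (\prod_(0 <= k < K)
       expR (- fine (jsum (fun x => (e k)%:R * G k x) (M ^~ w) (t k) (t k.+1))))%:E)%E.
  apply: eq_integral => w _; congr EFin; rewrite big_mkord; apply: eq_bigr => k _.
  by rewrite -[RHS]expjX// eE.
rewrite (lap_jsum levyM levyL margM K t0 tm aG').
rewrite fine_prode/=; last first.
  move=> k; apply: int01_fin.
    exact: (@measurable_expj _ T0 (fun t => L t : T0 -> R)).
  by move=> w; apply: expj_01 => x; rewrite mulr_ge0.
rewrite big_mkord; apply: eq_bigr => k _; congr fine; apply: eq_integral => w _.
by rewrite -[LHS]/((expj _ _ _ _)%:E) -expjX ?eE// subr_ge0.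
Qed.

End Poly.
End PolyJump.

(** * Independence for increasing limits of exponential polynomials *)

Section JumpFunctionals.
Context {R : realType}.
Implicit Types (g : R -> R) (f : R -> R) (a b s x : R) (Z : (R -> R) -> R -> R -> R).

Lemma cvg_monotone_ae d (T : measurableType d) (mu : {measure set T -> \bar R})
    (u : nat -> T -> R) (v : T -> R) :
  (forall n, measurable_fun setT (u n)) -> (forall n w, 0 <= u n w) ->
  (forall w, nondecreasing_seq (u ^~ w)) ->
  {ae mu, forall w, u n w @[n --> \oo] --> v w} ->
  (\int[mu]_w (u n w)%:E @[n --> \oo] --> \int[mu]_w (v w)%:E)%E.
Proof.
move=> mu_ u0 und uv.
have -> : (\int[mu]_w (v w)%:E = \int[mu]_w limn (fun n => (u n w)%:E))%E.
  apply: ae_integral; apply: filterS uv => w uvw _; apply/esym/cvg_lim => //.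
  by apply: cvg_EFin; [exact: nearW|exact: uvw].
apply: cvg_monotone_convergence => //.
- by move=> n; apply/measurable_EFinP.
- by move=> n w _; rewrite lee_fin.
- by move=> w _ m n mn; rewrite lee_fin und.
Qed.

Definition zm (p : nat -> {poly R}) (G : nat -> R -> R) m f a b : R :=
  (p m).[expj (G m) f a b].

(* Functionals of a path which are increasing limits of polynomials in the
   variables [expj], for which independence of the increments is available. *)
Definition jfunct Z := exists p G, [/\ forall m, away (G m),
  forall f a b m, cadlag f -> 0 <= a -> a <= b -> 0 <= zm p G m f a b,
  forall f a b, cadlag f -> 0 <= a -> a <= b ->
    nondecreasing_seq (fun m => zm p G m f a b) &
  forall f a b, cadlag f -> 0 <= a -> a <= b -> (jsum sqj f a b < +oo)%E ->
    zm p G m f a b @[m --> \oo] --> Z f a b].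

(** Increases to [x] as [m] grows, and is affine in the Laplace variable exp(- x / 2^m): this
    recovers a jump sum itself from its Laplace functionals. Powers of 2 make the monotonicity in
    [m] the inequality 1 - z^2 <= 2 (1 - z). *)
Definition qm (m : nat) (x : R) : R := 2 ^+ m * (1 - expR (- (x / 2 ^+ m))).

Lemma pow2_gt0 m : 0 < 2 ^+ m :> R.
Proof. by rewrite exprn_gt0. Qed.

Lemma qm_ge0 m x : 0 <= x -> 0 <= qm m x.
Proof.
move=> x0; rewrite mulr_ge0 ?exprn_ge0// subr_ge0.
by have /andP[] := @expRN_01 R (x / 2 ^+ m) (divr_ge0 x0 (ltW (pow2_gt0 m))).
Qed.

Lemma qm_le m x y : x <= y -> qm m x <= qm m y.
Proof.
move=> xy; rewrite ler_wpM2l ?exprn_ge0// lerD2l lerN2 ler_expR lerN2.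
by rewrite ler_pM2r// invr_gt0 pow2_gt0.
Qed.

Lemma qmS m x : qm m x <= qm m.+1 x.
Proof.
rewrite /qm; set z := expR (- (x / 2 ^+ m.+1)).
have -> : expR (- (x / 2 ^+ m)) = z ^+ 2.
  rewrite /z -expRM_natl; congr expR; rewrite exprS.
  have : 2 ^+ m != 0 :> R by rewrite expf_neq0.
  by set q := 2 ^+ m => q0; field.
rewrite (exprS 2 m) -mulrA mulrCA ler_wpM2l ?exprn_ge0//.
have : 0 <= (1 - z) ^+ 2 by exact: sqr_ge0.
rewrite !expr2; lra.
Qed.

Lemma qm_nd m n x : (m <= n)%N -> qm m x <= qm n x.
Proof. by move: m n; apply/nondecreasing_seqP => m; exact: qmS. Qed.

Lemma expRN_bounds x : 0 <= x -> x - x ^+ 2 <= 1 - expR (- x) <= x.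
Proof.
move=> x0; have e1 := expR_ge1Dx (- x).
have e2 := expR_ge1Dx x; apply/andP; split; last by lra.
have e0 : expR (- x) * expR x = 1 by rewrite -expRD addNr expR0.
have p0 := expR_gt0 (- x).
have h1 : expR (- x) * (1 + x) <= 1 by rewrite -[leRHS]e0 ler_pM2l.
have x3 : 0 <= x ^+ 3 by rewrite exprn_ge0.
have h2 : (1 - x + x ^+ 2) * (1 + x) = 1 + x ^+ 3 by ring.
have : expR (- x) * (1 + x) <= (1 - x + x ^+ 2) * (1 + x).
  by rewrite h2; apply: le_trans h1 _; rewrite lerDl.
rewrite ler_pM2r; [by move=> ?; lra|by lra].
Qed.

Lemma qm_le_id m x : 0 <= x -> qm m x <= x.
Proof.
move=> x0; have p2 := pow2_gt0 m.
have /andP[_ H] := expRN_bounds (divr_ge0 x0 (ltW p2)).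
by rewrite /qm mulrC -ler_pdivlMr.
Qed.

Lemma qm_ge m x : 0 <= x -> x - x ^+ 2 / 2 ^+ m <= qm m x.
Proof.
move=> x0; have p2 := pow2_gt0 m.
have /andP[H _] := expRN_bounds (divr_ge0 x0 (ltW p2)).
rewrite /qm [leRHS]mulrC -ler_pdivrMr//; apply: le_trans (le_trans _ H) (lexx _).
rewrite le_eqVlt; apply/orP; left; apply/eqP.
by move: (lt0r_neq0 p2); set q := 2 ^+ m => q0; field.
Qed.

Lemma cvg_pow2V : (2 ^+ m)^-1 @[m --> \oo] --> (0 : R).
Proof.
under eq_cvg do rewrite -exprVn.
by apply: cvg_expr; rewrite ger0_norm// invf_lt1//; lra.
Qed.

Lemma qm_cvg_id x : 0 <= x -> qm m x @[m --> \oo] --> x.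
Proof.
move=> x0; apply: (@squeeze_cvgr _ _ _ _ (fun m => x - x ^+ 2 / 2 ^+ m) (cst x)).
- by apply: nearW => m; rewrite qm_ge//= qm_le_id.
- rewrite -[X in _ --> X]subr0; apply: cvgB; first exact: cvg_cst.
  by rewrite -[X in _ --> X](mulr0 (x ^+ 2)); apply: cvgM; [exact: cvg_cst|exact: cvg_pow2V].
- exact: cvg_cst.
Qed.

(** Diagonal limit of a family that is monotone in both indices, with [l] possibly infinite. *)
Lemma qm_cvg (x : nat -> R) (l : \bar R) : (forall m, 0 <= x m) -> nondecreasing_seq x ->
  (x m)%:E @[m --> \oo] --> l -> (qm m (x m))%:E @[m --> \oo] --> l.
Proof.
move=> x0 xn xl.
have nd : nondecreasing_seq (fun m => (qm m (x m))%:E).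
  by move=> m n mn; rewrite lee_fin (le_trans (qm_le m (xn _ _ mn)))// qm_nd.
have /ereal_nondecreasing_cvgn := nd; set s := ereal_sup _ => cs.
have xnE : nondecreasing_seq (fun m => (x m)%:E) by move=> m n mn; rewrite lee_fin xn.
have xle m : ((x m)%:E <= l)%E.
  rewrite -(cvg_unique (@ereal_hausdorff R) (ereal_nondecreasing_cvgn xnE) xl).
  by apply: ereal_sup_ubound; exists m.
suff <- : s = l by [].
apply/eqP; rewrite eq_le; apply/andP; split.
  apply: ge_ereal_sup => _ [m _ <-]; apply: le_trans (xle m).
  by rewrite lee_fin qm_le_id.
apply: (cvge_to_le xl); apply: nearW => m0.
have c0 : (qm m (x m0))%:E @[m --> \oo] --> (x m0)%:E.
  by apply: cvg_EFin; [exact: nearW|exact: qm_cvg_id].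
apply: (cvge_to_le c0); near=> m.
apply: (@le_trans _ _ (qm m (x m))%:E); last by apply: ereal_sup_ubound; exists m.
rewrite lee_fin; apply: qm_le; apply: xn; near: m; exact: nbhs_infty_ge.
Unshelve. all: by end_near.
Qed.

Lemma qm_cvg_real (x : nat -> R) (l : R) : (forall m, 0 <= x m) -> nondecreasing_seq x ->
  x m @[m --> \oo] --> l -> qm m (x m) @[m --> \oo] --> l.
Proof.
move=> x0 xn xl.
have xlE : (x m)%:E @[m --> \oo] --> l%:E by apply: cvg_EFin; [exact: nearW|exact: xl].
by have /fine_cvgP[_] := qm_cvg x0 xn xlE.
Qed.

(** Partial geometric sums: they increase to 1 / z for z in (0, 1], and z = exp(- x) gives exp(x).
    So positive exponentials are limits of polynomials in Laplace variables. *)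
Definition psum_poly (m : nat) : {poly R} := \sum_(i < m) (1 - 'X) ^+ i.

Lemma horner_psum m x : (psum_poly m).[x] = \sum_(i < m) (1 - x) ^+ i.
Proof.
rewrite /psum_poly horner_sum; apply: eq_bigr => i _.
by rewrite horner_exp !hornerE.
Qed.

Lemma psum_cvg (x : nat -> R) (l : R) : (forall m, 0 <= x m) -> nondecreasing_seq x ->
  x m @[m --> \oo] --> l ->
  (psum_poly m).[expR (- x m)] @[m --> \oo] --> expR l.
Proof.
move=> x0 xn xl.
have xle m : x m <= l.
  by rewrite -(cvg_lim (@Rhausdorff R) xl); apply: nondecreasing_cvgn_le => //; apply/cvg_ex; exists l.
have E m : (psum_poly m).[expR (- x m)] = expR (x m) * (1 - (1 - expR (- x m)) ^+ m).
  rewrite horner_psum; have := subrX1 (1 - expR (- x m)) m.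
  rewrite [1 - _ - 1]addrC addKr => H.
  rewrite -[RHS]opprK -mulrN opprB H mulNr mulrN opprK mulrA -expRD subrr expR0 mul1r.
  by [].
under eq_cvg do rewrite E.
have -> : expR l = expR l * (1 - 0) by rewrite subr0 mulr1.
apply: cvgM.
  exact: (continuous_cvg _ (@continuous_expR R _) xl).
apply: cvgB; first exact: cvg_cst.
apply: (@squeeze_cvgr _ _ _ _ (cst 0) (fun m => (1 - expR (- l)) ^+ m)).
- apply: nearW => m /=.
  have /andP[e0 e1] := expRN_01 (x0 m).
  rewrite exprn_ge0 ?subr_ge0//= lerXn2r ?nnegrE ?subr_ge0//.
    by rewrite -expR0 ler_expR oppr_le0 (le_trans (x0 m)).
  by rewrite lerD2l lerN2 ler_expR lerN2.
- exact: cvg_cst.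
- apply: cvg_expr; rewrite ger0_norm.
    by rewrite gtrBl expR_gt0.
  by rewrite subr_ge0 -expR0 ler_expR oppr_le0 (le_trans (x0 0%N)).
Qed.

Lemma psum_nd (x y : R) m n : 0 <= x -> x <= y -> (m <= n)%N ->
  (psum_poly m).[expR (- x)] <= (psum_poly n).[expR (- y)].
Proof.
move=> x0 xy mn; have y0 := le_trans x0 xy.
have /andP[ex0 ex1] := expRN_01 x0; have /andP[ey0 ey1] := expRN_01 y0.
rewrite !horner_psum.
apply: (@le_trans _ _ (\sum_(i < m) (1 - expR (- y)) ^+ i)).
  apply: ler_sum => i _; rewrite lerXn2r ?nnegrE ?subr_ge0//.
  by rewrite lerD2l lerN2 ler_expR lerN2.
rewrite -(big_mkord xpredT (fun i => (1 - expR (- y)) ^+ i)).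
rewrite -(big_mkord xpredT (fun i => (1 - expR (- y)) ^+ i)).
rewrite [leRHS](big_cat_nat (leq0n m) mn)/= lerDl; apply: sumr_ge0 => i _.
by rewrite exprn_ge0// subr_ge0.
Qed.

Section Approximated.
Variables (gm : nat -> R -> R) (g : R -> R).
Hypothesis ag : approx gm g.

Lemma fine_jsum_nd f a b : cadlag f -> 0 <= a ->
  nondecreasing_seq (fun m => fine (jsum (gm m) f a b)).
Proof.
move=> cf a0 m n mn; have am k : away (gm k) by case: ag.
by rewrite fine_le// ?jsum_away_fin//; exact: (jsum_nd f a b ag).
Qed.

Lemma fine_jsum_cvg f a b : cadlag f -> 0 <= a ->
  (fine (jsum (gm m) f a b))%:E @[m --> \oo] --> jsum g f a b.
Proof.
move=> cf a0; have am k : away (gm k) by case: ag.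
by under eq_cvg do rewrite fineK ?jsum_away_fin//; exact: jsum_cvg.
Qed.

Lemma approx_nneg m x : 0 <= gm m x.
Proof. by case: ag => /(_ m)[]. Qed.

Definition qpoly (m : nat) : {poly R} := (2 ^+ m)%:P * (1 - 'X).

Lemma zm_qm m f a b : cadlag f -> 0 <= a -> a <= b ->
  zm qpoly (fun m x => (2 ^+ m)^-1 * gm m x) m f a b = qm m (fine (jsum (gm m) f a b)).
Proof.
move=> cf a0 ab; rewrite /zm /qpoly !hornerE /expj.
have p2 : 0 <= (2 ^+ m)^-1 :> R by rewrite invr_ge0 exprn_ge0.
have am : away (gm m) by case: ag.
by rewrite (fine_jsumZ cf p2 am a0 ab) /qm [(2 ^+ m)^-1 * _]mulrC.
Qed.

Lemma away_qm m : away (fun x => (2 ^+ m)^-1 * gm m x).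
Proof. by apply: awayZ; [rewrite invr_ge0 exprn_ge0|case: ag]. Qed.

End Approximated.

Lemma jfunct_S : jfunct (fun f a b => fine (jsum sqj f a b)).
Proof.
exists qpoly, (fun m x => (2 ^+ m)^-1 * trunc sqj m x); split.
- by move=> m; apply: away_qm; exact: approx_sq.
- move=> f a b m cf a0 ab; rewrite (zm_qm approx_sq)//; apply: qm_ge0.
  by apply: fine_jsum_ge0; exact: (approx_nneg approx_sq m).
- move=> f a b cf a0 ab m n mn; rewrite !(zm_qm approx_sq)//.
  apply: le_trans (qm_le m _) (qm_nd _ mn).
  exact: (fine_jsum_nd approx_sq b cf a0).
- move=> f a b cf a0 ab Soo; under eq_cvg do rewrite (zm_qm approx_sq)//.
  apply: qm_cvg_real.
  + by move=> m; apply: fine_jsum_ge0; exact: (approx_nneg approx_sq m).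
  + exact: (fine_jsum_nd approx_sq b cf a0).
  + have Sf : jsum sqj f a b \is a fin_num.
      by rewrite ge0_fin_numE// jsum_ge0// => x; exact: sqj_ge0.
    by have := fine_jsum_cvg approx_sq (b := b) cf a0; rewrite -{1}(fineK Sf) => /fine_cvgP[].
Qed.

Lemma lnj_le phi x : 0 <= phi -> lnj phi x <= phi * sqj x.
Proof.
move=> p0; apply: le_ln1Dx; apply: lt_le_trans (_ : 0 <= _); first by lra.
by rewrite mulr_ge0// sqr_ge0.
Qed.

Lemma jsum_lnj_fin phi f a b : 0 <= phi -> (jsum sqj f a b < +oo)%E ->
  jsum (lnj phi) f a b \is a fin_num.
Proof.
move=> p0 Soo; rewrite ge0_fin_numE; last by apply: jsum_ge0 => x; exact: lnj_ge0.
apply: (esum_le_mul p0 _ _ Soo) => x _; first exact: sqj_ge0.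
exact: lnj_le.
Qed.

Lemma jfunct_G phi : 0 <= phi -> jfunct (fun f a b => expR (fine (jsum (lnj phi) f a b))).
Proof.
move=> p0; have al := approx_lnj p0.
exists psum_poly, (trunc (lnj phi)); split.
- by case: al.
- move=> f a b m cf a0 ab; rewrite /zm horner_psum; apply: sumr_ge0 => i _.
  rewrite exprn_ge0// subr_ge0.
  by have /andP[] := @expj_01 R (trunc (lnj phi) m) f a b (approx_nneg al m).
- move=> f a b cf a0 ab m n mn; apply: psum_nd => //.
    by apply: fine_jsum_ge0; exact: (approx_nneg al m).
  exact: (fine_jsum_nd al b cf a0).
- move=> f a b cf a0 ab Soo; apply: psum_cvg.
  + by move=> m; apply: fine_jsum_ge0; exact: (approx_nneg al m).
  + exact: (fine_jsum_nd al b cf a0).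
  + have Sf : jsum (lnj phi) f a b \is a fin_num by exact: jsum_lnj_fin.
    by have := fine_jsum_cvg al (b := b) cf a0; rewrite -{1}(fineK Sf) => /fine_cvgP[].
Qed.

Lemma jfunct_affine (c1 c2 : R) Z : 0 <= c1 -> 0 <= c2 -> jfunct Z ->
  jfunct (fun f a b => c1 + c2 * Z f a b).
Proof.
move=> c10 c20 [p [G [aG z0 zn zc]]].
exists (fun m => c1%:P + c2%:P * p m), G.
have E m f a b : zm (fun m => c1%:P + c2%:P * p m) G m f a b = c1 + c2 * zm p G m f a b.
  by rewrite /zm !hornerE.
split => //.
- by move=> f a b m cf a0 ab; rewrite E addr_ge0// mulr_ge0// z0.
- by move=> f a b cf a0 ab m n mn; rewrite !E lerD2l ler_wpM2l// zn.
- move=> f a b cf a0 ab Soo; under eq_cvg do rewrite E.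
  apply: cvgD; first exact: cvg_cst.
  by apply: cvgM; [exact: cvg_cst|exact: zc].
Qed.

Lemma jfunct_exp Z n : jfunct Z -> jfunct (fun f a b => Z f a b ^+ n).
Proof.
move=> [p [G [aG z0 zn zc]]].
exists (fun m => p m ^+ n), G.
have E m f a b : zm (fun m => p m ^+ n) G m f a b = zm p G m f a b ^+ n.
  by rewrite /zm horner_exp.
split => //.
- by move=> f a b m cf a0 ab; rewrite E exprn_ge0// z0.
- by move=> f a b cf a0 ab k l kl; rewrite !E lerXn2r ?nnegrE ?z0// zn.
- move=> f a b cf a0 ab Soo; under eq_cvg do rewrite E.
  by apply: (continuous_cvg _ (@exprn_continuous R n _)); exact: zc.
Qed.

Section Ind.
Context {d} {T : measurableType d} (P : probability T R) (M : R -> {RV P >-> R}).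
Context {d0} {T0 : measurableType d0} (P0 : probability T0 R) (L : R -> {RV P0 >-> R}).
Hypothesis levyM : levy_process M.
Hypothesis levyL : levy_process L.
Hypothesis margM : forall h, 0 <= h -> forall A : set R, measurable A ->
  P [set w | A (M h w)] = P0 [set w | A (L h w)].

(** The paths on which S is a genuine sum; elsewhere [fine] puts in a default value. *)
Definition finite_jumps f := forall b, (jsum sqj f 0 b < +oo)%E.

Lemma finite_jumps_lty f a b : finite_jumps f -> 0 <= a -> (jsum sqj f a b < +oo)%E.
Proof. by move=> H a0; apply: le_lt_trans (H b); apply: le_jsum => //; exact: sqj_ge0. Qed.

Hypothesis finM : {ae P, forall w, finite_jumps (M ^~ w)}.
Hypothesis finL : {ae P0, forall w, finite_jumps (L ^~ w)}.

Lemma measurable_zm d' (T' : measurableType d') (X : R -> T' -> R) p G m a b :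
  (forall t, 0 <= t -> measurable_fun setT (X t)) -> (forall w, cadlag (X ^~ w)) ->
  (forall m, away (G m)) -> 0 <= a ->
  measurable_fun setT (fun w => zm p G m (X ^~ w) a b).
Proof.
move=> mX cX aG a0; rewrite /zm.
under eq_fun do rewrite horner_coef.
apply: measurable_sum => i; apply: measurable_funM => //.
by apply: measurable_funX; exact: measurable_expj.
Qed.

(** Monotone limit of [poly_jsum] on both sides. Finiteness of each factor lets the limit of the
    product be taken factor by factor in the reals. *)
Lemma integral_jfunct_prod (t : nat -> R) K (Z : nat -> (R -> R) -> R -> R -> R) :
  0 <= t 0%N -> {homo t : m n / (m <= n)%N >-> m <= n} -> (forall k, jfunct (Z k)) ->
  (forall k, (k < K)%N -> \int[P0]_w (Z k (L ^~ w) 0 (t k.+1 - t k))%:E < +oo)%E ->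
  (\int[P]_w (\prod_(0 <= k < K) Z k (M ^~ w) (t k) (t k.+1))%:E =
   \big[*%E/1%E]_(0 <= k < K) \int[P0]_w (Z k (L ^~ w) 0 (t k.+1 - t k))%:E)%E.
Proof.
move=> t0 tm /choice[p /choice[G HpG]] Zoo.
have tk k : 0 <= t k by rewrite (le_trans t0)// tm.
have tS k : t k <= t k.+1 by rewrite tm.
have hk k : 0 <= t k.+1 - t k by rewrite subr_ge0.
have cM w : cadlag (M ^~ w) by case: levyM.
have cL w : cadlag (L ^~ w) by case: levyL.
have aG k m : away (G k m) by case: (HpG k).
have z0 k f a b m : cadlag f -> 0 <= a -> a <= b -> 0 <= zm (p k) (G k) m f a b.
  by case: (HpG k) => _ + _ _; exact.
have zn k f a b m n : (m <= n)%N -> cadlag f -> 0 <= a -> a <= b ->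
    zm (p k) (G k) m f a b <= zm (p k) (G k) n f a b.
  by move=> mn cf a0 ab; case: (HpG k) => _ _ + _; exact.
have zc k f a b : cadlag f -> 0 <= a -> a <= b -> (jsum sqj f a b < +oo)%E ->
    zm (p k) (G k) m f a b @[m --> \oo] --> Z k f a b.
  by case: (HpG k) => _ _ _; exact.
have mzM k m : measurable_fun setT (fun w => zm (p k) (G k) m (M ^~ w) (t k) (t k.+1)).
  by apply: (@measurable_zm _ T (fun t => M t : T -> R)).
have mzL k m : measurable_fun setT (fun w => zm (p k) (G k) m (L ^~ w) 0 (t k.+1 - t k)).
  by apply: (@measurable_zm _ T0 (fun t => L t : T0 -> R)).
have c1 : (\int[P]_w (\prod_(0 <= k < K) zm (p k) (G k) m (M ^~ w) (t k) (t k.+1))%:E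
    @[m --> \oo] --> \int[P]_w (\prod_(0 <= k < K) Z k (M ^~ w) (t k) (t k.+1))%:E)%E.
  apply: cvg_monotone_ae.
  - by move=> m; apply: measurable_prod.
  - by move=> m w; apply: prodr_ge0 => k _; exact: z0.
  - move=> w m n mn; apply: ler_prod => k _.
    by rewrite z0//= zn.
  - apply: filterS finM => w fw; apply: cvg_prod_seq => k _.
    by apply: zc => //; exact: finite_jumps_lty.
have c2 k : (\int[P0]_w (zm (p k) (G k) m (L ^~ w) 0 (t k.+1 - t k))%:E
    @[m --> \oo] --> \int[P0]_w (Z k (L ^~ w) 0 (t k.+1 - t k))%:E)%E.
  apply: cvg_monotone_ae => //.
  - by move=> m w; exact: z0.
  - by move=> w m n mn; apply: zn.
  - apply: filterS finL => w fw; apply: zc => //.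
have Zfin k : (k < K)%N -> (\int[P0]_w (Z k (L ^~ w) 0 (t k.+1 - t k))%:E)%E \is a fin_num.
  move=> kK; rewrite ge0_fin_numE ?Zoo//.
  apply: (cvge_to_ge (c2 k)); apply: nearW => m; apply: integral_ge0 => w _.
  by rewrite lee_fin z0.
have -> : (\big[*%E/1%E]_(0 <= k < K) \int[P0]_w (Z k (L ^~ w) 0 (t k.+1 - t k))%:E =
    (\prod_(0 <= k < K) fine (\int[P0]_w (Z k (L ^~ w) 0 (t k.+1 - t k))%:E)%E)%:E)%E.
  rewrite -prodEFin big_nat [RHS]big_nat; apply: eq_bigr => k /Zfin H.
  by rewrite fineK.
have c3 : \prod_(0 <= k < K) fine (\int[P0]_w (zm (p k) (G k) m (L ^~ w) 0 (t k.+1 - t k))%:E)%E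
    @[m --> \oo] --> \prod_(0 <= k < K) fine (\int[P0]_w (Z k (L ^~ w) 0 (t k.+1 - t k))%:E)%E.
  apply: (@cvg_prod_seq _ _ _ (fun k m => fine (\int[P0]_w (zm (p k) (G k) m (L ^~ w) 0 (t k.+1 - t k))%:E)%E)
    (fun k => fine (\int[P0]_w (Z k (L ^~ w) 0 (t k.+1 - t k))%:E)%E)) => k.
  rewrite mem_index_iota => kK; apply: fine_cvg; rewrite fineK; first exact: c2.
  exact: Zfin.
have E : (fun m => \int[P]_w (\prod_(0 <= k < K) zm (p k) (G k) m (M ^~ w) (t k) (t k.+1))%:E)%E =
  (fun m => (\prod_(0 <= k < K) fine (\int[P0]_w (zm (p k) (G k) m (L ^~ w) 0 (t k.+1 - t k))%:E)%E)%:E).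
  apply/funext => m.
  exact: (poly_jsum levyM levyL margM K (fun k => p k m) t0 tm (fun k => aG k m)).
rewrite E in c1; apply: (cvg_unique (@ereal_hausdorff R) c1).
by apply: cvg_EFin; [exact: nearW|exact: c3].
Qed.

End Ind.

End JumpFunctionals.

(** * Mean jump sums and almost sure summability of squared jumps *)

Section MeanJumps.
Context {R : realType}.
Implicit Types (g : R -> R) (f : R -> R) (a b s x phi c : R).

Lemma integral_jsum_cvg d (T : measurableType d) (P : probability T R) (X : R -> T -> R)
    gm g a b :
  (forall t, 0 <= t -> measurable_fun setT (X t)) -> (forall w, cadlag (X ^~ w)) ->
  approx gm g -> 0 <= a ->
  (\int[P]_w (qm m (fine (jsum (gm m) (X ^~ w) a b)))%:E @[m --> \oo] -->
   \int[P]_w jsum g (X ^~ w) a b)%E.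
Proof.
move=> mX cX ag a0.
have am m : away (gm m) by case: ag.
have q0 m w : 0 <= qm m (fine (jsum (gm m) (X ^~ w) a b)).
  by apply: qm_ge0; apply: fine_jsum_ge0; exact: (approx_nneg ag m).
have -> : (\int[P]_w jsum g (X ^~ w) a b =
    \int[P]_w limn (fun m => (qm m (fine (jsum (gm m) (X ^~ w) a b)))%:E))%E.
  apply: eq_integral => w _; apply/esym/cvg_lim => //; apply: qm_cvg.
  - by move=> m; apply: fine_jsum_ge0; exact: (approx_nneg ag m).
  - exact: (fine_jsum_nd ag b (cX w) a0).
  - exact: (fine_jsum_cvg ag (cX w) a0).
apply: cvg_monotone_convergence => //.
- move=> m; apply/measurable_EFinP; rewrite /qm; apply: measurable_funM => //.
  apply: measurable_funB => //; apply: measurable_expN.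
  apply: measurable_funM => //; apply: measurableT_comp => //.
  exact: measurable_jsum_away.
- by move=> m w _; rewrite lee_fin.
- move=> w _ m n mn; rewrite lee_fin.
  exact: le_trans (qm_le m (fine_jsum_nd ag b (cX w) a0 mn)) (qm_nd _ mn).
Qed.

Lemma measurable_jsum_levy d (T : measurableType d) (P : probability T R)
    (X : R -> {RV P >-> R}) gm g a b : levy_process X -> approx gm g -> 0 <= a ->
  measurable_fun setT (fun w => jsum g (X ^~ w) a b).
Proof.
move=> [_ cX _ _] ag a0.
exact: (@measurable_jsum _ _ _ (fun t => X t : T -> R) (fun t _ => measurable_funPT (X t))
  cX gm g a b ag a0).
Qed.

Section TwoProcesses.
Context {d} {T : measurableType d} (P : probability T R) (M : R -> {RV P >-> R}).
Context {d0} {T0 : measurableType d0} (P0 : probability T0 R) (L : R -> {RV P0 >-> R}).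
Hypothesis levyM : levy_process M.
Hypothesis levyL : levy_process L.
Hypothesis margM : forall h, 0 <= h -> forall A : set R, measurable A ->
  P [set w | A (M h w)] = P0 [set w | A (L h w)].

Lemma integral_qm gm g m a b : approx gm g -> 0 <= a -> a <= b ->
  (\int[P]_w (qm m (fine (jsum (gm m) (M ^~ w) a b)))%:E =
   (fine (\int[P0]_w (qm m (fine (jsum (gm m) (L ^~ w) 0 (b - a))))%:E))%:E)%E.
Proof.
move=> ag a0 ab.
have cM w : cadlag (M ^~ w) by case: levyM.
have cL w : cadlag (L ^~ w) by case: levyL.
pose t (n : nat) := if n is 0%N then a else b.
have tm : {homo t : m n / (m <= n)%N >-> m <= n} by move=> [|i] [|j].
have H := poly_jsum levyM levyL margM 1 (fun=> qpoly m) (t := t) a0 tm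
  (fun=> away_qm ag m).
rewrite big_nat1 in H.
have ba0 : 0 <= b - a by rewrite subr_ge0.
transitivity ((fine (\int[P0]_w (zm qpoly (fun m x => (2 ^+ m)^-1 * gm m x) m (L ^~ w) 0 (b - a))%:E)%E)%:E); last first.
  congr (fine _)%:E; apply: eq_integral => w _; congr EFin.
  exact: (zm_qm ag m (cL w) (lexx 0) ba0).
rewrite -[RHS]H; apply: eq_integral => w _; rewrite big_nat1; congr EFin.
by apply/esym; exact: (zm_qm ag m (cM w)).
Qed.

End TwoProcesses.

Section Mean.
Context {d} {T : measurableType d} (P : probability T R) (M : R -> {RV P >-> R}).
Context {d0} {T0 : measurableType d0} (P0 : probability T0 R) (L : R -> {RV P0 >-> R}).
Hypothesis levyM : levy_process M.
Hypothesis levyL : levy_process L.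
Hypothesis margM : forall h, 0 <= h -> forall A : set R, measurable A ->
  P [set w | A (M h w)] = P0 [set w | A (L h w)].

(** Limit of [integral_qm]; the common value may be infinite. *)
Lemma integral_jsum gm g a b : approx gm g -> 0 <= a -> a <= b ->
  (\int[P]_w jsum g (M ^~ w) a b = \int[P0]_w jsum g (L ^~ w) 0 (b - a))%E.
Proof.
move=> ag a0 ab.
have cM w : cadlag (M ^~ w) by case: levyM.
have cL w : cadlag (L ^~ w) by case: levyL.
have c1 := @integral_jsum_cvg _ _ P (fun t => M t : T -> R) gm g a b
  (fun t _ => measurable_funPT (M t)) cM ag a0.
have c2 := @integral_jsum_cvg _ _ P0 (fun t => L t : T0 -> R) gm g 0 (b - a)
  (fun t _ => measurable_funPT (L t)) cL ag (lexx 0).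
have ba0 : 0 <= b - a by rewrite subr_ge0.
have E : (fun m => \int[P]_w (qm m (fine (jsum (gm m) (M ^~ w) a b)))%:E)%E =
  (fun m => \int[P0]_w (qm m (fine (jsum (gm m) (L ^~ w) 0 (b - a))))%:E)%E.
  apply/funext => m; rewrite (integral_qm levyM levyL margM m ag a0 ab).
  rewrite [RHS](integral_qm levyL levyL (fun _ _ _ _ => erefl) m ag (lexx 0) ba0).
  by rewrite subr0.
by rewrite E in c1; exact: (cvg_unique (@ereal_hausdorff R) c1 c2).
Qed.

End Mean.

(** Capped at 1 so that the dyadic levels 2^-k with k >= 0 suffice for a layer decomposition. On one
    cadlag path the cap does not affect summability, since the jumps are locally bounded. *)
Definition minj phi x := Num.min 1 (lnj phi x).

Lemma minj_ge0 phi x : 0 <= phi -> 0 <= minj phi x.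
Proof. by move=> p0; rewrite /minj le_min ler01 lnj_ge0. Qed.

Lemma approx_minj phi : 0 <= phi -> approx (trunc (minj phi)) (minj phi).
Proof.
move=> p0; apply: approx_trunc.
- move=> x; apply: (@continuous_min _ _ (cst 1) (lnj phi)); first exact: cvg_cst.
  exact: lnj_continuous.
- by move=> x; exact: minj_ge0.
- by rewrite /minj /lnj expr0n mulr0 addr0 ln1; apply/min_idPr.
Qed.

Lemma finite_sq_of_minj phi f a b : cadlag f -> 0 < phi -> 0 <= a ->
  (jsum (minj phi) f a b < +oo)%E -> (jsum sqj f a b < +oo)%E.
Proof.
move=> cf p0 a0 H; have p0' := ltW p0.
have [K K0 HK] := cadlag_jump_bound b cf.
have [C C0 HC] := sq_le_lnj p0 K0.
(* On jumps bounded by [K], [lnj] is at most [H1 * minj]: where the cap acts, [minj] is 1 and [lnj]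
   is at most [lnj phi K]; elsewhere the two agree. *)
pose H1 := 1 + lnj phi K.
have H11 : 1 <= H1 by rewrite lerDl lnj_ge0.
apply: (@esum_le_mul R _ _ (fun x => minj phi (jump f x)) (C * H1) _ _ _ H).
- by rewrite mulr_ge0 ?(ltW C0)// (le_trans ler01).
- by move=> x _; exact: minj_ge0.
- move=> x; rewrite /= in_itv/= => /andP[ax xb].
  have xK : `|jump f x| <= K by apply: HK; rewrite xb (le_lt_trans a0 ax).
  apply: (le_trans (HC _ xK)); rewrite -mulrA ler_pM2l//.
  set y := jump f x in xK *.
  have yK : lnj phi y <= lnj phi K.
    rewrite /lnj ler_ln ?posrE ?(lt_le_trans ltr01 (lnj_arg _ p0'))// lerD2l ler_pM2l//.
    by rewrite -(@ger0_norm _ (y ^+ 2)) ?sqr_ge0// normrX lerXn2r ?nnegrE.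
  rewrite /minj; have y0 := lnj_ge0 y p0'.
  have [l1|l1] := lerP (lnj phi y) 1.
    by rewrite ler_peMl.
  rewrite mulr1; apply: (le_trans yK); rewrite /H1; lra.
Qed.

(* Dyadic layers: u/2 <= sum_k 2^-k 1(u > 2^-k) <= 2u for u <= 1. *)
Lemma layer_upper (u : R) n : 0 <= u ->
  \sum_(k < n) 2^-1 ^+ k * ((2^-1 ^+ k < u)%R%:R : R) <= Num.max 0 (2 * u - 2 * 2^-1 ^+ n).
Proof.
move=> u0; elim: n => [|n IH]; first by rewrite big_ord0 le_max lexx.
rewrite big_ord_recr /=.
have q0 : 0 < 2^-1 ^+ n :> R by rewrite exprn_gt0// invr_gt0.
rewrite exprS; move: IH q0; set S := \sum_(i < n) _; set q := 2^-1 ^+ n => IH q0.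
have [qu|qu] := ltrP q u.
  move: IH; rewrite mulr1 (max_idPr _); last by lra.
  by move=> IH; rewrite le_max; apply/orP; right; lra.
rewrite mulr0 addr0 (le_trans IH)// ge_max le_max lexx/= le_max.
by apply/orP; right; lra.
Qed.

Lemma layer_lower (u : R) : 0 <= u -> u <= 1 ->
  exists k, u / 2 <= 2^-1 ^+ k * ((2^-1 ^+ k < u)%R%:R : R).
Proof.
rewrite le_eqVlt => /orP[/eqP <- _|u0 u1].
  by exists 0%N; rewrite mul0r mulr_ge0.
have ex : exists k, 2^-1 ^+ k < u.
  have : \forall k \near \oo, 2^-1 ^+ k < u.
    have c : (2^-1 : R) ^+ k @[k --> \oo] --> (0 : R).
      by apply: cvg_expr; rewrite ger0_norm// invf_lt1//; lra.
    have /cvgrPdist_lt/(_ _ u0) := c; apply: filterS => k.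
    by rewrite sub0r normrN ger0_norm.
  by case=> k _ Hk; exists k; exact: (Hk k (leqnn k)).
case: (ex_minnP ex) => k Hk mk; exists k.
rewrite Hk mulr1; case: k Hk mk => [|k] Hk mk; first by rewrite expr0 in Hk *; lra.
have : u <= 2^-1 ^+ k by rewrite leNgt; apply/negP => /mk; rewrite ltnn.
rewrite exprS; lra.
Qed.

Lemma minj_layers phi x : 0 <= phi ->
  ((minj phi x)%:E <= \sum_(0 <= k <oo) (2 * 2^-1 ^+ k * indj (lnj phi) (2^-1 ^+ k) x)%:E)%E.
Proof.
move=> p0.
have m1 : minj phi x <= 1 by rewrite /minj ge_min lexx.
have [k Hk] := layer_lower (minj_ge0 x p0) m1.
have t0 i : 0 <= 2 * 2^-1 ^+ i * indj (lnj phi) (2^-1 ^+ i) x.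
  by rewrite !mulr_ge0// exprn_ge0// invr_ge0.
apply: (@le_trans _ _ (\sum_(0 <= i < k.+1) (2 * 2^-1 ^+ i * indj (lnj phi) (2^-1 ^+ i) x)%:E)%E); last first.
  by apply: nneseries_lim_ge => i _ _; rewrite lee_fin; exact: t0.
rewrite sumEFin lee_fin big_nat_recr//= ler_wpDl//; first exact: sumr_ge0.
rewrite -mulrA -ler_pdivrMl// mulrC (le_trans Hk)// ler_wpM2l ?exprn_ge0 ?invr_ge0//.
rewrite /indj ler_nat; case: ltrP => // H1; case: ltrP => // H2.
by move: H1; rewrite ltNge; rewrite /minj ge_min H2 orbT.
Qed.

Lemma jsum_minj_layers phi f a b : 0 <= phi ->
  (jsum (minj phi) f a b <=
   \sum_(0 <= k <oo) (2 * 2^-1 ^+ k)%:E * jsum (indj (lnj phi) (2^-1 ^+ k)) f a b)%E.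
Proof.
move=> p0; apply: ge_ereal_sup => _ [F [fF FI] <-].
have c0 k : 0 <= 2 * 2^-1 ^+ k :> R by rewrite mulr_ge0// exprn_ge0// invr_ge0.
have i0 k x : 0 <= indj (lnj phi) (2^-1 ^+ k) x by exact: ler0n.
rewrite fsbig_finite//=.
apply: (@le_trans _ _ (\sum_(x <- finmap.enum_fset (fset_set F)) \sum_(0 <= k <oo)
   (2 * 2^-1 ^+ k * indj (lnj phi) (2^-1 ^+ k) (jump f x))%:E)%E).
  by apply: lee_sum => x _; exact: minj_layers.
rewrite -(nneseries_sum _ 0%N); last by move=> x k _; rewrite lee_fin mulr_ge0.
apply: lee_nneseries => [k _ _|k _].
  by apply: sume_ge0 => x _; rewrite lee_fin mulr_ge0.
under eq_bigr do rewrite EFinM.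
rewrite -ge0_sume_distrr; last by move=> x _; rewrite lee_fin.
rewrite lee_pmul2l ?lte_fin ?ltr0n ?mulr_gt0 ?exprn_gt0 ?invr_gt0//.
by apply: ereal_sup_ubound; exists F => //; rewrite fsbig_finite.
Qed.

Section Finiteness.
Context {d0} {T0 : measurableType d0} (P0 : probability T0 R) (L : R -> {RV P0 >-> R}).
Context (nuL : {measure set R -> \bar R}).
Hypothesis levyL : levy_process L.
Hypothesis nuLE : levy_measure L nuL.

Lemma measurable_lnj phi : 0 <= phi -> measurable_fun setT (lnj phi).
Proof. by move=> p0; apply: continuous_measurable_fun; exact: lnj_continuous. Qed.

(** The left side counts jumps in a set that avoids 0 because [c > 0], so the definition of the Levy
    measure applies. *)
Lemma integral_ind_levy phi c : 0 <= phi -> 0 < c ->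
  (\int[P0]_w jsum (indj (lnj phi) c) (L ^~ w) 0 1 =
   nuL [set x | (c < lnj phi x)%R])%E.
Proof.
move=> p0 c0; case: nuLE => _ H; rewrite H; last 2 first.
- by have := @measurable_fun_ltr _ _ _ setT _ _ (measurable_cst c) (measurable_lnj p0)
    measurableT [set true] I; rewrite setTI; congr measurable; apply/seteqP; split.
- by rewrite /= /lnj expr0n mulr0 addr0 ln1; apply/negP; rewrite -leNgt ltW.
apply: eq_integral => w _; rewrite /jsum.
rewrite esum_mkcond [RHS]esum_mkcond; apply: eq_esum => x _.
rewrite /indj; case: ifPn => [|/negP] /=; rewrite inE/= in_itv/= => x01.
  case: ifPn => [|/negP]; rewrite inE/=; first by move=> [_ ->].
  by move=> H1; case: ltrP => // cl; exfalso; apply: H1.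
by case: ifPn => //; rewrite inE/= => -[x01'].
Qed.

(** The Levy measure is given on sets only. Dyadic layers turn the jump sum into counts of jumps
    with [lnj] above 2^-k, whose means are values of [nuL], and turn these back into the integral of
    [lnj], finite by [Phi_L]. *)
Lemma integral_minj_lty phi eta : 0 < phi -> Phi_L eta nuL phi ->
  (\int[P0]_w jsum (minj phi) (L ^~ w) 0 1 < +oo)%E.
Proof.
move=> p0 [_ Hphi]; have p0' := ltW p0.
have cL w : cadlag (L ^~ w) by case: levyL.
have c0 k : 0 <= 2 * 2^-1 ^+ k :> R by rewrite mulr_ge0// exprn_ge0// invr_ge0.
have h0 k : 0 < 2^-1 ^+ k :> R by rewrite exprn_gt0// invr_gt0.
have i0 k x : 0 <= indj (lnj phi) (2^-1 ^+ k) x by exact: ler0n.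
have l0 : lnj phi 0 = 0 by rewrite /lnj expr0n mulr0 addr0 ln1.
have ai k := approx_ind (lnj_continuous p0') l0 (h0 k).
have mind k : measurable_fun setT (fun w => jsum (indj (lnj phi) (2^-1 ^+ k)) (L ^~ w) 0 1).
  exact: (measurable_jsum_levy _ levyL (ai k) (lexx 0)).
have mterm k : measurable_fun setT
   (fun w => (2 * 2^-1 ^+ k)%:E * jsum (indj (lnj phi) (2^-1 ^+ k)) (L ^~ w) 0 1)%E.
  exact: measurable_funeM.
have t0 k w : (0 <= (2 * 2^-1 ^+ k)%:E * jsum (indj (lnj phi) (2^-1 ^+ k)) (L ^~ w) 0 1)%E.
  by rewrite mule_ge0 ?lee_fin// jsum_ge0.
apply: (@le_lt_trans _ _ (\int[P0]_w \sum_(0 <= k <oo)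
    (2 * 2^-1 ^+ k)%:E * jsum (indj (lnj phi) (2^-1 ^+ k)) (L ^~ w) 0 1)%E).
  apply: ge0_le_integral => //.
  - by move=> w _; apply: jsum_ge0 => x; exact: minj_ge0.
  - exact: (measurable_jsum_levy _ levyL (approx_minj p0') (lexx 0)).
  - by apply: (ge0_emeasurable_sum (P := xpredT)) => // k w _ _.
  - by move=> w _; exact: jsum_minj_layers.
rewrite integral_nneseries//.
(* The pull-back of the half-line along the square leaves out 0 only, where [lnj] vanishes. *)
pose D := (fun x : R => x ^+ 2) @^-1` `]0, +oo[%classic.
have msq : measurable_fun setT (fun x : R => x ^+ 2) by exact: measurable_funX.
have mD : measurable D by rewrite -[X in measurable X]setTI; exact: msq.
have mB k : measurable [set x | (2^-1 ^+ k < lnj phi x)%R].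
  by have := @measurable_fun_ltr _ _ _ setT _ _ (measurable_cst (2^-1 ^+ k : R)) (measurable_lnj p0')
    measurableT [set true] I; rewrite setTI; congr measurable; apply/seteqP; split.
have mlnj : measurable_fun D (EFin \o lnj phi).
  apply/measurable_EFinP; apply: measurable_funS (measurable_lnj p0') => //.
have lnoo : (\int[nuL]_(x in D) (lnj phi x)%:E < +oo)%E.
  have mf : measurable_fun (`]0, +oo[%classic : set R) (fun y : R => (ln (1 + phi * y))%:E).
    apply/measurable_EFinP; apply: measurableT_comp; first exact: measurable_ln.
    by apply: measurable_funD => //; apply: measurable_funM.
  have := ge0_integral_pushforward msq nuL (measurable_itv `]0, +oo[) mf.
  move=> E; apply: (@lt_trans _ _ eta%:E); last by rewrite ltry.
  apply: le_lt_trans Hphi; rewrite le_eqVlt; apply/orP; left; apply/eqP/esym.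
  apply: E => y; rewrite inE/= in_itv/= andbT => y0; rewrite lee_fin.
  by apply: ln_ge0; rewrite lerDl mulr_ge0// ltW.
(* The 4 is a factor 2 from the lower layer bound times a factor 2 from the upper one. *)
apply: (@le_lt_trans _ _ (\int[nuL]_(x in D) (4 * lnj phi x)%:E)%E); last first.
  under eq_integral do rewrite EFinM.
  rewrite ge0_integralZl_EFin//; first by rewrite lte_mul_pinfty.
  by move=> x _; rewrite lee_fin lnj_ge0.
have -> : (\sum_(0 <= k <oo) \int[P0]_w ((2 * 2^-1 ^+ k)%:E * jsum (indj (lnj phi) (2^-1 ^+ k)) (L ^~ w) 0 1) =
   \sum_(0 <= k <oo) \int[nuL]_(x in D) ((2 * 2^-1 ^+ k) * indj (lnj phi) (2^-1 ^+ k) x)%:E)%E.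
  apply: eq_eseriesr => k _; rewrite ge0_integralZl_EFin//; last first.
    by move=> w _; exact: jsum_ge0.
  rewrite integral_ind_levy//.
  under [RHS]eq_integral do rewrite EFinM.
  rewrite ge0_integralZl_EFin//; last 2 first.
  - by move=> x _; rewrite lee_fin.
  - apply/measurable_EFinP; apply: measurable_funS (_ : measurable_fun setT _) => //.
    rewrite [X in measurable_fun _ X](_ : _ = \1_[set x | (2^-1 ^+ k < lnj phi x)%R]).
      exact: measurable_indic.
    by apply/funext => x; rewrite indicE /indj; congr (nat_of_bool _)%:R; apply/idP/idP; rewrite inE.
  congr (_ * _)%E.
  transitivity (\int[nuL]_(x in D) (\1_[set x | (2^-1 ^+ k < lnj phi x)%R] x)%:E)%E.
    rewrite integral_indic//; congr (nuL _); apply/seteqP; split => x /=; last by case.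
    move=> H; split => //; rewrite /D /= in_itv/= andbT lt_neqAle sqr_ge0 andbT.
    rewrite eq_sym sqrf_eq0; apply/eqP => x0; move: H; rewrite x0 l0.
    by apply/negP; rewrite -leNgt ltW.
  apply: eq_integral => x _; rewrite indicE /indj; congr (nat_of_bool _)%:R%:E.
  by apply/idP/idP; rewrite inE.
rewrite -integral_nneseries//; last 2 first.
- move=> k; apply/measurable_EFinP; apply: measurable_funS (_ : measurable_fun setT _) => //.
  apply: measurable_funM => //.
  rewrite [X in measurable_fun _ X](_ : _ = \1_[set x | (2^-1 ^+ k < lnj phi x)%R]).
    exact: measurable_indic.
  by apply/funext => x; rewrite indicE /indj; congr (nat_of_bool _)%:R; apply/idP/idP; rewrite inE.
- by move=> k x _; rewrite lee_fin mulr_ge0.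
apply: ge0_le_integral => //.
- by move=> x _; apply: nneseries_ge0 => k _ _; rewrite lee_fin mulr_ge0.
- apply: (ge0_emeasurable_sum (P := xpredT)) => [k x _ _|k _]; first by rewrite lee_fin mulr_ge0.
  apply/measurable_EFinP; apply: measurable_funS (_ : measurable_fun setT _) => //.
  apply: measurable_funM => //.
  rewrite [X in measurable_fun _ X](_ : _ = \1_[set x | (2^-1 ^+ k < lnj phi x)%R]).
    exact: measurable_indic.
  by apply/funext => x; rewrite indicE /indj; congr (nat_of_bool _)%:R; apply/idP/idP; rewrite inE.
- apply/measurable_EFinP; apply: measurable_funM => //.
  exact/measurable_EFinP.
- move=> x _; apply: lime_le.
    by apply: is_cvg_nneseries => k _ _; rewrite lee_fin mulr_ge0.
  apply: nearW => n; rewrite sumEFin lee_fin big_mkord.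
  under eq_bigr do rewrite -mulrA.
  rewrite -mulr_sumr.
  have := layer_upper n (lnj_ge0 x p0').
  have : Num.max 0 (2 * lnj phi x - 2 * 2^-1 ^+ n) <= 2 * lnj phi x.
    rewrite ge_max mulr_ge0 ?lnj_ge0//= lerBlDr lerDl mulr_ge0// ltW//.
  by rewrite /indj; lra.
Qed.

Context {d} {T : measurableType d} (P : probability T R) (M : R -> {RV P >-> R}).
Hypothesis levyM : levy_process M.
Hypothesis margM : forall h, 0 <= h -> forall A : set R, measurable A ->
  P [set w | A (M h w)] = P0 [set w | A (L h w)].

(** On each interval between consecutive integers the jump sum of [minj] has finite mean, so it is
    almost surely finite on all of them at once, and [finite_sq_of_minj] passes to squares path by
    path. *)
Lemma ae_finite_jumps phi eta : 0 < phi -> Phi_L eta nuL phi ->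
  {ae P, forall w, finite_jumps (M ^~ w)}.
Proof.
move=> p0 Hphi; have p0' := ltW p0.
have cM w : cadlag (M ^~ w) by case: levyM.
have H n : {ae P, forall w, setT w -> (jsum (minj phi) (M ^~ w) n%:R n.+1%:R \is a fin_num)}.
  apply: integrable_ae => //; apply/integrableP; split.
    exact: (measurable_jsum_levy _ levyM (approx_minj p0') (ler0n _ _)).
  rewrite (eq_integral (fun w => jsum (minj phi) (M ^~ w) n%:R n.+1%:R)); last first.
    by move=> w _; rewrite gee0_abs// jsum_ge0// => x; exact: minj_ge0.
  rewrite (integral_jsum levyM levyL margM (approx_minj p0')) ?ler_nat//.
  have -> : n.+1%:R - n%:R = 1 :> R by rewrite -natr1 addrC addKr.
  exact: integral_minj_lty Hphi.
have := ae_foralln H; apply: filterS => w Hw b.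
have Hn n : (jsum sqj (M ^~ w) 0 n%:R < +oo)%E.
  elim: n => [|n IH]; first by rewrite jsum_nil ltry.
  rewrite (@jsumD R _ sqj 0 n%:R n.+1%:R sqj_ge0)// ?ler_nat//.
  apply: lte_add_pinfty => //; apply: (finite_sq_of_minj (cM w) p0) => //.
  by have := Hw n I; rewrite fin_num_abs; apply: le_lt_trans; exact: lee_abs.
have [n Hb] : exists n : nat, b <= n%:R.
  by exists (Num.truncn b).+1; apply: ltW; apply: truncnS_gt.
by apply: le_lt_trans (Hn n); apply: le_jsum => //; exact: sqj_ge0.
Qed.

End Finiteness.

End MeanJumps.

(** * Covariance of nonnegative variables with finite means *)

Section Covariance.
Context {R : realType} {d : measure_display} {T : measurableType d}.
Local Open Scope ereal_scope.

(** [F] may have infinite integral. In that case the negative part of [F - g] is at most [g], and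
    [F] is at most the positive part plus [g], so the positive part has infinite integral. *)
Lemma integral_sub_nneg (mu : {measure set T -> \bar R}) (F g : T -> R) :
  measurable_fun setT F -> measurable_fun setT g ->
  (forall w, 0 <= F w)%R -> (forall w, 0 <= g w)%R ->
  \int[mu]_w (g w)%:E < +oo ->
  \int[mu]_w (F w - g w)%:E = \int[mu]_w (F w)%:E - \int[mu]_w (g w)%:E.
Proof.
move=> mF mg F0 g0 goo.
have mFE : measurable_fun setT (EFin \o F) by exact/measurable_EFinP.
have mgE : measurable_fun setT (EFin \o g) by exact/measurable_EFinP.
have ig : mu.-integrable setT (EFin \o g).
  apply/integrableP; split => //.
  rewrite (eq_integral (EFin \o g))// => w _ /=.
  by rewrite ger0_norm.
have [Foo|] := boolP (\int[mu]_w (F w)%:E < +oo).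
  have iF : mu.-integrable setT (EFin \o F).
    apply/integrableP; split => //.
    rewrite (eq_integral (EFin \o F))// => w _ /=.
    by rewrite ger0_norm.
  by rewrite -integralB//.
rewrite -leNgt leye_eq => /eqP Foo.
have gf : \int[mu]_w (g w)%:E \is a fin_num.
  by rewrite ge0_fin_numE//; apply: integral_ge0 => w _; rewrite lee_fin.
rewrite Foo; have -> : +oo - \int[mu]_w (g w)%:E = +oo by move: gf; case: (\int[mu]_w _).
pose D := fun w => (F w - g w)%:E.
have mD : measurable_fun setT D by apply/measurable_EFinP; exact: measurable_funB.
rewrite -/D integralE.
have neg : \int[mu]_w D^\- w \is a fin_num.
  rewrite ge0_fin_numE; last exact: integral_ge0.
  apply: le_lt_trans goo; apply: ge0_le_integral => //.
    exact: measurable_funeneg.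
  move=> w _; rewrite funenegE /D -EFinN -EFin_max lee_fin ge_max g0 andbT.
  by have := F0 w; lra.
suff -> : \int[mu]_w D^\+ w = +oo by move: neg; case: (\int[mu]_w _).
apply/eqP; rewrite -leye_eq leNgt; apply/negP => Doo.
have : \int[mu]_w (F w)%:E <= \int[mu]_w (D^\+ w + (g w)%:E).
  apply: ge0_le_integral => //.
  - by move=> w _; rewrite lee_fin.
  - by apply: emeasurable_funD => //; exact: measurable_funepos.
  - move=> w _; rewrite funeposE /D -EFin_max -EFinD lee_fin -lerBlDr le_max lexx //.
rewrite Foo ge0_integralD//; last 2 first.
- exact: measurable_funepos.
- by move=> w _; rewrite lee_fin.
by rewrite leye_eq => /eqP H; have := lte_add_pinfty Doo goo; rewrite H.
Qed.

(** The centred product is the difference of the nonnegative functions X Y + a b and a Y + b X, the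
    second being integrable. The mean of X Y may be infinite. *)
Lemma covariance_nneg (P : probability T R) (X Y : T -> R) :
  measurable_fun setT X -> measurable_fun setT Y ->
  (forall w, 0 <= X w)%R -> (forall w, 0 <= Y w)%R ->
  \int[P]_w (X w)%:E < +oo -> \int[P]_w (Y w)%:E < +oo ->
  covariance P X Y =
    \int[P]_w (X w * Y w)%:E - \int[P]_w (X w)%:E * \int[P]_w (Y w)%:E.
Proof.
move=> mX mY X0 Y0 Xoo Yoo; rewrite unlock.
have Xf : \int[P]_w (X w)%:E \is a fin_num.
  by rewrite ge0_fin_numE//; apply: integral_ge0 => w _; rewrite lee_fin.
have Yf : \int[P]_w (Y w)%:E \is a fin_num.
  by rewrite ge0_fin_numE//; apply: integral_ge0 => w _; rewrite lee_fin.
rewrite ![in fine _]unlock unlock.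
set a := fine (\int[P]_w (X w)%:E); set b := fine (\int[P]_w (Y w)%:E).
have a0 : (0 <= a)%R by apply: fine_ge0; apply: integral_ge0 => w _; rewrite lee_fin.
have b0 : (0 <= b)%R by apply: fine_ge0; apply: integral_ge0 => w _; rewrite lee_fin.
have mXY : measurable_fun setT (fun w => X w * Y w)%R by exact: measurable_funM.
have maY : measurable_fun setT (fun w => a * Y w)%R by exact: measurable_funM.
have mbX : measurable_fun setT (fun w => b * X w)%R by exact: measurable_funM.
have Ig : \int[P]_w (a * Y w + b * X w)%:E = (a * b + b * a)%:E.
  under eq_integral do rewrite EFinD !EFinM.
  rewrite ge0_integralD//.
  - rewrite !ge0_integralZl_EFin//; first by rewrite EFinD !EFinM !fineK.
    + by move=> w _; rewrite lee_fin.
    + exact/measurable_EFinP.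
    + by move=> w _; rewrite lee_fin.
    + exact/measurable_EFinP.
  - by move=> w _; rewrite lee_fin mulr_ge0.
  - exact/measurable_EFinP.
  - by move=> w _; rewrite lee_fin mulr_ge0.
  - exact/measurable_EFinP.
transitivity (\int[P]_w ((X w * Y w + a * b) - (a * Y w + b * X w))%:E).
  apply: eq_integral => w _; congr EFin. rewrite -[LHS]/((X w - a) * (Y w - b))%R; ring.
rewrite integral_sub_nneg ?Ig ?ltry//.
- under eq_integral do rewrite EFinD.
  rewrite ge0_integralD//.
  + have -> : \int[P]_w (a * b)%:E = (a * b)%:E.
      by have := expectation_cst P (a * b)%R; rewrite unlock.
    rewrite -addeA; congr (_ + _).
    rewrite -[X in _ = - (X * _)]fineK// -[X in _ = - (_ * X)]fineK// -/a -/b -EFinM -EFinN -EFinB.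
    by congr EFin; ring.
  + by move=> w _; rewrite lee_fin mulr_ge0.
  + exact/measurable_EFinP.
  + by move=> w _; rewrite lee_fin mulr_ge0.
- by apply: measurable_funD.
- by apply: measurable_funD.
- by move=> w; rewrite addr_ge0// mulr_ge0.
- by move=> w; rewrite addr_ge0// mulr_ge0.
Qed.

End Covariance.

(** * Additive functions, exponential limits and grid products of jump sums *)

Section RealLemmas.
Context {R : realType}.
Implicit Types (g : R -> R) (f : R -> R) (a b s x phi c : R).

(** The Cauchy equation for a nonnegative, hence nondecreasing, function. *)
Lemma additive_linear (f : R -> R) : (forall s t, 0 <= s -> 0 <= t -> f (s + t) = f s + f t) ->
  (forall t, 0 <= t -> 0 <= f t) -> forall t, 0 <= t -> f t = t * f 1.
Proof.
move=> fD f0 t t0.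
have fn s n : 0 <= s -> f (n%:R * s) = n%:R * f s.
  move=> s0; elim: n => [|n IH].
    rewrite !mul0r; have := fD 0 0 (lexx 0) (lexx 0); rewrite addr0; lra.
  by rewrite -natr1 !mulrDl !mul1r fD ?IH// mulr_ge0.
have fm s u : 0 <= s -> s <= u -> f s <= f u.
  move=> s0 su; have -> : u = s + (u - s) by ring.
  by rewrite fD ?subr_ge0// lerDl f0// subr_ge0.
have f1 : 0 <= f 1 by apply: f0.
(* Both n f(t) and n t f(1) lie between k f(1) and (k + 1) f(1), with [k] the integer part of n
   t. *)
have key n : `|n%:R * (f t - t * f 1)| <= f 1.
  have nt0 : 0 <= n%:R * t by rewrite mulr_ge0.
  have /andP[k1 k2] := truncn_itv nt0.
  set k := Num.truncn _ in k1 k2.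
  have e1 : k%:R * f 1 <= n%:R * f t.
    by rewrite -!fn// mulr1 fm.
  have e2 : n%:R * f t <= k.+1%:R * f 1.
    by rewrite -!fn// mulr1 fm// ltW.
  have e3 : k%:R * f 1 <= n%:R * t * f 1 by rewrite ler_wpM2r.
  have e4 : n%:R * t * f 1 <= k.+1%:R * f 1 by rewrite ler_wpM2r// ltW.
  move: e2 e4; rewrite -natr1 mulrDl mul1r => e2 e4.
  rewrite mulrBr mulrA ler_norml; apply/andP; split; lra.
apply/eqP; rewrite -subr_eq0 -normr_le0 leNgt; apply/negP => d0.
have [n Hn] : exists n : nat, f 1 / `|f t - t * f 1| < n%:R.
  by exists (Num.truncn (f 1 / `|f t - t * f 1|)).+1; apply: truncnS_gt.
by have := key n; rewrite normrM normr_nat leNgt -ltr_pdivrMr// Hn.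
Qed.

(** Squeeze by u / (1 + u) <= ln (1 + u) <= u at u = x_N / (N + 1). *)
Lemma cvg_1Dx_pow (x : nat -> R) (l : R) : (forall N, 0 <= x N) -> x N @[N --> \oo] --> l ->
  (1 + x N / N.+1%:R) ^+ N.+1 @[N --> \oo] --> expR l.
Proof.
move=> x0 xl.
have c0 : x N / N.+1%:R @[N --> \oo] --> 0.
  by rewrite -[X in _ --> X](mulr0 l); apply: cvgM => //; exact: cvg_harmonic.
apply: (@squeeze_cvgr _ _ _ _ (fun N => expR (x N / (1 + x N / N.+1%:R))) (fun N => expR (x N))).
- apply: nearW => N.
  set u := x N / N.+1%:R.
  have u0 : 0 <= u by rewrite divr_ge0.
  have xu : x N = u *+ N.+1.
    by rewrite -mulr_natr /u divfK.
  have -> : expR (x N / (1 + u)) = expR (u / (1 + u)) ^+ N.+1.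
    by rewrite -expRM_natl {1}xu -mulr_natl mulrA.
  rewrite xu -mulr_natl expRM_natl.
  rewrite !lerXn2r ?nnegrE ?expR_ge0 ?addr_ge0//=.
    exact: expR_ge1Dx.
  have u1 : 0 < 1 + u by rewrite ltr_pwDl.
  by rewrite -[leRHS]lnK ?posrE// ler_expR ln1D_ge.
- apply: (continuous_cvg _ (@continuous_expR R _)).
  have -> : l = l / (1 + 0) by rewrite addr0 divr1.
  apply: cvgM => //; apply: cvgV; first by rewrite addr0.
  by apply: cvgD => //; exact: cvg_cst.
- exact: (continuous_cvg _ (@continuous_expR R _)).
Qed.

Lemma grid_index (s : seq R) a b : uniq s -> (forall x, x \in s -> a < x <= b) ->
  \forall N \near \oo, exists k : R -> nat, {in s &, injective k} /\
    forall x, x \in s -> (k x < N.+1)%N /\ grid a b N.+1 (k x) < x <= grid a b N.+1 (k x).+1.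
Proof.
move=> us Ss.
have [d2 d20 Hd2] : exists2 d : R, 0 < d & forall z, z \in [seq (x, y) | x <- s, y <- s] ->
      d <= (if z.1 == z.2 then 1 else `|z.1 - z.2|).
  by apply: seq_pos_lower => y _; case: ifPn => // yn; rewrite normr_gt0 subr_eq0.
near=> N.
have mN2 : (b - a) / N.+1%:R < d2 by near: N; exact: mesh_near.
have /choice [k Hk] : forall x : R, exists k, x \in s ->
   (k < N.+1)%N /\ grid a b N.+1 k < x <= grid a b N.+1 k.+1.
  move=> x; have [xs|_] := boolP (x \in s); last by exists 0%N.
  by have [k Hk] := grid_ex N (Ss _ xs); exists k.
exists k; split => // x y xs ys kxy.
have /andP[A B] := (Hk _ xs).2; have /andP[C D] := (Hk _ ys).2.
apply/eqP/negPn/negP => xy.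
have := Hd2 (x, y) (allpairs_f (fun x y => (x, y)) xs ys); rewrite /= (negbTE xy).
move: A B C D; rewrite -kxy gridS => A B C D.
move: mN2 A B C D; set mesh := (b - a) / N.+1%:R => mN2 A B C D.
have : `|x - y| <= mesh by rewrite ler_norml; apply/andP; split; lra.
lra.
Unshelve. all: by end_near.
Qed.

(** One plus a sum of nonnegative terms is at most the product of the one plus each term. *)
Lemma ln_jsum_le phi f a b : 0 <= phi -> (jsum sqj f a b < +oo)%E ->
  ln (1 + phi * fine (jsum sqj f a b)) <= fine (jsum (lnj phi) f a b).
Proof.
move=> p0 Soo; have jf := jsum_lnj_fin p0 Soo; set j := fine (jsum (lnj phi) f a b).
have Sf : jsum sqj f a b \is a fin_num by rewrite ge0_fin_numE// jsum_ge0// => x; exact: sqj_ge0.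
have s0 : 0 <= fine (jsum sqj f a b) by apply: fine_jsum_ge0 => x; exact: sqj_ge0.
have key (l : seq R) : 1 + phi * \sum_(x <- l) sqj (jump f x) <=
    expR (\sum_(x <- l) lnj phi (jump f x)).
  elim: l => [|x l IH]; first by rewrite !big_nil mulr0 addr0 expR0.
  rewrite !big_cons expRD {1}/lnj lnK; last first.
    by rewrite posrE (lt_le_trans ltr01)// lnj_arg.
  set S1 := \sum_(x <- l) sqj _ in IH *.
  have S10 : 0 <= S1 by apply: sumr_ge0 => y _; exact: sqj_ge0.
  have x20 : 0 <= phi * sqj (jump f x) by rewrite mulr_ge0// sqj_ge0.
  apply: le_trans (ler_wpM2l _ IH); last by rewrite -[leLHS]addr0 lerD.
  rewrite -[X in (1 + phi * X) * _]/(sqj (jump f x)).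
  have := mulr_ge0 x20 (mulr_ge0 p0 S10); nra.
have phij : 1 + phi * fine (jsum sqj f a b) <= expR j.
  have [->|pn] := eqVneq phi 0.
    rewrite mul0r addr0 -[leLHS]expR0 ler_expR /j.
    by apply: fine_jsum_ge0 => x; exact: lnj_ge0.
  have pp : 0 < phi by rewrite lt_neqAle eq_sym pn.
  rewrite -lerBrDl mulrC -ler_pdivlMr// -lee_fin fineK//.
  apply: ge_ereal_sup => _ [F [fF FI] <-].
  rewrite fsbig_finite//= sumEFin lee_fin ler_pdivlMr// mulrC lerBrDl.
  apply: le_trans (key _) _; rewrite ler_expR /j -lee_fin fineK//.
  by apply: ereal_sup_ubound; exists F => //; rewrite fsbig_finite//= sumEFin.
rewrite -[leRHS]expRK ler_ln ?posrE ?expR_gt0//.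
by rewrite ltr_pwDl// mulr_ge0.
Qed.

Lemma jsum_grid g f a b N n : (forall x, 0 <= g x) -> a <= b -> (n <= N.+1)%N ->
  (\sum_(k < n) jsum g f (grid a b N.+1 k) (grid a b N.+1 k.+1))%E =
  jsum g f a (grid a b N.+1 n).
Proof.
move=> g0 ab; elim: n => [|n IH] nN; first by rewrite big_ord0 grid0 jsum_nil.
rewrite big_ord_recr/= IH 1?ltnW// -jsumD//; last exact: grid_le.
by rewrite -[X in X <= _](grid0 a b N.+1) grid_le.
Qed.

(** The upper bound is [ln_jsum_le] in every cell. For the limit, finitely many jumps exhaust the
    sum up to [e], a fine grid puts them into different cells, and each such cell contributes at
    least the [lnj] of its jump. *)
Lemma lnprod_cvg phi f h : 0 <= phi -> 0 <= h -> (jsum sqj f 0 h < +oo)%E ->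
  (forall N, \sum_(k < N.+1) ln (1 + phi * fine (jsum sqj f (grid 0 h N.+1 k) (grid 0 h N.+1 k.+1)))
    <= fine (jsum (lnj phi) f 0 h)) /\
  \sum_(k < N.+1) ln (1 + phi * fine (jsum sqj f (grid 0 h N.+1 k) (grid 0 h N.+1 k.+1)))
    @[N --> \oo] --> fine (jsum (lnj phi) f 0 h).
Proof.
move=> p0 h0 Soo; have jf := jsum_lnj_fin p0 Soo.
have g0 N k : 0 <= grid 0 h N.+1 k by rewrite -[X in X <= _](grid0 0 h N.+1) grid_le.
have gh N k : (k < N.+1)%N -> grid 0 h N.+1 k.+1 <= h.
  by move=> kN; rewrite -[X in _ <= X](gridN 0 h N) grid_le.
have Sk N k : (k < N.+1)%N ->
    (jsum sqj f (grid 0 h N.+1 k) (grid 0 h N.+1 k.+1) < +oo)%E.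
  move=> kN; apply: le_lt_trans Soo; apply: le_jsum => //; [exact: sqj_ge0|exact: gh].
have l0 x : 0 <= lnj phi x by exact: lnj_ge0.
have up N : \sum_(k < N.+1) ln (1 + phi * fine (jsum sqj f (grid 0 h N.+1 k) (grid 0 h N.+1 k.+1)))
    <= fine (jsum (lnj phi) f 0 h).
  have E := jsum_grid f l0 h0 (leqnn N.+1); rewrite gridN in E; rewrite -E.
  rewrite -sum_fine; last by move=> k _; apply: jsum_lnj_fin => //; exact: Sk.
  by apply: ler_sum => k _; apply: ln_jsum_le => //; exact: Sk.
split => //.
apply/cvgrPdist_le => e e0.
have [_ [F [fF FI] <-] HF] : exists2 x, [set (\sum_(x \in F) (lnj phi (jump f x))%:E)%E |
     F in fsets `]0%R, h]%classic] x & (jsum (lnj phi) f 0 h - e%:E < x)%E.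
  by apply: ereal_sup_gt; rewrite -/(jsum _ _ _ _) lteBlDr// lteDl// lte_fin.
move: HF; rewrite fsbig_finite//= sumEFin.
set l := finmap.enum_fset (fset_set F) => HF.
have ul : uniq l by exact: finmap.fset_uniq.
have Sl x : x \in l -> 0 < x <= h.
  by move=> /(mem_enum_fset_set fF)/FI; rewrite /= in_itv.
near=> N.
have [k [ki Hk]] : exists k : R -> nat, {in l &, injective k} /\
    forall x, x \in l -> (k x < N.+1)%N /\ grid 0 h N.+1 (k x) < x <= grid 0 h N.+1 (k x).+1.
  by near: N; exact: grid_index.
rewrite ger0_norm; last by rewrite subr_ge0 up.
rewrite lerBlDr -lerBlDl.
have {}HF : fine (jsum (lnj phi) f 0 h) - e <= \sum_(x <- l) lnj phi (jump f x).
  by rewrite -lee_fin EFinB fineK// ltW.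
apply: le_trans HF _.
pose F' j := ln (1 + phi * fine (jsum sqj f (grid 0 h N.+1 j) (grid 0 h N.+1 j.+1))).
have F'0 j : (j < N.+1)%N -> 0 <= F' j.
  move=> jN; apply: ln_ge0; rewrite lerDl mulr_ge0//.
  by apply: fine_jsum_ge0 => x; exact: sqj_ge0.
apply: (@le_trans _ _ (\sum_(x <- l) F' (k x))).
  rewrite big_seq [leRHS]big_seq; apply: ler_sum => x xl.
  have [kN /andP[kx1 kx2]] := Hk _ xl.
  rewrite /F' ler_ln ?posrE; last 2 first.
  - by rewrite (lt_le_trans ltr01)// lnj_arg.
  - by rewrite ltr_pwDl// mulr_ge0// fine_jsum_ge0// => y; exact: sqj_ge0.
  rewrite lerD2l ler_wpM2l// -lee_fin fineK; last first.
    by rewrite ge0_fin_numE ?Sk// jsum_ge0// => y; exact: sqj_ge0.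
  by apply: (@jsum_ge1 R f sqj _ _ x sqj_ge0); rewrite kx1.
rewrite -(big_mkord xpredT F') -(big_map k xpredT F').
rewrite [leRHS](bigID (mem [seq k x | x <- l]))/= -[leLHS]addr0.
apply: lerD; last first.
  rewrite big_seq_cond; apply: sumr_ge0 => j; rewrite mem_index_iota => /andP[jN _].
  exact: F'0.
rewrite -[leRHS]big_filter le_eqVlt; apply/orP; left; apply/eqP; apply: perm_big.
have um : uniq [seq k x | x <- l] by rewrite map_inj_in_uniq.
apply: uniq_perm => //; first by rewrite filter_uniq// iota_uniq.
move=> j; rewrite mem_filter mem_index_iota/=.
case: (boolP (j \in _)) => //= /mapP[x xl ->].
by have [->] := Hk _ xl.
Unshelve. all: by end_near.
Qed.

End RealLemmas.

(** * Mean and variance of the subordinator are linear in time *)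

Section LevyMoments.
Context {R : realType}.
Context {d0} {T0 : measurableType d0} (P0 : probability T0 R) (L : R -> {RV P0 >-> R}).
Hypothesis levyL : levy_process L.
Hypothesis finL : {ae P0, forall w, finite_jumps (L ^~ w)}.
Implicit Types (a b s t h phi : R).

Definition sqsum a b w : R := fine (jsum sqj (L ^~ w) a b).
(** The stochastic exponential of phi S at time [h], that is, exp(eta h - X_h) where the squared
    jumps are summable. *)
Definition gam phi h w : R := expR (fine (jsum (lnj phi) (L ^~ w) 0 h)).

Let margL : forall h, 0 <= h -> forall A : set R, measurable A ->
  P0 [set w | A (L h w)] = P0 [set w | A (L h w)].
Proof. by []. Qed.

Lemma measurable_sqsum a b : 0 <= a -> measurable_fun setT (sqsum a b).
Proof.
move=> a0; apply: measurableT_comp => //.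
exact: (measurable_jsum_levy b levyL approx_sq a0).
Qed.

Lemma sqsum_ge0 a b w : 0 <= sqsum a b w.
Proof. by apply: fine_jsum_ge0; exact: sqj_ge0. Qed.

Lemma measurable_gam phi h : 0 <= phi -> measurable_fun setT (gam phi h).
Proof.
move=> p0; apply: (measurableT_comp (@measurable_expR R)); apply: measurableT_comp => //.
exact: (measurable_jsum_levy h levyL (approx_lnj p0) (lexx 0)).
Qed.

Lemma jsum_sq_fin (f : R -> R) a b : finite_jumps f -> 0 <= a -> jsum sqj f a b \is a fin_num.
Proof.
move=> ff a0; rewrite ge0_fin_numE ?finite_jumps_lty// jsum_ge0// => x.
exact: sqj_ge0.
Qed.

Lemma sqsumD s t w : finite_jumps (L ^~ w) -> 0 <= s -> 0 <= t ->
  sqsum 0 (s + t) w = sqsum 0 s w + sqsum s (s + t) w.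
Proof.
move=> fw s0 t0; rewrite /sqsum (@jsumD _ _ _ 0 s) ?lerDl//; last exact: sqj_ge0.
by rewrite fineD ?jsum_sq_fin.
Qed.

Lemma integral_shift (Z : (R -> R) -> R -> R -> R) s t : jfunct Z -> 0 <= s -> 0 <= t ->
  (\int[P0]_w (Z (L ^~ w) 0 t)%:E < +oo ->
   \int[P0]_w (Z (L ^~ w) s (s + t))%:E = \int[P0]_w (Z (L ^~ w) 0 t)%:E)%E.
Proof.
move=> jZ s0 t0 Zoo.
pose u (n : nat) := if n is 0%N then s else s + t.
have um : {homo u : m n / (m <= n)%N >-> m <= n} by move=> [|i] [|j] //= _; rewrite lerDl.
have st : s + t - s = t by rewrite addrC addKr.
have := integral_jfunct_prod levyL levyL margL finL finL (t := u) (K := 1%N) (Z := fun=> Z) s0 um (fun=> jZ).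
rewrite big_nat1 /= st => <-.
  by apply: eq_integral => w _; rewrite big_nat1.
by case => //= _; rewrite st.
Qed.

Lemma integral_two (Z : (R -> R) -> R -> R -> R) s t : jfunct Z -> 0 <= s -> 0 <= t ->
  (\int[P0]_w (Z (L ^~ w) 0 s)%:E < +oo -> \int[P0]_w (Z (L ^~ w) 0 t)%:E < +oo ->
   \int[P0]_w (Z (L ^~ w) 0 s * Z (L ^~ w) s (s + t))%:E =
   \int[P0]_w (Z (L ^~ w) 0 s)%:E * \int[P0]_w (Z (L ^~ w) 0 t)%:E)%E.
Proof.
move=> jZ s0 t0 Zs Zt.
pose u (n : nat) := match n with 0%N => 0 | 1%N => s | _ => s + t end.
have um : {homo u : m n / (m <= n)%N >-> m <= n}.
  by move=> [|[|i]] [|[|j]] //= _; rewrite ?lerDl ?addr_ge0.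
have st : s + t - s = t by rewrite addrC addKr.
have := integral_jfunct_prod levyL levyL margL finL finL (t := u) (K := 2%N) (Z := fun=> Z) (lexx 0) um (fun=> jZ).
rewrite !big_nat_recl//= !big_geq// mule1 subr0 st => <-.
  by apply: eq_integral => w _; rewrite !big_nat_recl//= big_geq// mulr1.
by case=> [|[|]] //= _; rewrite ?subr0 ?st.
Qed.

Section FirstMoment.
Hypothesis mu_fin : (\int[P0]_w (sqsum 0 1 w)%:E < +oo)%E.

Definition mean1 h : R := fine (\int[P0]_w (sqsum 0 h w)%:E)%E.

Lemma integral_sqsum h : (\int[P0]_w (sqsum 0 h w)%:E = \int[P0]_w jsum sqj (L ^~ w) 0 h)%E.
Proof.
apply: ae_integral; apply: filterS finL => w fw _.
by rewrite /sqsum fineK// jsum_sq_fin.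
Qed.

Lemma integral_sqsumD s t : 0 <= s -> 0 <= t ->
  (\int[P0]_w (sqsum 0 (s + t) w)%:E =
   \int[P0]_w (sqsum 0 s w)%:E + \int[P0]_w (sqsum 0 t w)%:E)%E.
Proof.
move=> s0 t0; rewrite !integral_sqsum.
have st : s <= s + t by rewrite lerDl.
have -> : (\int[P0]_w jsum sqj (L ^~ w) 0 t = \int[P0]_w jsum sqj (L ^~ w) s (s + t))%E.
  by rewrite (integral_jsum levyL levyL margL approx_sq s0 st) addrC addKr.
rewrite -ge0_integralD//.
- by apply: eq_integral => w _; rewrite (@jsumD _ _ _ 0 s)//; exact: sqj_ge0.
- by move=> w _; apply: jsum_ge0; exact: sqj_ge0.
- exact: (measurable_jsum_levy s levyL approx_sq (lexx 0)).
- by move=> w _; apply: jsum_ge0; exact: sqj_ge0.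
- exact: (measurable_jsum_levy (s + t) levyL approx_sq s0).
Qed.

Lemma integral_sqsum_ge0 h : (0 <= \int[P0]_w (sqsum 0 h w)%:E)%E.
Proof. by apply: integral_ge0 => w _; rewrite lee_fin sqsum_ge0. Qed.

Lemma sqsum_le a b h w : finite_jumps (L ^~ w) -> 0 <= a -> b <= h -> sqsum a b w <= sqsum a h w.
Proof.
move=> fw a0 bh; rewrite /sqsum fine_le ?jsum_sq_fin//.
by apply: le_jsum => //; exact: sqj_ge0.
Qed.

Lemma integral_sqsum_lty h : (\int[P0]_w (sqsum 0 h w)%:E < +oo)%E.
Proof.
have Hn n : (\int[P0]_w (sqsum 0 n%:R w)%:E < +oo)%E.
  elim: n => [|n IH].
    under eq_integral do rewrite /sqsum jsum_nil.
    by rewrite integral0 ltry.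
  by rewrite -natr1 integral_sqsumD// lte_add_pinfty.
apply: le_lt_trans (Hn (Num.truncn h).+1).
apply: ae_ge0_le_integral => //.
- by move=> w _; rewrite lee_fin sqsum_ge0.
- by apply/measurable_EFinP; exact: measurable_sqsum.
- by move=> w _; rewrite lee_fin sqsum_ge0.
- by apply/measurable_EFinP; exact: measurable_sqsum.
- apply: filterS finL => w fw _; rewrite lee_fin; apply: sqsum_le => //.
  by apply: ltW; exact: truncnS_gt.
Qed.

Lemma integral_sqsum_fin h : (\int[P0]_w (sqsum 0 h w)%:E)%E \is a fin_num.
Proof. by rewrite ge0_fin_numE ?integral_sqsum_lty ?integral_sqsum_ge0. Qed.

Lemma mean1_linear h : 0 <= h -> mean1 h = h * mean1 1.
Proof.
apply: additive_linear => [s t s0 t0|t t0].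
  by rewrite /mean1 integral_sqsumD// fineD// integral_sqsum_fin.
by apply: fine_ge0; exact: integral_sqsum_ge0.
Qed.

Lemma mean1_ge0 : 0 <= mean1 1.
Proof. by apply: fine_ge0; exact: integral_sqsum_ge0. Qed.

Section SecondMoment.
Hypothesis m2_fin : (\int[P0]_w (sqsum 0 1 w ^+ 2)%:E < +oo)%E.

Lemma measurable_sqsumX a b n : 0 <= a -> measurable_fun setT (fun w => sqsum a b w ^+ n).
Proof. by move=> a0; apply: measurable_funX; exact: measurable_sqsum. Qed.

(** Time is doubled by (x + y)^2 <= 2 x^2 + 2 y^2 and stationarity, which reaches every 2^n from
    time 1. *)
Lemma integral_sqsum2_lty h : (\int[P0]_w (sqsum 0 h w ^+ 2)%:E < +oo)%E.
Proof.
have Hn n : (\int[P0]_w (sqsum 0 (2 ^+ n) w ^+ 2)%:E < +oo)%E.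
  elim: n => [|n IH]; first by rewrite expr0.
  have n0 : 0 <= 2 ^+ n :> R by rewrite exprn_ge0.
  have E : 2 ^+ n.+1 = 2 ^+ n + 2 ^+ n :> R by rewrite exprS; ring.
  apply: (@le_lt_trans _ _ (\int[P0]_w ((2 * sqsum 0 (2 ^+ n) w ^+ 2)%:E +
     (2 * sqsum (2 ^+ n) (2 ^+ n + 2 ^+ n) w ^+ 2)%:E))%E).
    apply: ae_ge0_le_integral => //.
    - by move=> w _; rewrite lee_fin exprn_ge0// sqsum_ge0.
    - by apply/measurable_EFinP; exact: measurable_sqsumX.
    - by move=> w _; rewrite -EFinD lee_fin addr_ge0// mulr_ge0// exprn_ge0// sqsum_ge0.
    - by apply: emeasurable_funD; apply/measurable_EFinP; apply: measurable_funM => //; exact: measurable_sqsumX.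
    - apply: filterS finL => w fw _; rewrite -EFinD lee_fin E sqsumD//.
      set x := sqsum 0 _ w; set y := sqsum _ _ w.
      have : 0 <= (x - y) ^+ 2 by exact: sqr_ge0.
      rewrite !expr2; lra.
  rewrite ge0_integralD//; last 4 first.
  - by move=> w _; rewrite lee_fin mulr_ge0// exprn_ge0// sqsum_ge0.
  - by apply/measurable_EFinP; apply: measurable_funM => //; exact: measurable_sqsumX.
  - by move=> w _; rewrite lee_fin mulr_ge0// exprn_ge0// sqsum_ge0.
  - by apply/measurable_EFinP; apply: measurable_funM => //; exact: measurable_sqsumX.
  under eq_integral do rewrite EFinM.
  under [X in (_ + X)%E]eq_integral do rewrite EFinM.
  rewrite !ge0_integralZl_EFin//; last 4 first.
  - by move=> w _; rewrite lee_fin exprn_ge0// sqsum_ge0.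
  - by apply/measurable_EFinP; exact: measurable_sqsumX.
  - by move=> w _; rewrite lee_fin exprn_ge0// sqsum_ge0.
  - by apply/measurable_EFinP; exact: measurable_sqsumX.
  rewrite (integral_shift (jfunct_exp 2 jfunct_S))//.
  by rewrite lte_add_pinfty// lte_mul_pinfty.
have [n Hh] : exists n : nat, h <= 2 ^+ n.
  exists (Num.truncn h).+1; apply: (@le_trans _ _ (Num.truncn h).+1%:R).
    by apply: ltW; exact: truncnS_gt.
  by rewrite -natrX ler_nat ltnW// ltn_expl.
apply: le_lt_trans (Hn n).
apply: ae_ge0_le_integral => //.
- by move=> w _; rewrite lee_fin exprn_ge0// sqsum_ge0.
- by apply/measurable_EFinP; exact: measurable_sqsumX.
- by move=> w _; rewrite lee_fin exprn_ge0// sqsum_ge0.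
- by apply/measurable_EFinP; exact: measurable_sqsumX.
- apply: filterS finL => w fw _; rewrite lee_fin.
  by rewrite lerXn2r ?nnegrE ?sqsum_ge0// sqsum_le.
Qed.

Definition mean2 h : R := fine (\int[P0]_w (sqsum 0 h w ^+ 2)%:E)%E.

Lemma integral_sqsum2_fin h : (\int[P0]_w (sqsum 0 h w ^+ 2)%:E)%E \is a fin_num.
Proof.
rewrite ge0_fin_numE ?integral_sqsum2_lty//.
by apply: integral_ge0 => w _; rewrite lee_fin exprn_ge0// sqsum_ge0.
Qed.

Lemma mean2D s t : 0 <= s -> 0 <= t ->
  mean2 (s + t) = mean2 s + 2 * mean1 s * mean1 t + mean2 t.
Proof.
move=> s0 t0; rewrite /mean2 /mean1.
have -> : (\int[P0]_w (sqsum 0 (s + t) w ^+ 2)%:E = \int[P0]_w ((sqsum 0 s w ^+ 2)%:E +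
   (2 * (sqsum 0 s w * sqsum s (s + t) w))%:E + (sqsum s (s + t) w ^+ 2)%:E))%E.
  apply: ae_integral; apply: filterS finL => w fw _.
  by rewrite sqsumD// -!EFinD; congr EFin; ring.
have mp : measurable_fun setT (fun w => sqsum 0 s w * sqsum s (s + t) w).
  by apply: measurable_funM; exact: measurable_sqsum.
have p0 w : 0 <= sqsum 0 s w * sqsum s (s + t) w by rewrite mulr_ge0// sqsum_ge0.
rewrite ge0_integralD//; last 4 first.
- by move=> w _; rewrite -EFinD lee_fin addr_ge0 ?exprn_ge0 ?sqsum_ge0// mulr_ge0.
- apply: emeasurable_funD; apply/measurable_EFinP; first exact: measurable_sqsumX.
  exact: measurable_funM.
- by move=> w _; rewrite lee_fin exprn_ge0// sqsum_ge0.
- by apply/measurable_EFinP; exact: measurable_sqsumX.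
rewrite ge0_integralD//; last 4 first.
- by move=> w _; rewrite lee_fin exprn_ge0// sqsum_ge0.
- by apply/measurable_EFinP; exact: measurable_sqsumX.
- by move=> w _; rewrite lee_fin mulr_ge0.
- by apply/measurable_EFinP; exact: measurable_funM.
under [X in (_ + X + _)%E]eq_integral do rewrite EFinM.
rewrite ge0_integralZl_EFin//; last 2 first.
- by move=> w _; rewrite lee_fin.
- exact/measurable_EFinP.
rewrite (integral_shift (jfunct_exp 2 jfunct_S))//; last exact: integral_sqsum2_lty.
rewrite (integral_two jfunct_S)//; [|exact: integral_sqsum_lty|exact: integral_sqsum_lty].
have f1 := integral_sqsum_fin s; have f2 := integral_sqsum_fin t.
have g1 := integral_sqsum2_fin s; have g2 := integral_sqsum2_fin t.
rewrite -/(sqsum 0 s _).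
rewrite fineD//; last by rewrite fin_numD g1 fin_numM// fin_numM.
rewrite fineD//; last by rewrite fin_numM// fin_numM.
by rewrite fineM//= ?fin_numM// fineM// mulrA.
Qed.

Definition var1 : R := mean2 1 - mean1 1 ^+ 2.

Lemma variance_sqsum h : 0 <= h -> 'V_P0[sqsum 0 h] = (mean2 h - mean1 h ^+ 2)%:E.
Proof.
move=> h0; rewrite /variance covariance_nneg.
- rewrite EFinB expr2 EFinM !fineK ?integral_sqsum_fin ?integral_sqsum2_fin//.
- exact: measurable_sqsum.
- exact: measurable_sqsum.
- by move=> w; exact: sqsum_ge0.
- by move=> w; exact: sqsum_ge0.
- exact: integral_sqsum_lty.
- exact: integral_sqsum_lty.
Qed.

(** By [mean2D] the variance is additive in [h]; it is nonnegative, so [additive_linear] applies. *)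
Lemma var_linear h : 0 <= h -> mean2 h = h * var1 + (h * mean1 1) ^+ 2.
Proof.
move=> h0; rewrite -mean1_linear//.
have := @additive_linear R (fun h => mean2 h - mean1 h ^+ 2).
move=> /(_ _ _ h h0) H.
rewrite /var1 -H; first by rewrite subrK.
- move=> s t s0 t0; rewrite mean2D// (mean1_linear (addr_ge0 s0 t0)) (mean1_linear s0) (mean1_linear t0).
  by ring.
- by move=> t t0; rewrite -lee_fin -variance_sqsum// variance_ge0.
Qed.

Lemma var1_ge0 : 0 <= var1.
Proof. by rewrite -lee_fin -variance_sqsum// variance_ge0. Qed.

End SecondMoment.
End FirstMoment.
End LevyMoments.

(** * Moments of the stochastic exponential *)

Section GammaMoment.
Context {R : realType}.
Context {d0} {T0 : measurableType d0} (P0 : probability T0 R) (L : R -> {RV P0 >-> R}).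
Hypothesis levyL : levy_process L.
Hypothesis finL : {ae P0, forall w, finite_jumps (L ^~ w)}.
Variables (phi : R) (n : nat) (g b : R).
Hypotheses (phi0 : 0 <= phi) (g0 : 0 <= g) (b0 : 0 <= b).
Hypothesis Hn : forall h, 0 <= h ->
  (\int[P0]_w ((1 + phi * sqsum L 0 h w) ^+ n)%:E = (1 + h * (g + h * b))%:E)%E.
Implicit Types h : R.

Let margL : forall h, 0 <= h -> forall A : set R, measurable A ->
  P0 [set w | A (L h w)] = P0 [set w | A (L h w)].
Proof. by []. Qed.

Definition dprod h N w := \prod_(0 <= k < N.+1)
  (1 + phi * sqsum L (grid 0 h N.+1 k) (grid 0 h N.+1 k.+1) w) ^+ n.

Lemma sqsum1_gt0 s t w : 0 < 1 + phi * sqsum L s t w.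
Proof. by rewrite ltr_pwDl// mulr_ge0// sqsum_ge0. Qed.

Lemma dprod_ge0 h N w : 0 <= dprod h N w.
Proof. by apply: prodr_ge0 => k _; rewrite exprn_ge0// ltW// sqsum1_gt0. Qed.

Lemma grid_ge0 h N k : 0 <= h -> 0 <= grid 0 h N k.
Proof. by move=> h0; rewrite -{1}(grid0 0 h N) grid_le. Qed.

Lemma measurable_dprod h N : 0 <= h -> measurable_fun setT (dprod h N).
Proof.
move=> h0; apply: measurable_prod => k _; apply: measurable_funX.
apply: measurable_funD => //; apply: measurable_funM => //.
by apply: measurable_sqsum => //; exact: grid_ge0.
Qed.

Lemma integral_dprod h N : 0 <= h ->
  (\int[P0]_w (dprod h N w)%:E =
   ((1 + h * (g + h / N.+1%:R * b) / N.+1%:R) ^+ N.+1)%:E)%E.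
Proof.
move=> h0; have t0 : 0 <= grid 0 h N.+1 0 by exact: grid_ge0.
have tm : {homo grid 0 h N.+1 : m k / (m <= k)%N >-> m <= k} by move=> i j; exact: grid_le.
have jZ (k : nat) : jfunct (fun f x y => (1 + phi * fine (jsum sqj f x y)) ^+ n).
  by apply: jfunct_exp; apply: jfunct_affine => //; exact: jfunct_S.
have dt k : grid 0 h N.+1 k.+1 - grid 0 h N.+1 k = h / N.+1%:R.
  by rewrite gridS subr0 addrC addKr.
have hN : 0 <= h / N.+1%:R by rewrite divr_ge0.
rewrite (integral_jfunct_prod levyL levyL margL finL finL (t := grid 0 h N.+1) (K := N.+1) t0 tm jZ).
  under eq_bigr do rewrite dt Hn//.
  rewrite prodEFin prodr_const_nat subn0; congr (EFin (_ ^+ _)).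
  by congr (1 + _); rewrite -mulrA [X in _ = h * X]mulrC mulrA.
by move=> k _; rewrite dt Hn// ltry.
Qed.

Lemma dprod_le_cvg h w : 0 <= h -> finite_jumps (L ^~ w) ->
  (forall N, dprod h N w <= gam L phi h w ^+ n) /\
  dprod h N w @[N --> \oo] --> gam L phi h w ^+ n.
Proof.
move=> h0 fw.
have E N : dprod h N w = expR (\sum_(k < N.+1) ln (1 + phi *
    fine (jsum sqj (L ^~ w) (grid 0 h N.+1 k) (grid 0 h N.+1 k.+1)))) ^+ n.
  rewrite /dprod big_mkord prodrXl expR_sum; congr (_ ^+ _); apply: eq_bigr => k _.
  by rewrite lnK// posrE; exact: sqsum1_gt0.
have [H1 H2] := lnprod_cvg phi0 h0 (fw h); split.
  by move=> N; rewrite E lerXn2r// ?nnegrE ?expR_ge0// ler_expR.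
rewrite (_ : (fun N => _) = fun N => expR (\sum_(k < N.+1) ln (1 + phi *
    fine (jsum sqj (L ^~ w) (grid 0 h N.+1 k) (grid 0 h N.+1 k.+1)))) ^+ n); last exact/funext.
apply: (@continuous_cvg _ _ _ _ _ _ (fun x : R => expR x ^+ n)) H2.
by apply: (@continuous_comp _ _ _ expR (fun x : R => x ^+ n)); [exact: continuous_expR|exact: exprn_continuous].
Qed.

(** The integral of [dprod] over N + 1 independent cells is a power (1 + O(1 / N))^(N + 1) tending
    to exp(h g); the coefficient [b] is of second order in the cell length and disappears. Since
    [dprod] stays below its pointwise limit, domination gives one inequality and Fatou the other. *)
Lemma integral_gam h : 0 <= h ->
  (\int[P0]_w (gam L phi h w ^+ n)%:E = (expR (h * g))%:E)%E.
Proof.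
move=> h0.
have mg : measurable_fun setT (fun w => gam L phi h w ^+ n).
  by apply: measurable_funX; exact: measurable_gam.
have lim : (\int[P0]_w (dprod h N w)%:E @[N --> \oo] --> (expR (h * g))%:E)%E.
  under eq_cvg do rewrite integral_dprod//.
  apply: cvg_EFin; first exact: nearW.
  apply: cvg_1Dx_pow => [N|]; first by rewrite mulr_ge0// addr_ge0// mulr_ge0// divr_ge0.
  rewrite -[X in _ --> h * X](addr0 g); apply: cvgM; first exact: cvg_cst.
  apply: cvgD; first exact: cvg_cst.
  rewrite -(mul0r b); apply: cvgM; last exact: cvg_cst.
  by rewrite -(mulr0 h); apply: cvgM; [exact: cvg_cst|exact: cvg_harmonic].
apply/eqP; rewrite eq_le; apply/andP; split; last first.
  apply: (cvge_to_le lim); apply: nearW => N.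
  apply: ae_ge0_le_integral => //.
  - by move=> w _; rewrite lee_fin dprod_ge0.
  - by apply/measurable_EFinP; exact: measurable_dprod.
  - by move=> w _; rewrite lee_fin exprn_ge0// expR_ge0.
  - exact/measurable_EFinP.
  - apply: filterS finL => w fw _; rewrite lee_fin.
    by have [] := dprod_le_cvg h0 fw.
have -> : (\int[P0]_w (gam L phi h w ^+ n)%:E =
    \int[P0]_w limn_einf (fun N => (dprod h N w)%:E))%E.
  apply: ae_integral; apply: filterS finL => w fw _; apply/esym.
  have [_ c] := dprod_le_cvg h0 fw.
  have c' : (dprod h N w)%:E @[N --> \oo] --> (gam L phi h w ^+ n)%:E.
    by apply: cvg_EFin => //; exact: nearW.
  by have [-> _] := cvg_limn_einf_sup c'.
have [<- _] := cvg_limn_einf_sup lim.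
apply: (fatou P0 measurableT (f := fun N w => (dprod h N w)%:E)).
- by move=> N; apply/measurable_EFinP; exact: measurable_dprod.
- by move=> N w _; rewrite lee_fin dprod_ge0.
Qed.

End GammaMoment.

(** * The process exp(-X) on paths with summable squared jumps *)

Section Exponential.
Context {R : realType}.
Implicit Types (f : R -> R) (eta x s t : R).

Definition Yp eta x f t : R := expR (- cogarch_X eta x f t).

Lemma Yp_gt0 eta x f t : 0 < Yp eta x f t. Proof. exact: expR_gt0. Qed.

Lemma cogarch_X_jsum eta x f t : cadlag f -> finite_jumps f -> 0 <= x ->
  cogarch_X eta x f t = eta * t - fine (jsum (lnj x) f 0 t).
Proof.
move=> cf ff x0; rewrite cogarch_XE//; case: eqP => [->|_]; last by rewrite /lnsum ff.
congr (_ - _); rewrite /jsum esum1// => y _.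
by rewrite /lnj mul0r addr0 ln1.
Qed.

Lemma Yp0 eta x f : cadlag f -> finite_jumps f -> 0 <= x -> Yp eta x f 0 = 1.
Proof. by move=> *; rewrite /Yp cogarch_X_jsum// jsum_nil mulr0 subr0 oppr0 expR0. Qed.

Lemma Yp_ratio eta x f s t : cadlag f -> finite_jumps f -> 0 <= x -> 0 <= s -> s <= t ->
  Yp eta x f t / Yp eta x f s =
  expR (- (eta * (t - s))) * expR (fine (jsum (lnj x) f s t)).
Proof.
move=> cf ff x0 s0 st; rewrite /Yp -expRN -!expRD; congr expR.
rewrite !cogarch_X_jsum// (@jsumD _ _ _ 0 s)//; last by move=> y; exact: lnj_ge0.
rewrite fineD; first by ring.
- by apply: jsum_lnj_fin => //; exact: ff.
- by apply: jsum_lnj_fin => //; exact: finite_jumps_lty.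
Qed.

Lemma YpV_le eta x f t : cadlag f -> finite_jumps f -> 0 <= x -> (Yp eta x f t)^-1 <= expR (eta * t).
Proof.
move=> cf ff x0; rewrite /Yp -expRN opprK ler_expR cogarch_X_jsum// lerBlDr lerDl.
by apply: fine_jsum_ge0 => y; exact: lnj_ge0.
Qed.

End Exponential.

(** * Moments of ratios of exp(-X) *)

Section KeyMoments.
Context {R : realType}.
Context {d} {T : measurableType d} (P : probability T R) (M : R -> {RV P >-> R}).
Context {d0} {T0 : measurableType d0} (P0 : probability T0 R) (L : R -> {RV P0 >-> R}).
Hypothesis levyM : levy_process M.
Hypothesis levyL : levy_process L.
Hypothesis margM : forall h, 0 <= h -> forall A : set R, measurable A ->
  P [set w | A (M h w)] = P0 [set w | A (L h w)].
Hypothesis finM : {ae P, forall w, finite_jumps (M ^~ w)}.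
Hypothesis finL : {ae P0, forall w, finite_jumps (L ^~ w)}.
Variables (eta x : R) (kappa : nat) (G : nat -> R).
Hypothesis x0 : 0 <= x.
Hypothesis HG : forall e, (e <= kappa)%N -> forall h, 0 <= h ->
  (\int[P0]_w (gam L x h w ^+ e)%:E = (expR (h * G e))%:E)%E.

(** The logarithm of the mean of exp(-e X_1): [G e] comes from the jumps, the rest from the
    drift. *)
Definition rate (e : nat) : R := G e - e%:R * eta.

(** Each ratio is a deterministic factor times the exponential of a logarithmic jump sum over its
    own interval, a [jfunct]; [integral_jfunct_prod] factors the product. *)
Lemma moment_Y K (t : nat -> R) (e : nat -> nat) :
  0 <= t 0%N -> {homo t : m n / (m <= n)%N >-> m <= n} -> (forall k, (k < K)%N -> (e k <= kappa)%N) ->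
  (\int[P]_w (\prod_(0 <= k < K)
     (Yp eta x (M ^~ w) (t k.+1) / Yp eta x (M ^~ w) (t k)) ^+ e k)%:E =
   (expR (\sum_(0 <= k < K) rate (e k) * (t k.+1 - t k)))%:E)%E.
Proof.
move=> t0 tm ek.
have tk k : 0 <= t k by rewrite (le_trans t0)// tm.
have dt k : 0 <= t k.+1 - t k by rewrite subr_ge0 tm.
pose c k := expR (- (eta * (t k.+1 - t k))) ^+ e k.
have c0 k : 0 <= c k by rewrite exprn_ge0// expR_ge0.
pose Z k f a b := 0 + c k * expR (fine (jsum (lnj x) f a b)) ^+ e k.
have jZ k : jfunct (Z k) by apply: jfunct_affine => //; apply: jfunct_exp; exact: jfunct_G.
have IZ k : (k < K)%N -> (\int[P0]_w (Z k (L ^~ w) 0 (t k.+1 - t k))%:E =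
    (expR (rate (e k) * (t k.+1 - t k)))%:E)%E.
  move=> kK; rewrite /Z; under eq_integral do rewrite add0r EFinM.
  rewrite ge0_integralZl_EFin//; last first.
    by apply/measurable_EFinP; apply: measurable_funX; exact: measurable_gam.
  have -> : (\int[P0]_w (expR (fine (jsum (lnj x) (L ^~ w) 0 (t k.+1 - t k))) ^+ e k)%:E =
     (expR ((t k.+1 - t k) * G (e k)))%:E)%E by exact: (HG (ek k kK) (dt k)).
  by rewrite -EFinM /c -expRM_natl -expRD /rate; congr (expR _)%:E; ring.
rewrite expR_sum -prodEFin.
transitivity (\int[P]_w (\prod_(0 <= k < K) Z k (M ^~ w) (t k) (t k.+1))%:E)%E.
  apply: ae_integral; apply: filterS finM => w fw _; congr EFin.
  have cM : cadlag (M ^~ w) by case: levyM.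
  apply: eq_bigr => k _.
  by rewrite Yp_ratio ?tm// exprMn /Z add0r.
rewrite (integral_jfunct_prod levyM levyL margM finM finL t0 tm jZ).
  by rewrite big_nat [RHS]big_nat; apply: eq_bigr => k /andP[_ kK]; exact: IZ.
by move=> k kK; rewrite IZ// ltry.
Qed.

End KeyMoments.

Lemma integral_one d (T : measurableType d) (R : realType) (P : probability T R) :
  (\int[P]_w 1%:E = 1)%E.
Proof. by have := expectation_cst P 1; rewrite unlock. Qed.

(** * Growth rates of the first two moments *)

Section GammaRates.
Context {R : realType}.
Context {d0} {T0 : measurableType d0} (P0 : probability T0 R) (L : R -> {RV P0 >-> R}).
Hypothesis levyL : levy_process L.
Hypothesis finL : {ae P0, forall w, finite_jumps (L ^~ w)}.
Variable x : R.
Hypothesis x0 : 0 <= x.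
Hypothesis mu_fin : (\int[P0]_w (sqsum L 0 1 w)%:E < +oo)%E.

(** Read off from the first order term in [h] of the mean of (1 + x S_h)^e; the last branch stands
    for [e = 2]. *)
Definition grate (e : nat) : R := match e with
  | 0%N => 0
  | 1%N => x * mean1 L 1
  | _ => 2 * x * mean1 L 1 + x ^+ 2 * var1 L
  end.

Lemma gam_rate1 e : (e <= 1)%N -> forall h, 0 <= h ->
  (\int[P0]_w (gam L x h w ^+ e)%:E = (expR (h * grate e))%:E)%E.
Proof.
case: e => [|[|]]// _ h h0.
  by under eq_integral do rewrite expr0; rewrite mulr0 expR0 integral_one.
apply: (@integral_gam _ _ _ _ _ levyL finL x 1 _ 0) => //.
  by rewrite mulr_ge0// mean1_ge0.
move=> {h0}h h0; under eq_integral do rewrite expr1 EFinD.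
rewrite ge0_integralD//; last 2 first.
- by move=> w _; rewrite lee_fin mulr_ge0// sqsum_ge0.
- by apply/measurable_EFinP; apply: measurable_funM => //; exact: measurable_sqsum.
under [X in (_ + X)%E]eq_integral do rewrite EFinM.
rewrite ge0_integralZl_EFin//; last 2 first.
- by move=> w _; rewrite lee_fin sqsum_ge0.
- by apply/measurable_EFinP; exact: measurable_sqsum.
rewrite integral_one.
rewrite -[X in (_ + _ * X)%E]fineK ?integral_sqsum_fin// -/(mean1 L h) mean1_linear//.
by rewrite -EFinM -EFinD; congr EFin; rewrite /=; ring.
Qed.

Hypothesis m2_fin : (\int[P0]_w (sqsum L 0 1 w ^+ 2)%:E < +oo)%E.

Lemma gam_rate2 e : (e <= 2)%N -> forall h, 0 <= h ->
  (\int[P0]_w (gam L x h w ^+ e)%:E = (expR (h * grate e))%:E)%E.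
Proof.
case: e => [|[|[|]]]// _ h h0; [exact: gam_rate1|exact: gam_rate1|].
have mu0 := mean1_ge0 L.
(* The mean of (1 + x S_h)^2 is 1 + h (2 x mu + x^2 sigma^2) + h^2 x^2 mu^2, which identifies the
   coefficient [b]. *)
apply: (@integral_gam _ _ _ _ _ levyL finL x 2 _ (x ^+ 2 * mean1 L 1 ^+ 2)) => //.
- by rewrite addr_ge0// mulr_ge0 ?exprn_ge0// ?mulr_ge0// var1_ge0.
- by rewrite mulr_ge0// exprn_ge0.
move=> {h0}h h0.
transitivity (\int[P0]_w ((1 + x * sqsum L 0 h w)%:E +
    (x * sqsum L 0 h w)%:E + (x ^+ 2 * sqsum L 0 h w ^+ 2)%:E))%E.
  by apply: eq_integral => w _; rewrite -!EFinD; congr EFin; rewrite /=; ring.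
have mS : measurable_fun setT (fun w => x * sqsum L 0 h w).
  by apply: measurable_funM => //; exact: measurable_sqsum.
have S0 w : 0 <= x * sqsum L 0 h w by rewrite mulr_ge0// sqsum_ge0.
have IS : (\int[P0]_w (x * sqsum L 0 h w)%:E = (x * (h * mean1 L 1))%:E)%E.
  under eq_integral do rewrite EFinM.
  rewrite ge0_integralZl_EFin//; last 2 first.
  - by move=> w _; rewrite lee_fin sqsum_ge0.
  - by apply/measurable_EFinP; exact: measurable_sqsum.
  by rewrite -[X in (_ * X)%E]fineK ?integral_sqsum_fin// -/(mean1 L h) mean1_linear.
have I1 : (\int[P0]_w (1 + x * sqsum L 0 h w)%:E = (1 + x * (h * mean1 L 1))%:E)%E.
  under eq_integral do rewrite EFinD.
  rewrite ge0_integralD//; last 2 first.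
  - by move=> w _; rewrite lee_fin.
  - by apply/measurable_EFinP.
  by rewrite IS integral_one.
rewrite ge0_integralD//; last 4 first.
- by move=> w _; rewrite -EFinD lee_fin addr_ge0// addr_ge0.
- by apply: emeasurable_funD; apply/measurable_EFinP => //; exact: measurable_funD.
- by move=> w _; rewrite lee_fin mulr_ge0 ?exprn_ge0// sqsum_ge0.
- by apply/measurable_EFinP; apply: measurable_funM => //; exact: measurable_sqsumX.
rewrite ge0_integralD//; last 4 first.
- by move=> w _; rewrite lee_fin addr_ge0.
- by apply/measurable_EFinP; exact: measurable_funD.
- by move=> w _; rewrite lee_fin.
- by apply/measurable_EFinP.
rewrite IS I1; under [X in (_ + X)%E]eq_integral do rewrite EFinM.
rewrite ge0_integralZl_EFin ?exprn_ge0//; last 2 first.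
- by move=> w _; rewrite lee_fin exprn_ge0// sqsum_ge0.
- by apply/measurable_EFinP; exact: measurable_sqsumX.
rewrite -[X in (_ + _ * X)%E]fineK ?integral_sqsum2_fin// -/(mean2 L h) var_linear//.
by rewrite -EFinM -!EFinD; congr EFin; rewrite /=; ring.
Qed.

End GammaRates.

(** * Tonelli on rectangles *)

Section Tonelli.
Context {R : realType} {d1 d2 : measure_display}.
Context {T1 : measurableType d1} {T2 : measurableType d2}.
Context (m1 : {sigma_finite_measure set T1 -> \bar R}) (m2 : {sigma_finite_measure set T2 -> \bar R}).
Local Open Scope ereal_scope.

Lemma integral_mulind d (T : measurableType d) (mu : {measure set T -> \bar R}) (D : set T) (f : T -> R) :
  \int[mu]_(y in D) (f y)%:E = \int[mu]_y (f y * \1_D y)%:E.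
Proof.
rewrite integral_mkcond; apply: eq_integral => y _.
by rewrite patchE indicE; case: ifP => _; rewrite ?mulr1 ?mulr0.
Qed.

Section Extended.
Variables (F : T1 -> T2 -> \bar R).
Hypotheses (F0 : forall x y, 0 <= F x y).
Hypothesis mF : measurable_fun setT (fun z : T1 * T2 => F z.1 z.2).

Let mFD (C : set T1) (D : set T2) : measurable C -> measurable D ->
  measurable_fun setT (fun z : T1 * T2 => F z.1 z.2 * (\1_C z.1 * \1_D z.2 : R)%:E).
Proof.
move=> mC mD; apply: emeasurable_funM => //; apply/measurable_EFinP; apply: measurable_funM.
- by apply: (measurableT_comp (measurable_indic mC)); exact: measurable_fst.
- by apply: (measurableT_comp (measurable_indic mD)); exact: measurable_snd.
Qed.

Let FD0 (C : set T1) (D : set T2) z : 0 <= F z.1 z.2 * (\1_C z.1 * \1_D z.2 : R)%:E.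
Proof. by rewrite mule_ge0// lee_fin mulr_ge0. Qed.

Lemma etonelli (C : set T1) (D : set T2) : measurable C -> measurable D ->
  \int[m1]_(x in C) \int[m2]_(y in D) F x y = \int[m2]_(y in D) \int[m1]_(x in C) F x y.
Proof.
move=> mC mD; have H := @fubini_tonelli _ _ _ _ _ m1 m2 _ (mFD mC mD) (@FD0 C D).
transitivity (\int[m1]_x \int[m2]_y (F x y * (\1_C x * \1_D y : R)%:E)); last first.
  rewrite H [RHS]integral_mkcond; apply: eq_integral => y _; rewrite patchE/=.
  case: ifPn => yD; last first.
    by rewrite integral0_eq// => x _; rewrite [X in (_ * X)%R]indicE (negbTE yD) mulr0 mule0.
  rewrite [RHS]integral_mkcond; apply: eq_integral => x _.
  by rewrite patchE !indicE yD mulr1; case: ifP; rewrite ?mule1 ?mule0.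
rewrite [LHS]integral_mkcond; apply: eq_integral => x _; rewrite patchE.
case: ifPn => xC; last first.
  by rewrite integral0_eq// => y _; rewrite [X in (X * _)%R]indicE (negbTE xC) mul0r mule0.
rewrite [LHS]integral_mkcond; apply: eq_integral => y _.
by rewrite patchE !indicE xC mul1r; case: ifP; rewrite ?mule1 ?mule0.
Qed.

Lemma emeasurable_partial_integral (D : set T2) : measurable D ->
  measurable_fun setT (fun x => \int[m2]_(y in D) F x y).
Proof.
move=> mD; have H := @measurable_fun_fubini_tonelli_F _ _ _ _ _ m2 _ (mFD measurableT mD) (@FD0 setT D).
apply: eq_measurable_fun H => x _.
rewrite [RHS]integral_mkcond; apply: eq_integral => y _.
by rewrite patchE !indicE in_setT mul1r/=; case: ifP; rewrite ?mule1 ?mule0.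
Qed.

End Extended.

Variables (F : T1 -> T2 -> R).
Hypotheses (F0 : forall x y, (0 <= F x y)%R).
Hypothesis mF : measurable_fun setT (fun z : T1 * T2 => F z.1 z.2).

Lemma tonelli (C : set T1) (D : set T2) : measurable C -> measurable D ->
  \int[m1]_(x in C) \int[m2]_(y in D) (F x y)%:E = \int[m2]_(y in D) \int[m1]_(x in C) (F x y)%:E.
Proof.
apply: (@etonelli (fun x y => (F x y)%:E)) => [x y|]; first by rewrite lee_fin.
exact/measurable_EFinP.
Qed.

Lemma measurable_partial_integral (D : set T2) : measurable D ->
  measurable_fun setT (fun x => \int[m2]_(y in D) (F x y)%:E).
Proof.
apply: (@emeasurable_partial_integral (fun x y => (F x y)%:E)) => [x y|]; first by rewrite lee_fin.
exact/measurable_EFinP.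
Qed.

End Tonelli.

(** * Squares of integrals and integrals of exponentials *)

Section Lebesgue.
Context {R : realType}.
Local Notation mu := (@lebesgue_measure R).
Local Open Scope ereal_scope.
Implicit Types (a b c s t : R).

(** The square of the integral is a double integral; by symmetry the half planes r <= s and s <= r
    contribute equally. *)
Lemma square_integral (D : set R) (f : R -> R) : measurable D -> measurable_fun setT f ->
  (forall x, 0 <= f x)%R ->
  (\int[mu]_(s in D) (f s)%:E) * (\int[mu]_(s in D) (f s)%:E) =
  2%:E * \int[mu]_(s in D) \int[mu]_(r in D) (f s * f r * (r <= s)%R%:R)%:E.
Proof.
move=> mD mf f0; set I := \int[mu]_(s in D) (f s)%:E.
have mle : measurable_fun setT (fun z : R * R => ((z.2 <= z.1)%R%:R : R)).
  rewrite [X in measurable_fun _ X](_ : _ = \1_[set z : R * R | (z.2 <= z.1)%R]); last first.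
    by apply/funext => z; rewrite indicE; congr (_%:R); rewrite mem_setE.
  apply: measurable_indic.
  have := @measurable_fun_ler _ _ _ setT _ _ (@measurable_snd _ _ R R) (@measurable_fst _ _ R R)
    measurableT [set true] Logic.I.
  by rewrite setTI; congr measurable; apply/seteqP; split => z /=.
pose K s r : R := (f s * f r * (r <= s)%R%:R)%R.
have mff : measurable_fun setT (fun z : R * R => (f z.1 * f z.2)%R).
  by apply: measurable_funM; apply: measurableT_comp => //.
have mK : measurable_fun setT (fun z : R * R => K z.1 z.2).
  exact: measurable_funM.
have K0 s r : (0 <= K s r)%R by rewrite !mulr_ge0.
have mK' : measurable_fun setT (fun z : R * R => K z.2 z.1).
  exact: (measurableT_comp mK (@measurable_swap _ _ R R)).
have AB : \int[mu]_(s in D) \int[mu]_(r in D) (K s r)%:E = \int[mu]_(s in D) \int[mu]_(r in D) (K r s)%:E.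
  exact: (@tonelli _ _ _ _ _ mu mu K).
rewrite mule_natl mule2n [X in _ = _ + X]AB -ge0_integralD//; last 4 first.
- by move=> s _; apply: integral_ge0 => r _; rewrite lee_fin; exact: K0.
- by apply: measurable_funTS; exact: (@measurable_partial_integral _ _ _ _ _ mu K K0 mK).
- by move=> s _; apply: integral_ge0 => r _; rewrite lee_fin; exact: K0.
- by apply: measurable_funTS; exact: (@measurable_partial_integral _ _ _ _ _ mu (fun s r => K r s)).
have -> : I * I = \int[mu]_(s in D) ((f s)%:E * I).
  rewrite ge0_integralZr//.
  - by apply: measurable_funTS; exact/measurable_EFinP.
  - by move=> s _; rewrite lee_fin.
  - by apply: integral_ge0 => s _; rewrite lee_fin.
apply: eq_integral => s _.
have mKs (k : R -> R) : measurable_fun setT k -> measurable_fun D (EFin \o k).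
  by move=> mk; apply: measurable_funTS; exact/measurable_EFinP.
rewrite -ge0_integralD//; last 4 first.
- by move=> r _; rewrite lee_fin ?K0 ?f0 ?expR_ge0.
- by apply: mKs; exact: (measurableT_comp mK (measurable_pair1 s)).
- by move=> r _; rewrite lee_fin ?K0 ?f0 ?expR_ge0.
- by apply: mKs; exact: (measurableT_comp mK' (measurable_pair1 s)).
rewrite -ge0_integralZl_EFin//; last 2 first.
- by move=> r _; rewrite lee_fin ?K0 ?f0 ?expR_ge0.
- exact: mKs.
(* The two half planes overlap only where r = s, a null set for fixed [s]. *)
apply: ae_integral; exists [set s]; split => //; first exact: lebesgue_measure_set1.
move=> r /= /not_implyP[_ H]; apply: contrapT => rs; apply: H.
rewrite -EFinM -EFinD; congr EFin; rewrite /K.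
by case: (ltgtP r s) => rs' /=; rewrite ?mulr1 ?mulr0 ?addr0 ?add0r// 1?mulrC.
Qed.

Lemma integral_le_itv (f : R -> R) s t : (0 <= s <= t)%R ->
  \int[mu]_(r in `]0%R, t]) (f r * (r <= s)%R%:R)%:E = \int[mu]_(r in `]0%R, s]) (f r)%:E.
Proof.
move=> /andP[s0 st]; rewrite integral_mkcond [RHS]integral_mkcond; apply: eq_integral => r _.
rewrite !patchE; case: ifPn => H1; case: ifPn => H2 //; move: H1 H2; rewrite ?notin_setE ?inE/= !in_itv/=.
- by move=> _ /andP[_ ->]; rewrite mulr1.
- by move=> /andP[-> rt] /negP/negbTE/= ->; rewrite mulr0.
- by move=> H /andP[r0 rs]; case: H; rewrite r0 (le_trans rs st).
Qed.

Let is_derive_expc c l s : is_derive (s : R) 1%R (fun r : R => expR (c * r + l)) (c * expR (c * s + l))%R.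
Proof.
have H : is_derive s (1 : R)%R (fun r : R => c * r + l)%R c.
  by apply: is_derive_eq; rewrite /GRing.scale/=; ring.
rewrite mulrC.
exact: (@is_derive1_comp R expR (fun r : R => c * r + l)%R s _ _ (is_derive_expR _) H).
Qed.

Let cont_expc c l : continuous (fun r : R => expR (c * r + l)).
Proof.
move=> r; apply: differentiable_continuous; apply/derivable1_diffP.
by have [] := is_derive_expc c l r.
Qed.

Let is_derive_prim c l s : c != 0%R ->
  is_derive (s : R) 1%R (fun r : R => c^-1 * expR (c * r + l))%R (expR (c * s + l))%R.
Proof.
move=> c0; have H := is_derive_expc c l s.
have := @is_deriveZ _ _ _ (fun r : R => expR (c * r + l)) c^-1 s 1%R _ H.
by rewrite /GRing.scale/= mulrA mulVf// mul1r.
Qed.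

Let cont_prim c l : continuous (fun r : R => c^-1 * expR (c * r + l))%R.
Proof. by move=> r; apply: cvgM; [exact: cvg_cst|exact: cont_expc]. Qed.

Lemma integral_exp_itv c l a b : c != 0%R -> (a <= b)%R ->
  \int[mu]_(r in `]a, b]) (expR (c * r + l))%:E = ((expR (c * b + l) - expR (c * a + l)) / c)%:E.
Proof.
move=> c0; rewrite le_eqVlt => /predU1P[<-|ab].
  by rewrite set_itv_ge ?integral_set0 ?subrr ?mul0r// bnd_simp ltxx.
have me : measurable_fun setT (fun r : R => expR (c * r + l)).
  by apply: continuous_measurable_fun; exact: cont_expc.
rewrite integral_itv_obnd_cbnd; last by apply: measurable_funTS; exact/measurable_EFinP.
rewrite (@continuous_FTC2 _ _ (fun r : R => c^-1 * expR (c * r + l))%R)//.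
- by rewrite -EFinB; congr EFin; rewrite -mulrBr mulrC.
- by apply: continuous_subspaceT; exact: cont_expc.
- split.
  + by move=> r _; have [] := is_derive_prim l r c0.
  + by apply/cvg_at_right_filter; exact: cont_prim.
  + by apply/cvg_at_left_filter; exact: cont_prim.
- by move=> r _; rewrite derive1E; have [_ ->] := is_derive_prim l r c0.
Qed.

Lemma integral_exp_itvy c l a : (c < 0)%R ->
  \int[mu]_(r in `[a, +oo[) (expR (c * r + l))%:E = (- expR (c * a + l) / c)%:E.
Proof.
move=> c0; have cn : c != 0%R by rewrite lt_eqF.
rewrite (@ge0_continuous_FTC2y _ _ (fun r : R => c^-1 * expR (c * r + l))%R _ 0%R)//.
- by rewrite -EFinB sub0r mulNr mulrC.
- by apply: continuous_subspaceT; exact: cont_expc.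
- rewrite -(mulr0 (c^-1)%R); apply: cvgM; first exact: cvg_cst.
  have -> : (fun r : R => expR (c * r + l)) = (fun r => expR l * expR (- ((- c) * r)))%R.
    by apply/funext => r; rewrite -expRD; congr expR; ring.
  rewrite -(mulr0 (expR l)); apply: cvgM; first exact: cvg_cst.
  apply: (@cvg_comp _ _ _ (fun r => (- c) * r)%R (fun z => expR (- z)) _ (pinfty_nbhs R)); last exact: cvgr_expR.
  have nc : (0 < - c)%R by rewrite oppr_gt0.
  exact: (gt0_cvgMry nc (@cvg_id _ _)).
- by apply/cvg_at_right_filter; exact: cont_prim.
- by move=> r _; rewrite derive1E; have [_ ->] := is_derive_prim l r cn.
Qed.

Lemma integral_exp_itvy_pinfty c l : (0 <= c)%R ->
  \int[mu]_(r in `]0%R, +oo[) (expR (c * r + l))%:E = +oo.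
Proof.
move=> c0; apply/eqP; rewrite -leye_eq.
have <- : \int[mu]_(r in `]0%R, +oo[) (expR l)%:E = +oo.
  rewrite integral_cst//= lebesgue_measure_itv/= ltry.
  by rewrite gt0_muley// lte_fin expR_gt0.
apply: ge0_le_integral => //.
- apply: measurable_funTS; apply/measurable_EFinP.
  by apply: continuous_measurable_fun; exact: cont_expc.
- move=> r /=; rewrite in_itv/= andbT => r0.
  by rewrite lee_fin ler_expR lerDr mulr_ge0// ltW.
Qed.

End Lebesgue.

(** * The volatility equation for an abstract positive process *)

Section Volatility.
Context {R : realType} {T : Type}.
Variables (beta : R) (Y : T -> R -> R) (v0 : T -> R).
Local Notation mu := (@lebesgue_measure R).

(** Here [Y] plays the role of exp(-X), so that [Vol] is V and [locally_finite] excludes the default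
    value of the real integral. *)
Definition Jint w t : R := \int[mu]_(s in `]0, t]) (Y w s)^-1.
Definition Vol w t : R := Y w t * (v0 w + beta * Jint w t).
Definition locally_finite w :=
  forall t, 0 <= t -> (\int[mu]_(s in `]0%R, t]) ((Y w s)^-1)%:E < +oo)%E.

End Volatility.

Section VolatilityMoments.
Context {R : realType} {d : measure_display} {T : measurableType d} (P : probability T R).
Local Notation mu := (@lebesgue_measure R).
Variables (beta : R) (Y : T -> R -> R) (v0 : T -> R).
Hypothesis beta0 : 0 < beta.
Hypothesis mY : measurable_fun setT (fun z : T * R => Y z.1 z.2).
Hypothesis Y0 : forall w s, 0 < Y w s.
Hypothesis mv0 : measurable_fun setT v0.
Hypothesis v00 : forall w, 0 <= v0 w.

Local Notation Jint := (Jint Y).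
Local Notation Vol := (Vol beta Y v0).
Local Notation locally_finite := (locally_finite Y).

Let mYV : measurable_fun setT (fun z : T * R => (Y z.1 z.2)^-1).
Proof.
rewrite [X in measurable_fun _ X](_ : _ = fun z : T * R => expR (- ln (Y z.1 z.2))); last first.
  by apply/funext => z; rewrite expRN lnK// posrE.
apply: (measurableT_comp (@measurable_expR R)); apply: measurableT_comp => //.
exact: (measurableT_comp (@measurable_ln R)).
Qed.

Let YV0 w s : 0 <= (Y w s)^-1. Proof. by rewrite invr_ge0 ltW. Qed.

Lemma Jint_ge0 w t : 0 <= Jint w t.
Proof. by apply: fine_ge0; apply: integral_ge0 => s _; rewrite lee_fin. Qed.

Lemma Vol_ge0 w t : 0 <= Vol w t.
Proof.
apply: mulr_ge0; first exact: ltW.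
by apply: addr_ge0 => //; apply: mulr_ge0; [exact: ltW|exact: Jint_ge0].
Qed.

Lemma measurable_Jint2 : measurable_fun setT (fun z : T * R => Jint z.1 z.2).
Proof.
pose F (z : T * R) (r : R) : R := (Y z.1 r)^-1 * ((0 < r) && (r <= z.2))%R%:R.
have m1 : measurable_fun setT (fun u : (T * R) * R => u.1.1).
  exact: (measurableT_comp (@measurable_fst _ _ T R) (@measurable_fst _ _ _ R)).
have m2 : measurable_fun setT (fun u : (T * R) * R => u.1.2).
  exact: (measurableT_comp (@measurable_snd _ _ T R) (@measurable_fst _ _ _ R)).
have m3 : measurable_fun setT (fun u : (T * R) * R => u.2) by exact: measurable_snd.
have mF : measurable_fun setT (fun u : (T * R) * R => F u.1 u.2).
  apply: measurable_funM.
    exact: (measurableT_comp mYV (measurable_fun_pair m1 m3)).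
  apply: (measurableT_comp (f := fun b : bool => b%:R : R)) => //.
  by apply: measurable_and; [exact: measurable_fun_ltr|exact: measurable_fun_ler].
have F0 z r : 0 <= F z r by rewrite mulr_ge0.
have := @measurable_partial_integral _ _ _ _ _ mu F F0 mF setT measurableT.
move=> H; rewrite [X in measurable_fun _ X](_ : _ = fine \o (fun z => \int[mu]_y (F z y)%:E)%E).
  exact: measurableT_comp.
apply/funext => z /=; rewrite /Jint /Rintegral integral_mulind; congr fine.
apply: eq_integral => r _; rewrite /F indicE mem_setE in_itv/=.
by [].
Qed.

Lemma measurable_Vol2 : measurable_fun setT (fun z : T * R => Vol z.1 z.2).
Proof.
apply: measurable_funM => //; apply: measurable_funD.
  exact: (measurableT_comp mv0 (@measurable_fst _ _ T R)).
by apply: measurable_funM => //; exact: measurable_Jint2.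
Qed.

Let mpair s : measurable_fun setT (fun w : T => (w, s : R)).
Proof. exact: measurable_fun_pair. Qed.

Lemma measurable_Y s : measurable_fun setT (Y ^~ s).
Proof. exact: (measurableT_comp mY (mpair s)). Qed.

Lemma measurable_Jint s : measurable_fun setT (Jint ^~ s).
Proof. exact: (measurableT_comp measurable_Jint2 (mpair s)). Qed.

Lemma measurable_Vol s : measurable_fun setT (Vol ^~ s).
Proof. exact: (measurableT_comp measurable_Vol2 (mpair s)). Qed.

Lemma measurable_YV s : measurable_fun setT (fun w => (Y w s)^-1).
Proof. exact: (measurableT_comp mYV (mpair s)). Qed.

Let mYw w : measurable_fun setT (fun s => (Y w s)^-1).
Proof. exact: (measurableT_comp mYV (measurable_pair1 w)). Qed.

Let mYE w (D : set R) : measurable_fun D (fun s => ((Y w s)^-1)%:E).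
Proof. by apply: measurable_funTS; apply/measurable_EFinP; exact: mYw. Qed.


Lemma JintE w t : locally_finite w -> 0 <= t ->
  ((Jint w t)%:E = \int[mu]_(s in `]0%R, t]) ((Y w s)^-1)%:E)%E.
Proof.
move=> lw t0; rewrite /Jint /Rintegral fineK// ge0_fin_numE ?lw//.
by apply: integral_ge0 => s _; rewrite lee_fin.
Qed.

Lemma JintZ w s t (k : R) : locally_finite w -> 0 <= s -> s <= t -> 0 <= k ->
  ((k * (Jint w t - Jint w s))%:E = \int[mu]_(r in `]s, t]) (k * (Y w r)^-1)%:E)%E.
Proof.
move=> lw s0 st k0; have t0 := le_trans s0 st.
under eq_integral do rewrite EFinM.
rewrite ge0_integralZl_EFin//; last 2 first.
- by move=> r _; rewrite lee_fin.
- exact: mYE.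
rewrite EFinM EFinB !JintE//.
have -> : `]0, t]%classic = `]0, s]%classic `|` `]s, t]%classic.
  rewrite -itv_bndbnd_setU ?bnd_simp//.
rewrite ge0_integral_setU//=; last 3 first.
- exact: mYE.
- by move=> r _; rewrite lee_fin.
- apply/disj_set2P; apply/seteqP; split => r //= -[]; rewrite !in_itv/=.
  by move=> /andP[_ rs] /andP[sr _]; move: (lt_le_trans sr rs); rewrite ltxx.
rewrite addeAC subee ?add0e//.
rewrite ge0_fin_numE ?lw//.
by apply: integral_ge0 => r _; rewrite lee_fin.
Qed.

Lemma Jint0 w : Jint w 0 = 0.
Proof. by rewrite /Jint set_itvoc0 Rintegral_set0. Qed.

Lemma Vol_add w s t : locally_finite w -> 0 <= s -> s <= t ->
  ((Vol w t)%:E = (Y w t / Y w s * Vol w s)%:E +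
    \int[mu]_(r in `]s, t]) (beta * Y w t * (Y w r)^-1)%:E)%E.
Proof.
move=> lw s0 st; rewrite -JintZ//; last by rewrite mulr_ge0 ?ltW.
rewrite -EFinD /Vol; congr EFin.
have : Y w s != 0 by rewrite gt_eqF.
by move=> y0; field.
Qed.

(** The integrated form of d (V / Y)^2 = 2 beta (V / Y) Y^-1 ds; without differentiation it is
    [square_integral] applied to 1 / Y. *)
Lemma Vol_square w s : locally_finite w -> 0 <= s ->
  ((Vol w s ^+ 2)%:E = (v0 w ^+ 2 * Y w s ^+ 2)%:E +
    \int[mu]_(q in `]0%R, s]) (2 * beta * (Vol w q * (Y w s / Y w q) ^+ 2))%:E)%E.
Proof.
move=> lw s0; set I := (X in _ = (_ + X)%E).
have S := @square_integral R `]0, s]%classic (fun r => (Y w r)^-1) (measurable_itv _) (mYw w) (YV0 w).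
have J0 q : 0 <= Jint w q := Jint_ge0 w q.
have mJ : measurable_fun setT (fun q => Jint w q).
  exact: (measurableT_comp measurable_Jint2 (measurable_pair1 w)).
have mJY : measurable_fun setT (fun q => (Y w q)^-1 * Jint w q).
  by apply: measurable_funM => //; exact: mYw.
have {}S : ((Jint w s ^+ 2)%:E = \int[mu]_(q in `]0%R, s]) (2 * ((Y w q)^-1 * Jint w q))%:E)%E.
  rewrite expr2 EFinM !JintE// S.
  under [RHS]eq_integral do rewrite EFinM.
  rewrite ge0_integralZl_EFin//; last 2 first.
  - by move=> q _; rewrite lee_fin mulr_ge0.
  - by apply: measurable_funTS; apply/measurable_EFinP; exact: mJY.
  congr (_ * _)%E; apply: eq_integral => q; rewrite inE/= in_itv/= => /andP[q0 qs].
  rewrite EFinM JintE ?ltW//.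
  rewrite -(@integral_le_itv _ (fun r => (Y w r)^-1) q s) ?(ltW q0)//.
  rewrite -ge0_integralZl_EFin//.
  - by apply: eq_integral => r _; rewrite -EFinM mulrA.
  - by move=> r _; rewrite lee_fin mulr_ge0.
  - apply: measurable_funTS; apply/measurable_EFinP; apply: measurable_funM; first exact: mYw.
    apply: (measurableT_comp (f := fun b : bool => b%:R : R)) => //.
    exact: measurable_fun_ler.
have -> : I = (2 * beta * Y w s ^+ 2 * v0 w * Jint w s + beta ^+ 2 * Y w s ^+ 2 * Jint w s ^+ 2)%:E.
  have b0 : 0 <= beta by exact: ltW.
  have y2 q : 0 <= Y w q ^+ 2 by exact: sqr_ge0.
  have k1 : 0 <= 2 * beta * Y w s ^+ 2 * v0 w.
    by apply: mulr_ge0 => //; apply: mulr_ge0 => //; exact: mulr_ge0.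
  have k0 : 0 <= beta ^+ 2 * Y w s ^+ 2 by rewrite mulr_ge0// sqr_ge0.
  rewrite EFinD [X in (_ + X)%E]EFinM S.
  rewrite -ge0_integralZl_EFin//; last 2 first.
  - by move=> q _; rewrite lee_fin !mulr_ge0.
  - by apply: measurable_funTS; apply/measurable_EFinP; apply: measurable_funM => //; exact: mJY.
  have -> : Jint w s = Jint w s - Jint w 0.
    by rewrite Jint0 subr0.
  rewrite JintZ//.
  rewrite -ge0_integralD//.
  - rewrite /I; apply: eq_integral => q _; rewrite -EFinM -EFinD; congr EFin.
    rewrite /Vol exprMn exprVn.
    have y0 : Y w q != 0 by rewrite gt_eqF.
    by field.
  - by move=> q _; rewrite lee_fin mulr_ge0.
  - by apply: measurable_funTS; apply/measurable_EFinP; apply: measurable_funM => //; exact: mYw.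
  - by move=> q _; rewrite -EFinM lee_fin mulr_ge0// mulr_ge0// mulr_ge0.
  - apply: measurable_funTS; apply: measurable_funeM; apply/measurable_EFinP.
    by apply: measurable_funM => //; exact: mJY.
by rewrite -EFinD /Vol; congr EFin; ring.
Qed.

End VolatilityMoments.

(** * Time-independent moments from the moments of the start *)

Section StationaryMoments.
Context {R : realType} {d : measure_display} {T : measurableType d} (P : probability T R).
Local Notation mu := (@lebesgue_measure R).
Variables (beta : R) (Y : T -> R -> R) (v0 : T -> R).
Hypothesis beta0 : 0 < beta.
Hypothesis mY : measurable_fun setT (fun z : T * R => Y z.1 z.2).
Hypothesis Y0 : forall w s, 0 < Y w s.
Hypothesis mv0 : measurable_fun setT v0.
Hypothesis v00 : forall w, 0 <= v0 w.
Hypothesis lf : {ae P, forall w, locally_finite Y w}.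
Variables (kappa : nat) (C nu : nat -> R).
Hypothesis kappa1 : (1 <= kappa)%N.
Hypothesis moments : forall j a0 a1 e1 e2 q s t1 t2 t3,
  (j <= kappa)%N -> (a0 <= kappa)%N -> (a1 <= kappa)%N -> (e1 <= kappa)%N -> (e2 <= kappa)%N ->
  0 <= q -> q <= s -> s <= t1 -> t1 <= t2 -> t2 <= t3 ->
  (\int[P]_w (v0 w ^+ j * (Y w q ^+ a0 * (Y w s / Y w q) ^+ a1 *
     ((Y w t2 / Y w t1) ^+ e1 * (Y w t3 / Y w t2) ^+ e2)))%:E =
   (nu j * expR (C a0 * q + C a1 * (s - q) + C e1 * (t2 - t1) + C e2 * (t3 - t2)))%:E)%E.
Hypothesis nu0 : nu 0%N = 1.
Hypothesis C0 : C 0%N = 0.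
Local Notation c := (C 1).
Hypothesis c0 : c < 0.
Local Notation m := (nu 1).
Hypothesis mE : m = - beta / c.
Local Notation V := (Vol beta Y v0).

Let mYs s : measurable_fun setT (Y ^~ s) := measurable_Y mY s.
Let mYVs s : measurable_fun setT (fun w => (Y w s)^-1) := measurable_YV mY Y0 s.
Let V0 w s : 0 <= V w s := Vol_ge0 beta0 Y0 v00 w s.
Let mV s : measurable_fun setT (V ^~ s) := measurable_Vol beta mY Y0 mv0 s.
Let YV0 w s : 0 <= (Y w s)^-1. Proof. by rewrite invr_ge0 ltW. Qed.
Let Yd0 w s t : 0 <= Y w s / Y w t. Proof. by rewrite divr_ge0 ?ltW. Qed.
Let mYd s t : measurable_fun setT (fun w => Y w s / Y w t).
Proof. exact: measurable_funM. Qed.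
Let mfst1 (f : T -> R) : measurable_fun setT f -> measurable_fun setT (fun z : T * R => f z.1).
Proof. by move=> mf; exact: (measurableT_comp mf (@measurable_fst _ _ T R)). Qed.
Let Yne w s : Y w s != 0. Proof. by rewrite gt_eqF. Qed.

Lemma integral_exp_back (a b l k g : R) : 0 <= k -> a <= b -> g != 0 ->
  (\int[mu]_(r in `]a, b]) (k * expR (g * (b - r) + l))%:E =
   (k * expR l * (expR (g * (b - a)) - 1) / g)%:E)%E.
Proof.
move=> k0 ab g0.
have E r : g * (b - r) + l = - g * r + (g * b + l) by ring.
under eq_integral do rewrite E EFinM.
rewrite ge0_integralZl_EFin//; last first.
  apply: measurable_funTS; apply/measurable_EFinP; apply: (measurableT_comp (@measurable_expR R)).
  by apply: measurable_funD => //; exact: measurable_funM.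
rewrite integral_exp_itv ?oppr_eq0// -EFinM; congr EFin.
have -> : - g * b + (g * b + l) = l by ring.
have -> : - g * a + (g * b + l) = g * (b - a) + l by ring.
by rewrite expRD; field.
Qed.

(** The volatility equation and Tonelli give m exp(c s) + beta (exp(c s) - 1) / c times the mean of
    the later ratios; [mE] reduces the first factor to m. *)
Lemma E_VF e1 e2 s t1 t2 t3 : (e1 <= kappa)%N -> (e2 <= kappa)%N ->
  0 <= s -> s <= t1 -> t1 <= t2 -> t2 <= t3 ->
  (\int[P]_w (V w s * ((Y w t2 / Y w t1) ^+ e1 * (Y w t3 / Y w t2) ^+ e2))%:E =
   (m * expR (C e1 * (t2 - t1) + C e2 * (t3 - t2)))%:E)%E.
Proof.
move=> k1 k2 s0 st1 t12 t23.
set E := C e1 * _ + _.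
pose F w := (Y w t2 / Y w t1) ^+ e1 * (Y w t3 / Y w t2) ^+ e2.
have F0 w : 0 <= F w by rewrite mulr_ge0// exprn_ge0.
have mF : measurable_fun setT F by apply: measurable_funM; exact: measurable_funX.
have b0 : 0 <= beta by exact: ltW.
have Ys0 w q : 0 <= Y w q by exact: ltW.
pose K w q := beta * Y w s * F w * (Y w q)^-1.
have K0 w q : 0 <= K w q by rewrite mulr_ge0// mulr_ge0// mulr_ge0.
have mK : measurable_fun setT (fun z : T * R => K z.1 z.2).
  apply: measurable_funM; last first.
    rewrite [X in measurable_fun _ X](_ : _ = fun z : T * R => expR (- ln (Y z.1 z.2))); last first.
      by apply/funext => z; rewrite expRN lnK// posrE.
    apply: (measurableT_comp (@measurable_expR R)); apply: measurableT_comp => //.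
    exact: (measurableT_comp (@measurable_ln R)).
  apply: (@mfst1 (fun w => beta * Y w s * F w)).
  by apply: measurable_funM => //; exact: measurable_funM.
transitivity (\int[P]_w ((v0 w * (Y w s * F w))%:E + \int[mu]_(q in `]0%R, s]) (K w q)%:E)%E)%E.
  apply: ae_integral; apply: filterS lf => w lw _.
  rewrite -(JintZ mY Y0 lw (lexx 0) s0); last by rewrite mulr_ge0// mulr_ge0.
  by rewrite (Jint0 Y) subr0 -EFinD /Vol -/(F w); congr EFin; ring.
rewrite ge0_integralD//; last 4 first.
- by move=> w _; rewrite lee_fin mulr_ge0// mulr_ge0.
- by apply/measurable_EFinP; apply: measurable_funM => //; exact: measurable_funM.
- by move=> w _; apply: integral_ge0 => q _; rewrite lee_fin.
- exact: (@measurable_partial_integral _ _ _ _ _ mu K K0 mK).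
have -> : (\int[P]_w (v0 w * (Y w s * F w))%:E = (m * expR (c * s + E))%:E)%E.
  have := @moments 1 1 0 e1 e2 s s t1 t2 t3 kappa1 kappa1 (leq0n _) k1 k2 s0 (lexx _) st1 t12 t23.
  rewrite subrr mulr0 addr0 -addrA => <-.
  by apply: eq_integral => w _; rewrite !expr1 expr0 mulr1.
rewrite (@tonelli _ _ _ _ _ P mu K K0 mK setT)//.
have -> : (\int[mu]_(q in `]0%R, s]) \int[P]_w (K w q)%:E =
   \int[mu]_(q in `]0%R, s]) (beta * expR (c * (s - q) + E))%:E)%E.
  apply: eq_integral => q; rewrite inE/= in_itv/= => /andP[q0 qs].
  have := @moments 0 0 1 e1 e2 q s t1 t2 t3 (leq0n _) (leq0n _) kappa1 k1 k2 (ltW q0) qs st1 t12 t23.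
  rewrite C0 mul0r add0r nu0 mul1r -addrA => H.
  rewrite EFinM -H -ge0_integralZl_EFin//.
  - apply: eq_integral => w _; rewrite -EFinM; congr EFin.
    by rewrite !expr0 expr1 !mul1r /K /F; ring.
  - by move=> w _; rewrite lee_fin !expr0 expr1 !mul1r mulr_ge0//; exact: F0.
  - by apply/measurable_EFinP; apply: measurable_funM => //; apply: measurable_funM => //;
      apply: measurable_funM; exact: measurable_funX.
rewrite integral_exp_back//; last by rewrite lt_eqF.
rewrite -EFinD; congr EFin; rewrite subr0 expRD mE.
by have cn : c != 0; [rewrite lt_eqF|field].
Qed.

Lemma E_V s : 0 <= s -> (\int[P]_w (V w s)%:E = m%:E)%E.
Proof.
move=> s0; have := @E_VF 0 0 s s s s (leq0n _) (leq0n _) s0 (lexx _) (lexx _) (lexx _).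
rewrite subrr !mulr0 addr0 expR0 mulr1 => <-.
by apply: eq_integral => w _; rewrite !expr0 !mulr1.
Qed.

Section Second.
Hypothesis kappa2 : (2 <= kappa)%N.
Local Notation dd := (C 2).
Local Notation m2 := (nu 2).
Hypothesis d0 : dd < 0.
Hypothesis m2E : m2 = - (2 * beta * m) / dd.

(** By [Vol_square] and [E_VF], the mean is exp(c (t - s)) times m2 exp(d s) + 2 beta m (exp(d s) -
    1) / d with d = [C 2]; [m2E] cancels the dependence on [s]. *)
Lemma E_V2 s t : 0 <= s -> s <= t ->
  (\int[P]_w (V w s ^+ 2 * (Y w t / Y w s))%:E = (m2 * expR (c * (t - s)))%:E)%E.
Proof.
move=> s0 st; have b0 : 0 <= beta by exact: ltW.
have m0 : 0 <= m by rewrite mE mulNr oppr_ge0 pmulr_rle0// invr_le0 ltW.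
pose W w := Y w t / Y w s.
have W0 w : 0 <= W w by exact: Yd0.
have mW : measurable_fun setT W by exact: mYd.
pose K w q := 2 * beta * (V w q * (Y w s / Y w q) ^+ 2) * W w.
have K1 w q : 0 <= 2 * beta * (V w q * (Y w s / Y w q) ^+ 2).
  by apply: mulr_ge0; [exact: mulr_ge0|apply: mulr_ge0 => //; exact: exprn_ge0].
have K0 w q : 0 <= K w q by apply: mulr_ge0.
have mYd2 : measurable_fun setT (fun z : T * R => Y z.1 s / Y z.1 z.2).
  apply: measurable_funM; first exact: (mfst1 (mYs s)).
  rewrite [X in measurable_fun _ X](_ : _ = fun z : T * R => expR (- ln (Y z.1 z.2))); last first.
    by apply/funext => z; rewrite expRN lnK// posrE.
  apply: (measurableT_comp (@measurable_expR R)); apply: measurableT_comp => //.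
  exact: (measurableT_comp (@measurable_ln R)).
have mK : measurable_fun setT (fun z : T * R => K z.1 z.2).
  apply: measurable_funM; last exact: (mfst1 mW).
  apply: measurable_funM => //; apply: measurable_funM; last exact: measurable_funX.
  exact: measurable_Vol2.
transitivity (\int[P]_w ((v0 w ^+ 2 * (Y w s ^+ 2 * W w))%:E + \int[mu]_(q in `]0%R, s]) (K w q)%:E)%E)%E.
  apply: ae_integral; apply: filterS lf => w lw _.
  rewrite EFinM (Vol_square beta0 mY Y0 v00 lw s0) ge0_muleDl; last 2 first.
  - by rewrite lee_fin mulr_ge0// exprn_ge0// ltW.
  - by apply: integral_ge0 => q _; rewrite lee_fin; exact: K1.
  rewrite -EFinM mulrA; congr (_ + _)%E.
  rewrite -ge0_integralZr//.
  - apply: measurable_funTS; apply/measurable_EFinP; apply: measurable_funM => //; apply: measurable_funM.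
      exact: (measurableT_comp (measurable_Vol2 beta mY Y0 mv0) (measurable_pair1 w)).
    by apply: measurable_funX; exact: (measurableT_comp mYd2 (measurable_pair1 w)).
  - by move=> q _; rewrite lee_fin; exact: K1.
  - by rewrite lee_fin.
rewrite ge0_integralD//; last 4 first.
- by move=> w _; rewrite lee_fin mulr_ge0 ?exprn_ge0// mulr_ge0 ?exprn_ge0// ltW.
- apply/measurable_EFinP; apply: measurable_funM; first exact: measurable_funX.
  by apply: measurable_funM => //; exact: measurable_funX.
- by move=> w _; apply: integral_ge0 => q _; rewrite lee_fin.
- exact: (@measurable_partial_integral _ _ _ _ _ mu K K0 mK).
have -> : (\int[P]_w (v0 w ^+ 2 * (Y w s ^+ 2 * W w))%:E = (m2 * expR (dd * s + c * (t - s)))%:E)%E.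
  have := @moments 2 2 0 1 0 s s s t t kappa2 kappa2 (leq0n _) kappa1 (leq0n _) s0 (lexx _) (lexx _) st (lexx _).
  rewrite !subrr !mulr0 !addr0 => <-.
  by apply: eq_integral => w _; rewrite !expr1 !expr0 !mulr1.
rewrite (@tonelli _ _ _ _ _ P mu K K0 mK setT)//.
have -> : (\int[mu]_(q in `]0%R, s]) \int[P]_w (K w q)%:E =
   \int[mu]_(q in `]0%R, s]) (2 * beta * m * expR (dd * (s - q) + c * (t - s)))%:E)%E.
  apply: eq_integral => q; rewrite inE/= in_itv/= => /andP[q0 qs].
  have H := @E_VF 2 1 q q s t kappa2 kappa1 (ltW q0) (lexx _) qs st.
  rewrite -mulrA EFinM -H -ge0_integralZl_EFin ?mulr_ge0//.
  - by apply: eq_integral => w _; rewrite -EFinM; congr EFin; rewrite expr1 /K /W; ring.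
  - by move=> w _; rewrite lee_fin mulr_ge0// mulr_ge0// exprn_ge0.
  - apply/measurable_EFinP; apply: measurable_funM => //.
    by apply: measurable_funM; exact: measurable_funX.
rewrite integral_exp_back ?lt_eqF// ?mulr_ge0//.
rewrite -EFinD; congr EFin; rewrite subr0 expRD m2E.
by have dn : dd != 0; [rewrite lt_eqF|field].
Qed.

(** Restart the volatility equation at [s]: V_t is (Y_t / Y_s) V_s plus beta times the integral of
    Y_t / Y_r over []s, t]]. Multiplied by V_s, the two parts are handled by [E_V2] and [E_VF]. *)
Lemma E_VV s t : 0 <= s -> s <= t ->
  (\int[P]_w (V w s * V w t)%:E =
   (m2 * expR (c * (t - s)) + m ^+ 2 * (1 - expR (c * (t - s))))%:E)%E.
Proof.
move=> s0 st; have b0 : 0 <= beta by exact: ltW.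
have m0 : 0 <= m by rewrite mE mulNr oppr_ge0 pmulr_rle0// invr_le0 ltW.
pose K w r := beta * V w s * Y w t * (Y w r)^-1.
have Ys0 w q : 0 <= Y w q by exact: ltW.
have bV0 w : 0 <= beta * V w s by exact: mulr_ge0.
have K0 w r : 0 <= K w r by apply: mulr_ge0 => //; exact: mulr_ge0.
have mK : measurable_fun setT (fun z : T * R => K z.1 z.2).
  apply: measurable_funM; last first.
    rewrite [X in measurable_fun _ X](_ : _ = fun z : T * R => expR (- ln (Y z.1 z.2))); last first.
      by apply/funext => z; rewrite expRN lnK// posrE.
    apply: (measurableT_comp (@measurable_expR R)); apply: measurableT_comp => //.
    exact: (measurableT_comp (@measurable_ln R)).
  apply: (@mfst1 (fun w => beta * V w s * Y w t)).
  by apply: measurable_funM => //; exact: measurable_funM.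
transitivity (\int[P]_w ((V w s ^+ 2 * (Y w t / Y w s))%:E + \int[mu]_(r in `]s, t]) (K w r)%:E)%E)%E.
  apply: ae_integral; apply: filterS lf => w lw _.
  rewrite -(JintZ mY Y0 lw s0 st); last exact: mulr_ge0.
  rewrite -EFinD /Vol; congr EFin.
  have yn := Yne w s; by field.
rewrite ge0_integralD//; last 4 first.
- by move=> w _; rewrite lee_fin mulr_ge0// exprn_ge0.
- by apply/measurable_EFinP; apply: measurable_funM => //; exact: measurable_funX.
- by move=> w _; apply: integral_ge0 => r _; rewrite lee_fin.
- exact: (@measurable_partial_integral _ _ _ _ _ mu K K0 mK).
rewrite E_V2// (@tonelli _ _ _ _ _ P mu K K0 mK setT)//.
have -> : (\int[mu]_(r in `]s, t]) \int[P]_w (K w r)%:E =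
   \int[mu]_(r in `]s, t]) (beta * m * expR (c * (t - r) + 0))%:E)%E.
  apply: eq_integral => r; rewrite inE/= in_itv/= => /andP[sr rt].
  have := @E_VF 1 0 s r t t kappa1 (leq0n _) s0 (ltW sr) rt (lexx _).
  rewrite subrr !mulr0 => H.
  rewrite -mulrA EFinM -H -ge0_integralZl_EFin//.
  - by apply: eq_integral => w _; rewrite -EFinM; congr EFin; rewrite expr1 expr0 /K; ring.
  - by move=> w _; rewrite lee_fin mulr_ge0// mulr_ge0// exprn_ge0.
  - apply/measurable_EFinP; apply: measurable_funM => //.
    by apply: measurable_funM; exact: measurable_funX.
rewrite integral_exp_back ?lt_eqF// ?mulr_ge0//.
rewrite -EFinD; congr EFin; rewrite expR0 expr2 {2}mE.
by have cn : c != 0; [rewrite lt_eqF|field].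
Qed.

End Second.
End StationaryMoments.

(** * Measurability with respect to the driving process *)

Section SigmaProcess.
Context {R : realType} {d : measure_display} {T : measurableType d}.
Implicit Types (M : R -> T -> R).

(** The same sample space with the sigma-algebra generated by [M] alone. The measurability lemmas
    above, instantiated at this type, show that functionals of [M] belong to [sigma_process M]. *)
Definition process_type M : measurableType _ :=
  g_sigma_algebraType (\bigcup_(t in `[0, +oo[) g_sigma_algebra_preimage (M t)).

Lemma measurable_process M t : 0 <= t ->
  measurable_fun (setT : set (process_type M)) (M t).
Proof.
move=> t0 _ B mB; apply: sub_sigma_algebra; exists t => /=; first by rewrite in_itv/= andbT.
by exists B.
Qed.

Lemma sigma_process_preimage M (f : T -> R) :
  measurable_fun (setT : set (process_type M)) f ->
  forall B : set R, measurable B -> sigma_process M (f @^-1` B).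
Proof.
by move=> mf B mB; have := mf measurableT B mB; rewrite setTI.
Qed.

Lemma Yp_0 eta x (f : R -> R) : Yp eta x f 0 = 1.
Proof. by rewrite /Yp /cogarch_X set_itvoc0 esum_set0 mulr0 subr0 oppr0 expR0. Qed.

Lemma measurable_Yp2 M eta x : (forall t, 0 <= t -> measurable_fun setT (M t)) ->
  (forall w, cadlag (M ^~ w)) -> 0 <= x ->
  measurable_fun setT (fun z : T * R => Yp eta x (M ^~ z.1) z.2).
Proof.
move=> mM cM x0; apply: (measurableT_comp (@measurable_expR R)); apply: measurableT_comp => //.
exact: measurable_cogarch_X2.
Qed.

Lemma cogarch_VE (beta eta x v : R) (f : R -> R) t :
  cogarch_V beta eta x v f t =
  Yp eta x f t * (v + beta * \int[lebesgue_measure]_(s in `]0, t]) (Yp eta x f s)^-1).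
Proof.
rewrite /cogarch_V; congr (_ * (_ + _ * _)).
by apply: eq_Rintegral => s _; rewrite /Yp -expRN opprK.
Qed.

End SigmaProcess.

(** * Joint moments of the starting variable and of exp(-X) *)

Section CogarchMoments.
Context {R : realType}.
Context {d} {T : measurableType d} (P : probability T R) (M : R -> {RV P >-> R}) (v0 : {RV P >-> R}).
Context {d0} {T0 : measurableType d0} (P0 : probability T0 R) (L : R -> {RV P0 >-> R}).
Hypothesis levyM : levy_process M.
Hypothesis levyL : levy_process L.
Hypothesis margM : forall h, 0 <= h -> forall A : set R, measurable A ->
  P [set w | A (M h w)] = P0 [set w | A (L h w)].
Hypothesis finM : {ae P, forall w, finite_jumps (M ^~ w)}.
Hypothesis finL : {ae P0, forall w, finite_jumps (L ^~ w)}.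
Hypothesis v00 : forall w, 0 <= v0 w.
Hypothesis indepMv : forall E F, sigma_process M E -> g_sigma_algebra_preimage v0 F ->
  P (E `&` F) = (P E * P F)%E.
Variables (eta x : R).
Hypotheses (eta0 : 0 <= eta) (x0 : 0 <= x).

Definition YM (w : T) (s : R) : R := Yp eta x (M ^~ w) s.

Let cM w : cadlag (M ^~ w). Proof. by case: levyM. Qed.

Lemma measurable_YM2 : measurable_fun setT (fun z : T * R => YM z.1 z.2).
Proof.
by apply: (@measurable_Yp2 _ _ _ (fun t => M t : T -> R)) => // t _; exact: measurable_funPT.
Qed.

Lemma sigma_YM s : measurable_fun (setT : set (process_type (fun t => M t : T -> R))) (YM ^~ s).
Proof.
have := @measurable_Yp2 _ _ (process_type (fun t => M t : T -> R)) (fun t => M t : T -> R) eta x.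
move=> /(_ (@measurable_process _ _ _ _) cM x0) H.
exact: (measurableT_comp H (measurable_fun_pair (@measurable_id _ _ _) (measurable_cst s))).
Qed.

Lemma YM_gt0 w s : 0 < YM w s. Proof. exact: expR_gt0. Qed.

(** Jumps only lower X, so exp(X_s) is at most exp(eta s). *)
Lemma locally_finite_YM : {ae P, forall w, locally_finite YM w}.
Proof.
apply: filterS finM => w fw t t0.
have mY : measurable_fun setT (fun s => (YM w s)^-1).
  rewrite [X in measurable_fun _ X](_ : _ = fun s => expR (- ln (YM w s))); last first.
    by apply/funext => s; rewrite expRN lnK// posrE YM_gt0.
  apply: (measurableT_comp (@measurable_expR R)); apply: measurableT_comp => //.
  apply: (measurableT_comp (@measurable_ln R)).
  exact: (measurableT_comp measurable_YM2 (measurable_pair1 w)).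
apply: (@le_lt_trans _ _ (\int[lebesgue_measure]_(s in `]0%R, t]) (expR (eta * t))%:E)%E).
  apply: ge0_le_integral => //.
  - by move=> s _; rewrite lee_fin invr_ge0 ltW// YM_gt0.
  - by apply: measurable_funTS; exact/measurable_EFinP.
  - move=> s /=; rewrite in_itv/= => /andP[_ st]; rewrite lee_fin.
    by apply: (le_trans (YpV_le eta s (cM w) fw x0)); rewrite ler_expR ler_wpM2l.
rewrite integral_cst//= lebesgue_measure_itv/=; case: ifPn => _; last by rewrite mule0 ltry.
by rewrite -EFinB -EFinM ltry.
Qed.

Lemma sigma_v0 n (B : set R) : measurable B -> g_sigma_algebra_preimage v0 ((fun w => v0 w ^+ n) @^-1` B).
Proof.
move=> mB; exists ((fun y : R => y ^+ n) @^-1` B); last by rewrite setTI.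
have mX : measurable_fun setT (fun y : R => y ^+ n) by apply: measurable_funX.
by have := mX measurableT B mB; rewrite setTI.
Qed.

Lemma integral_indep2 (G : T -> R) n :
  measurable_fun (setT : set (process_type (fun t => M t : T -> R))) G ->
  measurable_fun setT G -> (forall w, 0 <= G w) ->
  (\int[P]_w (G w)%:E < +oo)%E -> (\int[P]_w (v0 w ^+ n)%:E < +oo)%E ->
  (\int[P]_w (v0 w ^+ n * G w)%:E = \int[P]_w (v0 w ^+ n)%:E * \int[P]_w (G w)%:E)%E.
Proof.
move=> sG mG G0 Goo voo.
pose f (b : bool) := if b then G else (fun w => v0 w ^+ n).
have := @integral_prod_indep _ _ _ P bool [:: false; true] f isT.
rewrite !big_cons !big_nil/= mule1 => <-.
- by apply: eq_integral => w _; rewrite !big_cons big_nil/= mulr1.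
- by case => //=; apply: measurable_funX; exact: measurable_funPT.
- by case=> w //=; rewrite exprn_ge0.
- by case.
move=> B mB; rewrite !big_cons big_nil mule1 muleC.
have -> : \bigcap_(j in [set` [:: false; true]]) f j @^-1` B j =
    (f true @^-1` B true) `&` (f false @^-1` B false).
  by apply/seteqP; split => [w H|w [H1 H2] []//]; split; apply: H; rewrite /= !inE.
by apply: indepMv; [exact: sigma_process_preimage|exact: sigma_v0].
Qed.

Section Moments.
Variables (kappa : nat) (G : nat -> R).
Hypothesis HG : forall e, (e <= kappa)%N -> forall h, 0 <= h ->
  (\int[P0]_w (gam L x h w ^+ e)%:E = (expR (h * G e))%:E)%E.
Hypothesis v0fin : forall j, (j <= kappa)%N -> (\int[P]_w (v0 w ^+ j)%:E < +oo)%E.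

Lemma cogarch_moments j a0 a1 e1 e2 q s t1 t2 t3 :
  (j <= kappa)%N -> (a0 <= kappa)%N -> (a1 <= kappa)%N -> (e1 <= kappa)%N -> (e2 <= kappa)%N ->
  0 <= q -> q <= s -> s <= t1 -> t1 <= t2 -> t2 <= t3 ->
  (\int[P]_w (v0 w ^+ j * (YM w q ^+ a0 * (YM w s / YM w q) ^+ a1 *
     ((YM w t2 / YM w t1) ^+ e1 * (YM w t3 / YM w t2) ^+ e2)))%:E =
   (fine (\int[P]_w (v0 w ^+ j)%:E)%E * expR (rate eta G a0 * q + rate eta G a1 * (s - q) +
      rate eta G e1 * (t2 - t1) + rate eta G e2 * (t3 - t2)))%:E)%E.
Proof.
move=> jk a0k a1k e1k e2k q0 qs st1 t12 t23.
pose H w := YM w q ^+ a0 * (YM w s / YM w q) ^+ a1 *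
     ((YM w t2 / YM w t1) ^+ e1 * (YM w t3 / YM w t2) ^+ e2).
have H0 w : 0 <= H w.
  by rewrite !mulr_ge0// exprn_ge0// ?divr_ge0 ?ltW ?YM_gt0.
have mdiv d' (T' : measurableType d') (f g : T' -> R) : measurable_fun setT f -> measurable_fun setT g ->
    (forall w, 0 < g w) -> measurable_fun setT (fun w => f w / g w).
  move=> mf mg g0; apply: measurable_funM => //.
  rewrite [X in measurable_fun _ X](_ : _ = fun s => expR (- ln (g s))); last first.
    by apply/funext => w; rewrite expRN lnK// posrE.
  apply: (measurableT_comp (@measurable_expR R)); apply: measurableT_comp => //.
  exact: (measurableT_comp (@measurable_ln R)).
have mHg d' (T' : measurableType d') (y : T' -> R -> R) : (forall s, measurable_fun setT (y ^~ s)) ->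
    (forall w s, 0 < y w s) -> measurable_fun setT (fun w => y w q ^+ a0 * (y w s / y w q) ^+ a1 *
     ((y w t2 / y w t1) ^+ e1 * (y w t3 / y w t2) ^+ e2)).
  by move=> my y0; apply: measurable_funM; apply: measurable_funM; apply: measurable_funX => //;
    apply: mdiv.
have mYs r : measurable_fun setT (YM ^~ r).
  exact: (measurableT_comp measurable_YM2 (measurable_fun_pair (@measurable_id _ _ _) (measurable_cst r))).
have mH : measurable_fun setT H by apply: mHg => // w r; exact: YM_gt0.
have sH : measurable_fun (setT : set (process_type (fun t => M t : T -> R))) H.
  by apply: (mHg _ (process_type (fun t => M t : T -> R)) YM) => [r|w r]; [exact: sigma_YM|exact: YM_gt0].
(* The sequence of times is constant after [t3]; the exponent on the gap from [s] to [t1] is 0. *)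
pose t (n : nat) := nth t3 [:: 0; q; s; t1; t2; t3] n.
pose e (n : nat) := nth 0%N [:: a0; a1; 0%N; e1; e2] n.
have tS n : t n <= t n.+1.
  by case: n => [|[|[|[|[|[|n]]]]]] //=; rewrite /t /= nth_nil.
have tm : {homo t : m n / (m <= n)%N >-> m <= n} by apply: homo_leq => //; exact: le_trans.
have ek k : (k < 5)%N -> (e k <= kappa)%N.
  by case: k => [|[|[|[|[|k]]]]].
have := moment_Y levyM levyL margM finM finL eta x0 HG (K := 5) (lexx 0 : 0 <= t 0%N) tm ek.
have -> : (\int[P]_w (\prod_(0 <= k < 5) (Yp eta x (M^~ w) (t k.+1) / Yp eta x (M^~ w) (t k)) ^+ e k)%:E =
    \int[P]_w (H w)%:E)%E.
  apply: eq_integral => w _; rewrite !big_nat_recl//= big_geq// expr0 mulr1 mul1r.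
  by rewrite Yp_0 divr1 /H /YM -!mulrA.
rewrite !big_nat_recl//= big_geq// /t /e /= => HH.
have Hoo : (\int[P]_w (H w)%:E < +oo)%E by rewrite HH ltry.
rewrite (integral_indep2 sH mH H0 Hoo (v0fin jk)) HH.
rewrite -[X in (X * _)%E]fineK; last first.
  by rewrite ge0_fin_numE ?v0fin//; apply: integral_ge0 => w _; rewrite lee_fin exprn_ge0.
rewrite -EFinM; congr (_ * expR _)%:E.
(* The zeroth moment of [gam] is 1, so [HG] at [e = 0] forces [G 0 = 0]. *)
have G0 : rate eta G 0 * (t1 - s) = 0.
  have := HG (leq0n _) ler01.
  under eq_integral do rewrite expr0.
  rewrite integral_one mul1r -expR0 => -[/esym/expR_inj G0].
  by rewrite /rate G0 mul0r subrr mul0r.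
by rewrite G0; ring.
Qed.

End Moments.
End CogarchMoments.

(** * Mean and second moment of the stationary law *)

Section VinfMoments.
Context {R : realType}.
Context {d0} {T0 : measurableType d0} (P0 : probability T0 R) (L : R -> {RV P0 >-> R}).
Local Notation mu := (@lebesgue_measure R).
Hypothesis levyL : levy_process L.
Hypothesis finL : {ae P0, forall w, finite_jumps (L ^~ w)}.
Variables (beta eta x : R).
Hypotheses (beta0 : 0 < beta) (x0 : 0 <= x).
Local Notation YL := (fun w s => Yp eta x (L ^~ w) s).
Local Open Scope ereal_scope.

Let cL w : cadlag (L ^~ w). Proof. by case: levyL. Qed.

Let margL : (forall h, 0 <= h -> forall A : set R, measurable A ->
  P0 [set w | A (L h w)] = P0 [set w | A (L h w)])%R.
Proof. by []. Qed.

Let mY2 : measurable_fun setT (fun z : T0 * R => YL z.1 z.2).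
Proof.
by apply: (@measurable_Yp2 _ _ _ (fun t => L t : T0 -> R)) => // t _; exact: measurable_funPT.
Qed.

Let Y0 w s : (0 <= YL w s)%R. Proof. exact: expR_ge0. Qed.

Lemma VinfE w : Vinf beta eta L x w = beta%:E * \int[mu]_(s in `]0%R, +oo[) (YL w s)%:E.
Proof. by []. Qed.

Lemma Vinf_ge0 w : 0 <= Vinf beta eta L x w.
Proof.
rewrite VinfE mule_ge0// ?lee_fin ?(ltW beta0)//.
by apply: integral_ge0 => s _; rewrite lee_fin.
Qed.

Lemma measurable_Vinf : measurable_fun setT (Vinf beta eta L x).
Proof.
rewrite [X in measurable_fun _ X](_ : _ = fun w => beta%:E * \int[mu]_(s in `]0%R, +oo[) (YL w s)%:E)//.
apply: measurable_funeM.
exact: (@measurable_partial_integral _ _ _ _ _ mu (fun w s => YL w s) Y0 mY2).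
Qed.

Section First.
Variables (kappa : nat) (G : nat -> R).
Hypothesis kappa1 : (1 <= kappa)%N.
Hypothesis HG : forall e, (e <= kappa)%N -> forall h, (0 <= h)%R ->
  \int[P0]_w (gam L x h w ^+ e)%:E = (expR (h * G e))%:E.
Local Notation c := (rate eta G 1).

(** Tonelli and [moment_Y]; the sign of [c] is left open, so that finiteness of the mean can be used
    to determine it. *)
Lemma integral_Vinf : \int[P0]_w Vinf beta eta L x w =
  beta%:E * \int[mu]_(s in `]0%R, +oo[) (expR (c * s + 0))%:E.
Proof.
have b0 : (0 <= beta)%R by exact: ltW.
under eq_integral do rewrite VinfE.
rewrite ge0_integralZl_EFin//; last 2 first.
- by move=> w _; apply: integral_ge0 => s _; rewrite lee_fin.
- exact: (@measurable_partial_integral _ _ _ _ _ mu (fun w s => YL w s) Y0 mY2).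
rewrite (@tonelli _ _ _ _ _ P0 mu (fun w s => YL w s) Y0 mY2 setT)//.
congr (_ * _); apply: eq_integral => s; rewrite inE/= in_itv/= andbT => s0.
pose t (n : nat) := (if n is 0%N then 0 else s)%R.
have tm : {homo t : m n / (m <= n)%N >-> (m <= n)%R} by move=> [|i] [|j] //= _; exact: ltW.
have := moment_Y levyL levyL margL finL finL eta x0 HG (K := 1%N) (e := fun=> 1%N) (lexx 0 : 0 <= t 0%N)%R tm (fun _ _ => kappa1).
rewrite !big_nat1/= subr0 addr0 => <-; apply: eq_integral => w _.
by rewrite big_nat1 expr1 /= Yp_0 divr1.
Qed.

Lemma integral_Vinf_fin : (c < 0)%R -> \int[P0]_w Vinf beta eta L x w = (- beta / c)%:E.
Proof.
move=> c0; rewrite integral_Vinf integral_itv_obnd_cbnd; last first.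
  apply: measurable_funTS; apply/measurable_EFinP; apply: (measurableT_comp (@measurable_expR R)).
  by apply: measurable_funD => //; exact: measurable_funM.
rewrite integral_exp_itvy// mulr0 addr0 expR0 -EFinM; congr EFin.
by rewrite !mulNr mulrN mul1r.
Qed.

Lemma integral_Vinf_lty : \int[P0]_w Vinf beta eta L x w < +oo -> (c < 0)%R.
Proof.
rewrite integral_Vinf; case: (ltrP c 0) => // c0.
by rewrite integral_exp_itvy_pinfty// gt0_muley ?ltxx// lte_fin.
Qed.

Section Second.
Hypothesis kappa2 : (2 <= kappa)%N.
Hypothesis c0 : (c < 0)%R.
Local Notation dd := (rate eta G 2).

(** By [square_integral] only times r <= s matter, where the mean of Y_r Y_s is exp(d r + c (s - r))
    with d = [rate eta G 2]. Integrating over s >= r produces the factor - 1 / c. *)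
Lemma integral_Vinf2 : \int[P0]_w (Vinf beta eta L x w * Vinf beta eta L x w) =
  (- (2 * beta ^+ 2) / c)%:E * \int[mu]_(r in `]0%R, +oo[) (expR (dd * r + 0))%:E.
Proof.
have b0 : (0 <= beta)%R by exact: ltW.
have mYw w : measurable_fun setT (fun s => YL w s).
  exact: (measurableT_comp mY2 (measurable_pair1 w)).
have mle : measurable_fun setT (fun z : R * R => ((z.2 <= z.1)%R%:R : R)).
  apply: (measurableT_comp (f := fun b : bool => b%:R : R)) => //.
  exact: measurable_fun_ler.
pose K (z : T0 * R) (r : R) : R := (YL z.1 z.2 * YL z.1 r * (r <= z.2)%R%:R)%R.
have K0 z r : (0 <= K z r)%R by rewrite !mulr_ge0.
have m1 : measurable_fun setT (fun u : (T0 * R) * R => u.1.1).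
  exact: (measurableT_comp (@measurable_fst _ _ T0 R) (@measurable_fst _ _ _ R)).
have m2 : measurable_fun setT (fun u : (T0 * R) * R => u.1.2).
  exact: (measurableT_comp (@measurable_snd _ _ T0 R) (@measurable_fst _ _ _ R)).
have m3 : measurable_fun setT (fun u : (T0 * R) * R => u.2) by exact: measurable_snd.
have mK : measurable_fun setT (fun u : (T0 * R) * R => K u.1 u.2).
  apply: measurable_funM; first apply: measurable_funM.
  - exact: (measurableT_comp mY2 (measurable_fun_pair m1 m2)).
  - exact: (measurableT_comp mY2 (measurable_fun_pair m1 m3)).
  - exact: (measurableT_comp mle (measurable_fun_pair m2 m3)).
have mI : measurable_fun setT (fun z : T0 * R => \int[mu]_(r in `]0%R, +oo[) (K z r)%:E).
  exact: (@measurable_partial_integral _ _ _ _ _ mu K K0 mK).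
transitivity (\int[P0]_w ((2 * beta ^+ 2)%:E *
    \int[mu]_(s in `]0%R, +oo[) \int[mu]_(r in `]0%R, +oo[) (K (w, s) r)%:E)).
  apply: eq_integral => w _; rewrite VinfE muleACA (square_integral (measurable_itv _) (mYw w) (Y0 w)).
  by rewrite muleA -!EFinM; congr (_%:E * _); rewrite expr2 mulrC.
have I0 w s : 0 <= \int[mu]_(r in `]0%R, +oo[) (K (w, s) r)%:E.
  by apply: integral_ge0 => r _; rewrite lee_fin.
rewrite ge0_integralZl_EFin//; last 3 first.
- by move=> w _; apply: integral_ge0 => s _.
- exact: (@emeasurable_partial_integral _ _ _ _ _ mu (fun w s => \int[mu]_(r in `]0%R, +oo[) (K (w, s) r)%:E) I0).
- by rewrite mulr_ge0// sqr_ge0.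
rewrite (@etonelli _ _ _ _ _ P0 mu (fun w s => \int[mu]_(r in `]0%R, +oo[) (K (w, s) r)%:E) I0)//.
pose k (s r : R) : R := (expR (dd * r + c * (s - r)) * (r <= s)%R%:R)%R.
have k0 s r : (0 <= k s r)%R by rewrite mulr_ge0// expR_ge0.
have mexp (f g : R * R -> R) : measurable_fun setT f -> measurable_fun setT g ->
    measurable_fun setT (fun z => expR (dd * f z + c * g z))%R.
  move=> mf mg; apply: (measurableT_comp (@measurable_expR R)).
  by apply: measurable_funD; apply: measurable_funM.
have mk : measurable_fun setT (fun z : R * R => k z.1 z.2).
  apply: measurable_funM => //; apply: mexp; first exact: measurable_snd.
  by apply: measurable_funB; [exact: measurable_fst|exact: measurable_snd].
have -> : \int[mu]_(s in `]0%R, +oo[) \int[P0]_w \int[mu]_(r in `]0%R, +oo[) (K (w, s) r)%:E =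
    \int[mu]_(s in `]0%R, +oo[) \int[mu]_(r in `]0%R, +oo[) (k s r)%:E.
  apply: eq_integral => s; rewrite inE/= in_itv/= andbT => s0.
  rewrite (@tonelli _ _ _ _ _ P0 mu (fun w r => K (w, s) r) (fun w r => K0 (w, s) r))//; last first.
    have p1 : measurable_fun setT (fun z : T0 * R => (z.1, s)).
      exact: (measurable_fun_pair (@measurable_fst _ _ T0 R) (measurable_cst s)).
    exact: (measurableT_comp mK (measurable_fun_pair p1 (@measurable_snd _ _ T0 R))).
  apply: eq_integral => r; rewrite inE/= in_itv/= andbT => r0; rewrite /K /k/=.
  case: (lerP r s) => rs; last by rewrite mulr0 integral0_eq// => w _; rewrite mulr0.
  (* Y_r Y_s = Y_r^2 (Y_s / Y_r): exponent 2 up to [r], exponent 1 from [r] to [s]. *)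
  pose t (n : nat) := (match n with 0%N => 0 | 1%N => r | _ => s end)%R.
  pose e (n : nat) := if n is 0%N then 2%N else 1%N.
  have tm : {homo t : m n / (m <= n)%N >-> (m <= n)%R}.
    by move=> [|[|i]] [|[|j]] //= _; apply: ltW.
  have ek j : (j < 2)%N -> (e j <= kappa)%N by case: j => [|[|j]] //=.
  have := moment_Y levyL levyL margL finL finL eta x0 HG (K := 2%N) (lexx 0 : 0 <= t 0%N)%R tm ek.
  rewrite !big_nat_recl//= !big_geq// addr0 subr0 mulr1 => <-; apply: eq_integral => w _.
  rewrite !big_nat_recl//= !big_geq// !mulr1 Yp_0 divr1 expr1; congr EFin.
  by have yn : YL w r != 0%R by [rewrite gt_eqF// expR_gt0]; field.
rewrite (@tonelli _ _ _ _ _ mu mu k k0 mk)//.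
have -> : \int[mu]_(r in `]0%R, +oo[) \int[mu]_(s in `]0%R, +oo[) (k s r)%:E =
    \int[mu]_(r in `]0%R, +oo[) ((- c^-1)%:E * (expR (dd * r + 0))%:E).
  apply: eq_integral => r; rewrite inE/= in_itv/= andbT => r0.
  transitivity (\int[mu]_(s in `[r, +oo[) (expR (c * s + (dd * r - c * r)))%:E).
    rewrite integral_mkcond [RHS]integral_mkcond; apply: eq_integral => s _.
    rewrite !patchE /k; case: ifPn => H1; case: ifPn => H2 //; move: H1 H2;
      rewrite ?notin_setE ?inE/= !in_itv/= ?andbT.
    - by move=> _ ->; rewrite mulr1; congr (expR _)%:E; ring.
    - by move=> _ /negP/negbTE ->; rewrite mulr0.
    - by move=> H rs; case: H; exact: lt_le_trans rs.
  rewrite integral_exp_itvy// -EFinM; congr EFin.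
  have -> : (c * r + (dd * r - c * r) = dd * r + 0)%R by ring.
  by rewrite mulrC mulrN mulNr.
have mexpd : measurable_fun setT (fun r : R => expR (dd * r + 0))%R.
  apply: (measurableT_comp (@measurable_expR R)).
  by apply: measurable_funD => //; exact: measurable_funM.
rewrite ge0_integralZl_EFin//; last 2 first.
- by apply: measurable_funTS; exact/measurable_EFinP.
- by rewrite oppr_ge0 invr_le0 ltW.
by rewrite muleA -EFinM; congr (_%:E * _); rewrite mulNr mulrN.
Qed.

Lemma integral_Vinf2_fin : (dd < 0)%R ->
  \int[P0]_w (Vinf beta eta L x w * Vinf beta eta L x w) = (2 * beta ^+ 2 / (c * dd))%:E.
Proof.
move=> d0'; rewrite integral_Vinf2 integral_itv_obnd_cbnd; last first.
  apply: measurable_funTS; apply/measurable_EFinP; apply: (measurableT_comp (@measurable_expR R)).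
  by apply: measurable_funD => //; exact: measurable_funM.
rewrite integral_exp_itvy// mulr0 addr0 expR0 -EFinM; congr EFin.
have cn : c != 0%R by rewrite lt_eqF.
have dn : dd != 0%R by rewrite lt_eqF.
by field; rewrite cn dn.
Qed.

Lemma integral_Vinf2_lty :
  \int[P0]_w (Vinf beta eta L x w * Vinf beta eta L x w) < +oo -> (dd < 0)%R.
Proof.
rewrite integral_Vinf2; case: (ltrP dd 0) => // d0'.
rewrite integral_exp_itvy_pinfty// gt0_muley ?ltxx// lte_fin.
by rewrite mulNr -mulrN mulr_gt0// ?mulr_gt0 ?exprn_gt0// oppr_gt0 invr_lt0.
Qed.

End Second.
End First.
End VinfMoments.

(** * Consequences of membership in [Phi_L_kappa] *)

Section KappaFacts.
Context {R : realType}.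
Context {d0} {T0 : measurableType d0} (P0 : probability T0 R) (L : R -> {RV P0 >-> R}).
Context (nuL : {measure set R -> \bar R}).
Hypothesis levyL : levy_process L.
Hypothesis nuLE : levy_measure L nuL.
Variables (beta eta : R).
Hypotheses (beta0 : 0 < beta) (eta0 : 0 < eta).
Local Notation mu := (@lebesgue_measure R).
Implicit Types (x phi y : R).

Let cL w : cadlag (L ^~ w). Proof. by case: levyL. Qed.

Let margL : (forall h, 0 <= h -> forall A : set R, measurable A ->
  P0 [set w | A (L h w)] = P0 [set w | A (L h w)]).
Proof. by []. Qed.

Lemma Phi_L_integral phi : 0 <= phi ->
  (\int[nuS nuL]_(y in `]0%R, +oo[) (ln (1 + phi * y)%R)%:E =
   \int[nuL]_(x in (fun x : R => x ^+ 2)%R @^-1` `]0%R, +oo[%classic) (lnj phi x)%:E)%E.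
Proof.
move=> p0.
have msq : measurable_fun setT (fun x : R => x ^+ 2) by exact: measurable_funX.
have mf : measurable_fun (`]0, +oo[%classic : set R) (fun y : R => (ln (1 + phi * y))%:E).
  apply/measurable_EFinP; apply: measurableT_comp; first exact: measurable_ln.
  by apply: measurable_funD => //; apply: measurable_funM.
apply: (ge0_integral_pushforward msq nuL (measurable_itv `]0, +oo[) mf) => y.
rewrite inE/= in_itv/= andbT => y0; rewrite lee_fin.
by apply: ln_ge0; rewrite lerDl mulr_ge0// ltW.
Qed.

Lemma Phi_L_le x y : 0 <= x -> x <= y -> Phi_L eta nuL y -> Phi_L eta nuL x.
Proof.
move=> x0 xy [y0]; rewrite Phi_L_integral// => H; split => //.
rewrite Phi_L_integral//; apply: le_lt_trans H.
have msq : measurable_fun setT (fun x : R => x ^+ 2) by exact: measurable_funX.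
have mD : measurable ((fun x : R => x ^+ 2) @^-1` `]0, +oo[%classic).
  by rewrite -[X in measurable X]setTI; exact: msq.
apply: ge0_le_integral => //.
- by move=> z _; rewrite lee_fin lnj_ge0.
- by apply: measurable_funTS; apply/measurable_EFinP; exact: measurable_lnj.
- by apply: measurable_funTS; apply/measurable_EFinP; exact: measurable_lnj.
- move=> z _; rewrite lee_fin ler_ln ?posrE.
  + by rewrite lerD2l ler_wpM2r// sqr_ge0.
  + by rewrite (lt_le_trans ltr01)// lnj_arg.
  + by rewrite (lt_le_trans ltr01)// lnj_arg.
Qed.

(** [x] lies strictly below a supremum. The parameter obtained is positive even if [x = 0], so
    [ae_finite_jumps] is available. *)
Lemma Phi_L_kappa_ex kappa x : Phi_L_kappa beta eta L nuL kappa x ->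
  0 <= x /\ exists phi, [/\ x < phi, Phi_L eta nuL phi & (Vmoment beta eta L kappa phi < +oo)%E].
Proof.
move=> [x0 /ereal_sup_gtP[_ [phi [H1 H2] <-]]]; rewrite lte_fin => xphi.
by split => //; exists phi.
Qed.

Lemma Phi_L_kappa_le kappa x y : 0 <= x -> x <= y ->
  Phi_L_kappa beta eta L nuL kappa y -> Phi_L_kappa beta eta L nuL kappa x.
Proof. by move=> x0 xy [y0 H]; split => //; apply: le_lt_trans H; rewrite lee_fin. Qed.

Lemma gam_ge phi w : 0 <= phi -> finite_jumps (L ^~ w) -> 1 + phi * sqsum L 0 1 w <= gam L phi 1 w.
Proof.
move=> p0 fw; have := ln_jsum_le p0 (fw 1); rewrite -ler_expR lnK//.
by rewrite posrE ltr_pwDl// mulr_ge0// fine_jsum_ge0// => z; exact: sqj_ge0.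
Qed.

(** For s in []1, 2]], - X_s is at least - 2 eta plus the logarithmic jumps up to time 1; this
    interval has length 1. With [gam_ge] it transfers moments of V_inf to S_1. *)
Lemma Vinf_ge phi w : 0 <= phi -> finite_jumps (L ^~ w) ->
  ((beta * expR (- (2 * eta)) * gam L phi 1 w)%:E <= Vinf beta eta L phi w)%E.
Proof.
move=> p0 fw; rewrite VinfE -mulrA EFinM lee_pmul2l ?lte_fin//.
have mYw : measurable_fun setT (fun s => (Yp eta phi (L ^~ w) s)%:E).
  apply/measurable_EFinP.
  have := @measurable_Yp2 _ _ _ (fun t => L t : T0 -> R) eta phi (fun t _ => measurable_funPT (L t)) cL p0.
  by move=> H; exact: (measurableT_comp H (measurable_pair1 w)).
apply: (@le_trans _ _ (\int[mu]_(s in `]1%R, 2%R]) (Yp eta phi (L ^~ w) s)%:E)%E).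
  rewrite (_ : (_ * _)%:E = (\int[mu]_(s in `]1%R, 2%R]) (expR (- (2 * eta)) * gam L phi 1 w)%:E)%E).
    apply: ge0_le_integral => //.
    - by move=> s _; rewrite lee_fin mulr_ge0// expR_ge0.
    - by apply: measurable_funTS.
    - move=> s /=; rewrite in_itv/= => /andP[s1 s2]; have s0 := ltW (lt_trans ltr01 s1).
      rewrite lee_fin /Yp /gam -expRD ler_expR cogarch_X_jsum// opprB addrC.
      apply: lerD.
        apply: fine_le; [exact: (jsum_lnj_fin p0 (fw 1))|exact: (jsum_lnj_fin p0 (fw s))|].
        by apply: le_jsum (ltW s1) => // z; exact: lnj_ge0.
      by rewrite lerN2 mulrC ler_pM2r.
  rewrite integral_cst//= lebesgue_measure_itv/= lte_fin.
  have -> : (1 < 2 :> R) by lra.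
  by rewrite -EFinB (_ : 2 - 1 = 1 :> R) ?mule1//; lra.
apply: ge0_subset_integral => //.
- by apply: measurable_funTS.
- by move=> s _; rewrite lee_fin expR_ge0.
- by move=> s /=; rewrite !in_itv/= => /andP[s1 _]; rewrite (lt_trans ltr01 s1).
Qed.

Let aphi := beta * expR (- (2 * eta)).
Let a0 : 0 < aphi. Proof. by rewrite mulr_gt0// expR_gt0. Qed.

Lemma sqsum_le_Vinf phi w : 0 < phi -> finite_jumps (L ^~ w) ->
  ((aphi * phi * sqsum L 0 1 w)%:E <= Vinf beta eta L phi w)%E.
Proof.
move=> p0 fw; apply: le_trans (Vinf_ge (ltW p0) fw); rewrite lee_fin -mulrA ler_pM2l//.
by apply: le_trans (gam_ge (ltW p0) fw); rewrite lerDr.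
Qed.

Section Phi.
Variable phi : R.
Hypotheses (phi0 : 0 < phi) (Hphi : Phi_L eta nuL phi).

Let finL : {ae P0, forall w, finite_jumps (L ^~ w)} := ae_finite_jumps levyL nuLE levyL margL phi0 Hphi.

Let k0 : 0 < aphi * phi. Proof. exact: mulr_gt0. Qed.

Lemma mu_fin_Vinf : (\int[P0]_w Vinf beta eta L phi w < +oo)%E -> (\int[P0]_w (sqsum L 0 1 w)%:E < +oo)%E.
Proof.
move=> H.
have : (\int[P0]_w (aphi * phi * sqsum L 0 1 w)%:E < +oo)%E.
  apply: le_lt_trans H; apply: ae_ge0_le_integral => //.
  - by move=> w _; rewrite lee_fin mulr_ge0 ?sqsum_ge0// ltW.
  - by apply/measurable_EFinP; apply: measurable_funM => //; exact: measurable_sqsum.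
  - by move=> w _; apply: Vinf_ge0 => //; exact: ltW.
  - by apply: measurable_Vinf => //; exact: ltW.
  - by apply: filterS finL => w fw _; exact: sqsum_le_Vinf.
under eq_integral do rewrite EFinM.
rewrite ge0_integralZl_EFin ?(ltW k0)//; last 2 first.
- by move=> w _; rewrite lee_fin sqsum_ge0.
- by apply/measurable_EFinP; exact: measurable_sqsum.
by move: (integral_sqsum_ge0 L 1); case: (\int[P0]_w _)%E => [r _ _|_|//]; [exact: ltry|rewrite gt0_muley ?lte_fin// ltxx].
Qed.

Lemma m2_fin_Vinf : (\int[P0]_w (Vinf beta eta L phi w * Vinf beta eta L phi w) < +oo)%E ->
  (\int[P0]_w (sqsum L 0 1 w ^+ 2)%:E < +oo)%E.
Proof.
move=> H; have mS := measurable_sqsum levyL 1 (lexx 0).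
have k2 : 0 < (aphi * phi) ^+ 2 by rewrite exprn_gt0.
have : (\int[P0]_w ((aphi * phi) ^+ 2 * sqsum L 0 1 w ^+ 2)%:E < +oo)%E.
  apply: le_lt_trans H; apply: ae_ge0_le_integral => //.
  - by move=> w _; rewrite lee_fin mulr_ge0// sqr_ge0.
  - by apply/measurable_EFinP; apply: measurable_funM => //; exact: measurable_funX.
  - by move=> w _; rewrite mule_ge0//; apply: Vinf_ge0 => //; exact: ltW.
  - by apply: emeasurable_funM; apply: measurable_Vinf => //; exact: ltW.
  - apply: filterS finL => w fw _; rewrite -exprMn expr2 EFinM.
    have s0 : (0 <= (aphi * phi * sqsum L 0 1 w)%:E)%E.
      by rewrite lee_fin; apply: mulr_ge0; [exact: ltW|exact: sqsum_ge0].
    by apply: lee_pmul => //; exact: sqsum_le_Vinf.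
under eq_integral do rewrite EFinM.
rewrite ge0_integralZl_EFin ?(ltW k2)//; last 2 first.
- by move=> w _; rewrite lee_fin sqr_ge0.
- by apply/measurable_EFinP; exact: measurable_funX.
have : (0 <= \int[P0]_w (sqsum L 0 1 w ^+ 2)%:E)%E.
  by apply: integral_ge0 => w _; rewrite lee_fin sqr_ge0.
by case: (\int[P0]_w _)%E => [r _ _|_|//]; [exact: ltry|rewrite gt0_muley ?lte_fin// ltxx].
Qed.

Lemma rate1_Vinf : (\int[P0]_w Vinf beta eta L phi w < +oo)%E -> phi * mean1 L 1 < eta.
Proof.
move=> H; have mf := mu_fin_Vinf H.
have := integral_Vinf_lty levyL finL beta0 (ltW phi0) (leqnn 1) (gam_rate1 levyL finL (ltW phi0) mf) H.
by rewrite /rate /=; lra.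
Qed.

Lemma Vinf_fin_Vinf2 : (\int[P0]_w (Vinf beta eta L phi w * Vinf beta eta L phi w) < +oo)%E ->
  (\int[P0]_w Vinf beta eta L phi w < +oo)%E.
Proof.
have mV : measurable_fun setT (Vinf beta eta L phi) by apply: measurable_Vinf => //; exact: ltW.
have V0 w : (0 <= Vinf beta eta L phi w)%E by apply: Vinf_ge0 => //; exact: ltW.
move=> H; apply: (@le_lt_trans _ _ (\int[P0]_w (1%:E + Vinf beta eta L phi w * Vinf beta eta L phi w))%E).
  apply: ge0_le_integral => //.
  - by apply: emeasurable_funD => //; exact: emeasurable_funM.
  - move=> w _; move: (V0 w); case: (Vinf _ _ _ _ w) => [r r0|_|//]; last by rewrite leey.
    rewrite -EFinM -EFinD lee_fin; have := sqr_ge0 (r - 1); rewrite expr2.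
    by rewrite lee_fin in r0; nra.
rewrite ge0_integralD//.
- by rewrite integral_one lte_add_pinfty// ltry.
- by move=> w _; rewrite mule_ge0.
- exact: emeasurable_funM.
Qed.

Lemma rate2_Vinf : (\int[P0]_w (Vinf beta eta L phi w * Vinf beta eta L phi w) < +oo)%E ->
  2 * phi * mean1 L 1 + phi ^+ 2 * var1 L < 2 * eta.
Proof.
move=> H; have H1 := Vinf_fin_Vinf2 H; have mf := mu_fin_Vinf H1; have m2f := m2_fin_Vinf H.
have c0 : rate eta (grate L phi) 1 < 0 by have := rate1_Vinf H1; rewrite /rate /=; lra.
have := integral_Vinf2_lty levyL finL beta0 (ltW phi0) (leqnSn 1) (gam_rate2 levyL finL (ltW phi0) mf m2f) (leqnn 2) c0 H.
by rewrite /rate /=; lra.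
Qed.

End Phi.

(** Everything is shown at the larger parameter of [Phi_L_kappa_ex] and passes down to [x], since
    [Phi_L] and the rates are monotone and the moments of S_1 do not involve the parameter. *)
Lemma kappa1_facts x : Phi_L_kappa beta eta L nuL 1 x ->
  [/\ 0 <= x, Phi_L eta nuL x, (exists2 phi, 0 < phi & Phi_L eta nuL phi),
      (\int[P0]_w (sqsum L 0 1 w)%:E < +oo)%E & x * mean1 L 1 < eta].
Proof.
move=> /Phi_L_kappa_ex[x0 [phi [xphi Hphi HV]]].
have p0 : 0 < phi by exact: le_lt_trans xphi.
have H : (\int[P0]_w Vinf beta eta L phi w < +oo)%E.
  move: HV; rewrite /Vmoment; congr (_ < _)%E; apply: eq_integral => w _.
  by rewrite poweRe1//; apply: Vinf_ge0 => //; exact: ltW.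
split => //.
- exact: Phi_L_le (ltW xphi) Hphi.
- by exists phi.
- exact: mu_fin_Vinf H.
- apply: le_lt_trans (rate1_Vinf p0 Hphi H).
  by rewrite ler_wpM2r ?mean1_ge0// ltW.
Qed.

Lemma kappa2_facts x : Phi_L_kappa beta eta L nuL 2 x ->
  [/\ 0 <= x, (exists2 phi, 0 < phi & Phi_L eta nuL phi),
      (\int[P0]_w (sqsum L 0 1 w)%:E < +oo)%E, (\int[P0]_w (sqsum L 0 1 w ^+ 2)%:E < +oo)%E &
      x * mean1 L 1 < eta /\ 2 * x * mean1 L 1 + x ^+ 2 * var1 L < 2 * eta].
Proof.
move=> /Phi_L_kappa_ex[x0 [phi [xphi Hphi HV]]].
have p0 : 0 < phi by exact: le_lt_trans xphi.
have H : (\int[P0]_w (Vinf beta eta L phi w * Vinf beta eta L phi w) < +oo)%E.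
  move: HV; rewrite /Vmoment; congr (_ < _)%E; apply: eq_integral => w _.
  have : (0 <= Vinf beta eta L phi w)%E by apply: Vinf_ge0 => //; exact: ltW.
  case: (Vinf _ _ _ _ w) => [r r0|_|//]; last by rewrite poweRyr// mulyy.
  by rewrite poweR_EFin -EFinM powR_mulrn ?expr2.
have H1 := Vinf_fin_Vinf2 p0 H.
have finL := ae_finite_jumps levyL nuLE levyL margL p0 Hphi.
have mf := mu_fin_Vinf p0 Hphi H1; have m2f := m2_fin_Vinf p0 Hphi H.
have xle := ltW xphi; have mu0 := mean1_ge0 L; have v0 := var1_ge0 levyL finL mf m2f.
have r1 := rate1_Vinf p0 Hphi H1; have r2 := rate2_Vinf p0 Hphi H.
split => //; first by exists phi.
split.
  by apply: le_lt_trans r1; rewrite ler_wpM2r.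
apply: le_lt_trans r2; apply: lerD.
  by rewrite ler_wpM2r// ler_wpM2l.
by rewrite ler_wpM2r// lerXn2r// ?nnegrE// ltW.
Qed.

End KappaFacts.

(** * Mean, variance and covariance of a stationary COGARCH process *)

Section StationaryCogarch.
Context {R : realType}.
Context {d0} {T0 : measurableType d0} (P0 : probability T0 R) (L : R -> {RV P0 >-> R}).
Context (nuL : {measure set R -> \bar R}).
Hypothesis levyL : levy_process L.
Hypothesis nuLE : levy_measure L nuL.
Variables (beta eta : R).
Hypotheses (beta0 : 0 < beta) (eta0 : 0 < eta).
Local Notation mu1 := (mean1 L 1).

Definition statmean x : R := beta / (eta - x * mu1).
(** The value 2 beta^2 / (r_1 r_2); both factors of the denominator are negative on [Phi_L_kappa] of
    order 2. *)
Definition statmean2 x : R :=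
  2 * beta ^+ 2 / ((x * mu1 - eta) * (2 * x * mu1 + x ^+ 2 * var1 L - 2 * eta)).

Let margL : (forall h, 0 <= h -> forall A : set R, measurable A ->
  P0 [set w | A (L h w)] = P0 [set w | A (L h w)]).
Proof. by []. Qed.

Lemma expectation_subordinator : ('E_P0[subordinator L 1] = \int[P0]_w (sqsum L 0 1 w)%:E)%E.
Proof. by rewrite unlock. Qed.

Lemma levy_copy_marg d (T : measurableType d) (P : probability T R) (M : R -> {RV P >-> R}) :
  levy_copy L M -> forall h, 0 <= h -> forall A : set R, measurable A ->
  P [set w | A (M h w)] = P0 [set w | A (L h w)].
Proof.
move=> [_ lawM] h h0 A mA; apply: (lawM [set f | A (f h)]).
apply: sub_sigma_algebra; exists h; first by rewrite /= in_itv/= h0.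
by exists A => //; rewrite setTI.
Qed.

Lemma levy_copy_finite_jumps d (T : measurableType d) (P : probability T R) (M : R -> {RV P >-> R}) :
  levy_copy L M -> (exists2 phi, 0 < phi & Phi_L eta nuL phi) ->
  {ae P, forall w, finite_jumps (M ^~ w)}.
Proof.
move=> copyM [phi p0 Hphi].
exact: (ae_finite_jumps levyL nuLE (proj1 copyM) (levy_copy_marg copyM) p0 Hphi).
Qed.

Lemma levy_copy_refl : levy_copy L L.
Proof. by split. Qed.

Lemma integral_Vinf_kappa1 x : Phi_L_kappa beta eta L nuL 1 x ->
  (\int[P0]_w Vinf beta eta L x w = (statmean x)%:E)%E.
Proof.
move=> /(kappa1_facts levyL nuLE beta0 eta0)[x0 _ /(levy_copy_finite_jumps levy_copy_refl) finL mf c0].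
have c0' : rate eta (grate L x) 1 < 0 by rewrite /rate /=; lra.
rewrite (integral_Vinf_fin levyL finL beta0 x0 (leqnn 1) (gam_rate1 levyL finL x0 mf) c0').
rewrite /rate/= mul1r /statmean; congr EFin.
rewrite mulNr -mulrN -invrN opprB; congr (_ / _); by ring.
Qed.

Section Process.
Context {d} {T : measurableType d} (P : probability T R) (M : R -> {RV P >-> R}) (v0 : {RV P >-> R}).
Variable x : R.
Hypothesis copyM : levy_copy L M.
Hypothesis v00 : forall w, 0 <= v0 w.
Hypothesis indepMv : forall E F, sigma_process M E -> g_sigma_algebra_preimage v0 F ->
  P (E `&` F) = (P E * P F)%E.
Hypothesis stat : stationary_law beta eta L x P v0.
Hypothesis x0 : 0 <= x.
Local Notation V := (cogarch beta eta x v0 M).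

Let levyM : levy_process M := proj1 copyM.
Let margM := levy_copy_marg copyM.

Lemma cogarchE t w : V t w = Vol beta (YM M eta x) v0 w t.
Proof. by rewrite /cogarch cogarch_VE. Qed.

Lemma cogarch0 w : V 0 w = v0 w.
Proof. by rewrite cogarchE /Vol Jint0 mulr0 addr0 /YM Yp_0 mul1r. Qed.

Lemma cogarch_ge0 t w : 0 <= V t w.
Proof. by rewrite cogarchE; apply: Vol_ge0 => // {}w s; exact: YM_gt0. Qed.

Lemma measurable_cogarch t : measurable_fun setT (V t).
Proof.
rewrite [X in measurable_fun _ X](_ : _ = Vol beta (YM M eta x) v0 ^~ t); last first.
  by apply/funext => w; exact: cogarchE.
apply: measurable_Vol => //; [exact: measurable_YM2|by move=> w s; exact: YM_gt0].
Qed.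

Let law (f : \bar R -> \bar R) : measurable_fun setT f -> (forall y, 0 <= f y)%E ->
  (\int[P]_w f (v0 w)%:E = \int[P0]_w f (Vinf beta eta L x w))%E.
Proof.
move=> mf f0.
have m1 : measurable_fun setT (EFin \o v0) by apply/measurable_EFinP; exact: measurable_funPT.
have m2 : measurable_fun setT (Vinf beta eta L x) by exact: measurable_Vinf.
have e1 := ge0_integral_pushforward m1 P measurableT mf (fun y _ => f0 y).
have e2 := ge0_integral_pushforward m2 P0 measurableT mf (fun y _ => f0 y).
rewrite !preimage_setT in e1 e2.
rewrite -[LHS]e1 -[RHS]e2; apply: eq_measure_integral => A mA _.
exact: stat.
Qed.

Lemma integral_v0 : (\int[P]_w (v0 w)%:E = \int[P0]_w Vinf beta eta L x w)%E.
Proof.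
(* [law] takes a function that is nonnegative on all extended reals; the absolute value is the
   identity on the values at hand. *)
have := @law (fun y => `|y|)%E (@abse_measurable R setT) (@abse_ge0 R).
rewrite (eq_integral (fun w => (v0 w)%:E)) => [->|w _]; last by rewrite gee0_abs// lee_fin.
by apply: eq_integral => w _; rewrite gee0_abs// Vinf_ge0.
Qed.

Lemma integral_v02 : (\int[P]_w (v0 w ^+ 2)%:E =
  \int[P0]_w (Vinf beta eta L x w * Vinf beta eta L x w))%E.
Proof.
have m : measurable_fun setT (fun y : \bar R => `|y| * `|y|)%E by apply: emeasurable_funM; exact: abse_measurable.
have := @law (fun y => `|y| * `|y|)%E m (fun y => mule_ge0 (abse_ge0 y) (abse_ge0 y)).
rewrite (eq_integral (fun w => (v0 w ^+ 2)%:E)) => [->|w _].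
  by apply: eq_integral => w _; rewrite gee0_abs// Vinf_ge0.
by rewrite gee0_abs// ?lee_fin// expr2 EFinM.
Qed.

Section Kappa1.
Hypothesis Hx : Phi_L_kappa beta eta L nuL 1 x.

Lemma E_v0 : (\int[P]_w (v0 w)%:E = (statmean x)%:E)%E.
Proof. by rewrite integral_v0 integral_Vinf_kappa1. Qed.

(** [E_V] with the rates of [gam_rate1]; the balance condition [mE] holds because [v0] has the law
    of V_inf, whose mean is - beta / r_1. *)
Lemma E_cogarch t : 0 <= t -> (\int[P]_w (V t w)%:E = (statmean x)%:E)%E.
Proof.
move=> t0.
have [_ _ Hphi mf c0] := kappa1_facts levyL nuLE beta0 eta0 Hx.
have finL := levy_copy_finite_jumps levy_copy_refl Hphi.
have finM := levy_copy_finite_jumps copyM Hphi.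
have lf := locally_finite_YM levyM finM (ltW eta0) x0.
have HG := gam_rate1 levyL finL x0 mf.
have vf j : (j <= 1)%N -> (\int[P]_w (v0 w ^+ j)%:E < +oo)%E.
  case: j => [|[|]]// _; last by under eq_integral do rewrite expr1; rewrite E_v0 ltry.
  by under eq_integral do rewrite expr0; rewrite integral_one ltry.
have mom := cogarch_moments levyM levyL margM finM finL v00 indepMv eta x0 HG vf.
have nu0 : fine (\int[P]_w (v0 w ^+ 0)%:E)%E = 1.
  by under eq_integral do rewrite expr0; rewrite integral_one.
have nu1 : fine (\int[P]_w (v0 w ^+ 1)%:E)%E = statmean x.
  by under eq_integral do rewrite expr1; rewrite E_v0.
have C0 : rate eta (grate L x) 0 = 0 by rewrite /rate /= mul0r subr0.
have C1 : rate eta (grate L x) 1 = x * mu1 - eta by rewrite /rate /= mul1r.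
have c1 : rate eta (grate L x) 1 < 0 by rewrite C1; lra.
have mE : fine (\int[P]_w (v0 w ^+ 1)%:E)%E = - beta / rate eta (grate L x) 1.
  by rewrite nu1 C1 /statmean mulNr -mulrN -invrN opprB.
have := @E_V _ _ _ P beta _ v0 beta0 (measurable_YM2 levyM eta x0) (@YM_gt0 _ _ _ _ _ _ _)
  (measurable_funPT v0) v00 lf 1 (rate eta (grate L x)) (fun j => fine (\int[P]_w (v0 w ^+ j)%:E)%E)
  (leqnn 1) mom nu0 C0 c1 mE t t0.
rewrite nu1 => <-; apply: eq_integral => w _; by rewrite cogarchE.
Qed.

End Kappa1.

Section Kappa2.
Hypothesis Hx : Phi_L_kappa beta eta L nuL 2 x.

Lemma kappa2_mean : (\int[P0]_w Vinf beta eta L x w = (statmean x)%:E)%E.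
Proof.
have [_ Hphi mf _ [c0 _]] := kappa2_facts levyL nuLE beta0 eta0 Hx.
have finL := levy_copy_finite_jumps levy_copy_refl Hphi.
have c0' : rate eta (grate L x) 1 < 0 by rewrite /rate /=; lra.
rewrite (integral_Vinf_fin levyL finL beta0 x0 (leqnn 1) (gam_rate1 levyL finL x0 mf) c0').
rewrite /rate/= mul1r /statmean; congr EFin.
by rewrite mulNr -mulrN -invrN opprB.
Qed.

Lemma E_v02 : (\int[P]_w (v0 w ^+ 2)%:E = (statmean2 x)%:E)%E.
Proof.
have [_ Hphi mf m2f [c0 d0']] := kappa2_facts levyL nuLE beta0 eta0 Hx.
have finL := levy_copy_finite_jumps levy_copy_refl Hphi.
have c0' : rate eta (grate L x) 1 < 0 by rewrite /rate /=; lra.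
have d0'' : rate eta (grate L x) 2 < 0 by rewrite /rate /=; lra.
rewrite integral_v02 (integral_Vinf2_fin levyL finL beta0 x0 (leqnSn 1) (gam_rate2 levyL finL x0 mf m2f) (leqnn 2) c0' d0'').
by rewrite /rate/= mul1r.
Qed.

Lemma E_cogarch_prod s t : 0 <= s -> s <= t ->
  (\int[P]_w (V s w)%:E = (statmean x)%:E)%E /\
  (\int[P]_w (V s w * V t w)%:E =
   (statmean2 x * expR ((t - s) * (x * mu1 - eta)) +
    statmean x ^+ 2 * (1 - expR ((t - s) * (x * mu1 - eta))))%:E)%E.
Proof.
move=> s0 st.
have [_ Hphi mf m2f [c0 d0']] := kappa2_facts levyL nuLE beta0 eta0 Hx.
have finL := levy_copy_finite_jumps levy_copy_refl Hphi.
have finM := levy_copy_finite_jumps copyM Hphi.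
have lf := locally_finite_YM levyM finM (ltW eta0) x0.
have HG := gam_rate2 levyL finL x0 mf m2f.
have E1 : (\int[P]_w (v0 w)%:E = (statmean x)%:E)%E by rewrite integral_v0 kappa2_mean.
have vf j : (j <= 2)%N -> (\int[P]_w (v0 w ^+ j)%:E < +oo)%E.
  case: j => [|[|[|]]]// _; last by rewrite E_v02 ltry.
    by under eq_integral do rewrite expr0; rewrite integral_one ltry.
  by under eq_integral do rewrite expr1; rewrite E1 ltry.
have mom := cogarch_moments levyM levyL margM finM finL v00 indepMv eta x0 HG vf.
have nu0 : fine (\int[P]_w (v0 w ^+ 0)%:E)%E = 1.
  by under eq_integral do rewrite expr0; rewrite integral_one.
have nu1 : fine (\int[P]_w (v0 w ^+ 1)%:E)%E = statmean x.
  by under eq_integral do rewrite expr1; rewrite E1.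
have nu2 : fine (\int[P]_w (v0 w ^+ 2)%:E)%E = statmean2 x by rewrite E_v02.
have C0 : rate eta (grate L x) 0 = 0 by rewrite /rate /= mul0r subr0.
have C1 : rate eta (grate L x) 1 = x * mu1 - eta by rewrite /rate /= mul1r.
have C2 : rate eta (grate L x) 2 = 2 * x * mu1 + x ^+ 2 * var1 L - 2 * eta by [].
have c1 : rate eta (grate L x) 1 < 0 by rewrite C1; lra.
have c2 : rate eta (grate L x) 2 < 0 by rewrite C2; lra.
have mE : fine (\int[P]_w (v0 w ^+ 1)%:E)%E = - beta / rate eta (grate L x) 1.
  by rewrite nu1 C1 /statmean mulNr -mulrN -invrN opprB.
(* With m = - beta / r_1, the second moment 2 beta^2 / (r_1 r_2) is - 2 beta m / r_2. *)
have m2E : fine (\int[P]_w (v0 w ^+ 2)%:E)%E =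
    - (2 * beta * fine (\int[P]_w (v0 w ^+ 1)%:E)%E) / rate eta (grate L x) 2.
  rewrite mE nu2 /statmean2 -C1 -C2.
  have cn : rate eta (grate L x) 1 != 0 by rewrite lt_eqF.
  have dn : rate eta (grate L x) 2 != 0 by rewrite lt_eqF.
  by field; rewrite cn dn.
split.
  have := @E_V _ _ _ P beta _ v0 beta0 (measurable_YM2 levyM eta x0) (@YM_gt0 _ _ _ _ _ _ _)
    (measurable_funPT v0) v00 lf 2 (rate eta (grate L x)) (fun j => fine (\int[P]_w (v0 w ^+ j)%:E)%E)
    (leqnSn 1) mom nu0 C0 c1 mE s s0.
  by rewrite nu1 => <-; apply: eq_integral => w _; rewrite cogarchE.
have := @E_VV _ _ _ P beta _ v0 beta0 (measurable_YM2 levyM eta x0) (@YM_gt0 _ _ _ _ _ _ _)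
  (measurable_funPT v0) v00 lf 2 (rate eta (grate L x)) (fun j => fine (\int[P]_w (v0 w ^+ j)%:E)%E)
  (leqnSn 1) mom nu0 C0 c1 mE (leqnn 2) c2 m2E s t s0 st.
rewrite nu1 nu2 C1 [_ * (t - s)]mulrC => <-.
by apply: eq_integral => w _; rewrite !cogarchE.
Qed.

Lemma covariance_cogarch s t : 0 <= s -> s <= t ->
  covariance P (V s) (V t) =
  (expR ((t - s) * (x * mu1 - eta)) * (statmean2 x - statmean x ^+ 2))%:E.
Proof.
move=> s0 st; have t0 := le_trans s0 st.
have [E1 E2] := E_cogarch_prod s0 st.
have [E3 _] := E_cogarch_prod t0 (lexx t).
rewrite covariance_nneg ?E1 ?E3 ?E2 ?ltry//.
- by rewrite -EFinM -EFinB; congr EFin; ring.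
- exact: measurable_cogarch.
- exact: measurable_cogarch.
- by move=> w; exact: cogarch_ge0.
- by move=> w; exact: cogarch_ge0.
Qed.

Lemma statvarE : statmean2 x - statmean x ^+ 2 =
  beta ^+ 2 * x ^+ 2 * var1 L /
    ((x * mu1 - eta) ^+ 2 * (2 * eta - 2 * x * mu1 - x ^+ 2 * var1 L)).
Proof.
have [_ Hphi mf m2f [c0 d0']] := kappa2_facts levyL nuLE beta0 eta0 Hx.
rewrite /statmean2 /statmean.
have n1 : eta - x * mu1 != 0 by rewrite gt_eqF// subr_gt0.
have n2 : x * mu1 - eta != 0 by rewrite lt_eqF// subr_lt0.
have n3 : 2 * eta - 2 * x * mu1 - x ^+ 2 * var1 L != 0 by rewrite gt_eqF//; lra.
have n4 : 2 * x * mu1 + x ^+ 2 * var1 L - 2 * eta != 0 by rewrite lt_eqF//; lra.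
by field; rewrite n1 n2 n3 n4.
Qed.

Lemma variance_v0 : ('V_P[v0] = (statmean2 x - statmean x ^+ 2)%:E)%E.
Proof.
have := covariance_cogarch (lexx 0) (lexx 0).
rewrite subrr mul0r expR0 mul1r /variance => <-.
by have -> : V 0 = v0 by apply/funext => w; exact: cogarch0.
Qed.

End Kappa2.
End Process.
End StationaryCogarch.

(** * Boundedness of the stationary mean *)

Section NonDegenerate.
Context {R : realType}.
Context {d0} {T0 : measurableType d0} (P0 : probability T0 R) (L : R -> {RV P0 >-> R}).
Hypothesis levyL : levy_process L.
Hypothesis finL : {ae P0, forall w, finite_jumps (L ^~ w)}.
Hypothesis mu_fin : (\int[P0]_w (sqsum L 0 1 w)%:E < +oo)%E.
Hypothesis m2_fin : (\int[P0]_w (sqsum L 0 1 w ^+ 2)%:E < +oo)%E.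

Let margL : (forall h, 0 <= h -> forall A : set R, measurable A ->
  P0 [set w | A (L h w)] = P0 [set w | A (L h w)]).
Proof. by []. Qed.

Let q4 (y : R) := y ^+ 4.
Let q40 y : 0 <= q4 y. Proof. by rewrite /q4 (exprM y 2 2) sqr_ge0. Qed.
Let approx_q4 : approx (trunc q4) q4.
Proof.
apply: approx_trunc => //; last by rewrite /q4 expr0n.
exact: exprn_continuous.
Qed.

Let jsum_q4_le f h : jsum sqj f 0 h \is a fin_num ->
  (jsum q4 f 0 h <= (fine (jsum sqj f 0 h) ^+ 2)%:E)%E.
Proof.
move=> Sf; apply: ge_ereal_sup => _ [F [fF FI] <-].
rewrite fsbig_finite//= sumEFin lee_fin.
apply: (@le_trans _ _ ((\sum_(x <- finmap.enum_fset (fset_set F)) sqj (jump f x)) ^+ 2)).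
  elim: {FI}(finmap.enum_fset (fset_set F)) => [|y s IH]; first by rewrite !big_nil expr0n.
  rewrite !big_cons; set S := \sum_(x <- s) sqj _ in IH *.
  have S0 : 0 <= S by apply: sumr_ge0 => z _; exact: sqj_ge0.
  have y0 := @sqj_ge0 R (jump f y).
  have -> : q4 (jump f y) = sqj (jump f y) ^+ 2 by rewrite /q4 /sqj -exprM.
  have := mulr_ge0 y0 S0; rewrite sqrrD; move: IH; set Q := \sum_(x <- s) _ => IH H.
  rewrite -mulr_natr mulr2n; lra.
rewrite lerXn2r ?nnegrE//.
- by apply: sumr_ge0 => z _; exact: sqj_ge0.
- by apply: fine_ge0; apply: jsum_ge0; exact: sqj_ge0.
rewrite -lee_fin fineK//.
by apply: ereal_sup_ubound; exists F => //; rewrite fsbig_finite//= sumEFin.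
Qed.

(** The mean of the sum of the fourth powers of the jumps of L up to [h] is linear in [h], but at
    most the mean of S_h^2, which is (h E[S_1])^2 when the variance is 0. Small [h] forces it to
    vanish, so there are almost surely no jumps up to time 1. *)
Lemma mean1_eq0 : var1 L = 0 -> mean1 L 1 = 0.
Proof.
move=> v0; pose J4 (h : R) := (\int[P0]_w jsum q4 (L ^~ w) 0 h)%E.
have m4 b a : 0 <= a -> measurable_fun setT (fun w => jsum q4 (L ^~ w) a b).
  by move=> a0; exact: (measurable_jsum_levy b levyL approx_q4 a0).
have J40 h : (0 <= J4 h)%E by apply: integral_ge0 => w _; exact: jsum_ge0.
have J4D s t : 0 <= s -> 0 <= t -> J4 (s + t) = (J4 s + J4 t)%E.
  move=> s0 t0; have st : s <= s + t by rewrite lerDl.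
  have -> : J4 t = (\int[P0]_w jsum q4 (L ^~ w) s (s + t))%E.
    by rewrite (integral_jsum levyL levyL margL approx_q4 s0 st) addrC addKr.
  rewrite /J4 -ge0_integralD//; last 4 first.
  - by move=> w _; exact: jsum_ge0.
  - exact: m4.
  - by move=> w _; exact: jsum_ge0.
  - exact: m4.
  by apply: eq_integral => w _; rewrite (@jsumD _ _ _ 0 s).
have J4le h : 0 <= h -> (J4 h <= ((h * mean1 L 1) ^+ 2)%:E)%E.
  move=> h0; have <- : mean2 L h = (h * mean1 L 1) ^+ 2 by rewrite var_linear// v0 mulr0 add0r.
  rewrite /mean2 fineK ?integral_sqsum2_fin//.
  apply: ae_ge0_le_integral => //.
  - by move=> w _; exact: jsum_ge0.
  - exact: m4.
  - by move=> w _; rewrite lee_fin sqr_ge0.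
  - by apply/measurable_EFinP; exact: measurable_sqsumX.
  - by apply: filterS finL => w fw _; apply: jsum_q4_le; exact: jsum_sq_fin.
have J4f h : 0 <= h -> J4 h \is a fin_num.
  by move=> h0; rewrite ge0_fin_numE//; apply: le_lt_trans (J4le h h0) (ltry _).
have lin h : 0 <= h -> fine (J4 h) = h * fine (J4 1).
  apply: (@additive_linear R (fun h => fine (J4 h))) => [s t s0 t0|t t0]; last exact: fine_ge0.
  by rewrite J4D// fineD// J4f.
have J41 : fine (J4 1) = 0.
  apply/eqP; rewrite eq_le fine_ge0// andbT; apply/ler_addgt0Pr => e e0; rewrite add0r.
  have mu0 := mean1_ge0 L; set m := mean1 L 1 in mu0 J4le *.
  (* Chosen so that h m^2 <= e; the extra 1 avoids division by zero. *)
  pose h := e / (m ^+ 2 + 1).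
  have k0 : 0 < m ^+ 2 + 1 by rewrite ltr_wpDl// sqr_ge0.
  have h0 : 0 < h by rewrite divr_gt0.
  have := J4le h (ltW h0); rewrite -[X in (X <= _)%E]fineK ?J4f ?(ltW h0)// lin ?(ltW h0)// lee_fin.
  rewrite exprMn expr2 -mulrA ler_pM2l// => H; apply: (le_trans H).
  by rewrite /h mulrAC ler_pdivrMr// ler_pM2l// lerDl.
have : ae_eq P0 setT (fun w => jsum q4 (L ^~ w) 0 1) (cst 0%E).
  apply/(ae_eq_integral_abs P0 measurableT (m4 1 0 (lexx 0))).
  rewrite -[RHS](_ : J4 1 = 0%E); last by rewrite -[J4 1]fineK ?J4f// J41.
  by apply: eq_integral => w _; rewrite gee0_abs//; exact: jsum_ge0.
move=> H; rewrite /mean1.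
suff -> : (\int[P0]_w (sqsum L 0 1 w)%:E = \int[P0]_w 0)%E by rewrite integral0.
apply: ae_integral; apply: filterS H => w /(_ Logic.I) H _.
rewrite /sqsum /jsum esum1// => y; rewrite /= in_itv/= => y01.
have := jsum_ge1 _ q40 y01 : ((q4 (jump (L ^~ w) y))%:E <= jsum q4 (L ^~ w) 0 1)%E.
rewrite H lee_fin => H4; congr EFin; apply/eqP.
rewrite /sqj sqrf_eq0; move: (q40 (jump (L ^~ w) y)) => H5.
have : q4 (jump (L ^~ w) y) == 0 by rewrite eq_le H4 H5.
by rewrite /q4 expf_eq0.
Qed.

(** The second order condition keeps eta - x E[S_1] away from 0 if Var[S_1] > 0; otherwise E[S_1] =
    0 by [mean1_eq0]. This gives finite means of the superposition in part (b). *)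
Lemma statmean_bound eta beta : 0 < eta -> 0 < beta ->
  exists2 K : R, 0 <= K & forall x, 0 <= x -> x * mean1 L 1 < eta ->
    2 * x * mean1 L 1 + x ^+ 2 * var1 L < 2 * eta -> statmean L beta eta x <= K.
Proof.
move=> e0 b0; have mu0 := mean1_ge0 L; have v0 := var1_ge0 levyL finL mu_fin m2_fin.
suff [del del0 Hd] : exists2 del : R, 0 < del & forall x, 0 <= x -> x * mean1 L 1 < eta ->
    2 * x * mean1 L 1 + x ^+ 2 * var1 L < 2 * eta -> del <= eta - x * mean1 L 1.
  exists (beta / del) => [|x x0 H1 H2]; first by rewrite divr_ge0// ltW.
  rewrite /statmean ler_pM2l// lef_pV2 ?posrE ?subr_gt0//.
  exact: Hd.
have [m0|mn0] := eqVneq (mean1 L 1) 0.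
  by exists eta => // x _ _ _; rewrite m0 mulr0 subr0.
have vgt : 0 < var1 L.
  by rewrite lt_neqAle v0 andbT eq_sym; apply: contra mn0 => /eqP/mean1_eq0 ->.
have mgt : 0 < mean1 L 1 by rewrite lt_neqAle eq_sym mn0.
set m := mean1 L 1 in mu0 mn0 mgt *; set V := var1 L in v0 vgt *.
(* If x m <= eta / 2 the gap is at least eta / 2. Otherwise x >= eta / (2 m), and the second
   inequality gives a gap above x^2 V / 2. *)
exists (Num.min (eta / 2) ((eta / (2 * m)) ^+ 2 * V / 2)).
  by rewrite lt_min !divr_gt0//= mulr_gt0// exprn_gt0// divr_gt0// mulr_gt0.
move=> x x0 H1 H2; rewrite ge_min; apply/orP.
have [xm|xm] := lerP (x * m) (eta / 2); [left|right]; first lra.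
have hx : eta / (2 * m) <= x.
  by rewrite ler_pdivrMr ?mulr_gt0//; lra.
have h0 : 0 <= eta / (2 * m) by rewrite divr_ge0 ?ltW// mulr_gt0.
have h2 : (eta / (2 * m)) ^+ 2 <= x ^+ 2 by rewrite lerXn2r// nnegrE.
have : (eta / (2 * m)) ^+ 2 * V <= x ^+ 2 * V by rewrite ler_wpM2r.
lra.
Qed.

End NonDegenerate.

(** * The discrete mixing measure and its support *)

Section Mixing.
Context {R : realType}.
Variables (p phi : nat -> R) (mix : probability R R).
Hypothesis p_ge0 : forall i, 0 <= p i.
Hypothesis mixE : forall A : set R, measurable A ->
  mix A = (\sum_(0 <= i <oo) ((p i)%:E * \d_(phi i) A))%E.
Local Open Scope ereal_scope.

(** An atom of positive weight outside [A] would give the complement positive mass. *)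
Lemma mix_support A : measurable A -> mix A = 1 -> forall i, (0 < p i)%R -> A (phi i).
Proof.
move=> mA A1 i pi; apply: contrapT => nA.
have : mix (~` A) = 0 by rewrite probability_setC// A1 subee.
rewrite mixE; last exact: measurableC.
apply/eqP; rewrite gt_eqF//.
have t0 j : 0 <= (p j)%:E * \d_(phi j) (~` A) by rewrite mule_ge0// lee_fin.
apply: (@lt_le_trans _ _ (\sum_(0 <= j < i.+1) ((p j)%:E * \d_(phi j) (~` A)))); last first.
  by apply: nneseries_lim_ge => j _ _.
rewrite big_nat_recr//=; apply: (@lt_le_trans _ _ (p i)%:E); first by rewrite lte_fin.
rewrite diracE mem_set// mule1 leeDr//.
by apply: sume_ge0 => j _; exact: t0.
Qed.

Lemma sum_mix : \sum_(0 <= i <oo) (p i)%:E = 1.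
Proof.
rewrite -(probability_setT mix) mixE//; apply: eq_eseriesr => i _.
by rewrite diracT mule1.
Qed.

Lemma integral_mix (D : set R) (f : R -> \bar R) : measurable D -> measurable_fun D f ->
  (forall x, D x -> 0 <= f x) ->
  \int[mix]_(x in D) f x = \sum_(0 <= i <oo) ((p i)%:E * (\d_(phi i) D * f (phi i))).
Proof.
move=> mD mf f0.
pose m_ i := mscale (NngNum (p_ge0 i)) (dirac (phi i)).
transitivity (\int[mseries m_ 0]_(x in D) f x).
  by apply: eq_measure_integral => A mA _; exact: (mixE mA).
rewrite ge0_integral_measure_series//; apply: eq_eseriesr => i _.
rewrite ge0_integral_mscale// integral_dirac//.
Qed.

End Mixing.

Section PhiIntervals.
Context {R : realType}.
Context {d0} {T0 : measurableType d0} (P0 : probability T0 R) (L : R -> {RV P0 >-> R}).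
Context (nuL : {measure set R -> \bar R}).
Hypothesis levyL : levy_process L.
Variables (beta eta : R).

Lemma measurable_Phi_L : measurable (Phi_L eta nuL).
Proof.
apply: is_interval_measurable => x y Hx Hy z /andP[xz zy].
by apply: Phi_L_le zy Hy; apply: le_trans xz; case: Hx.
Qed.

Lemma measurable_Phi_L_kappa kappa : measurable (Phi_L_kappa beta eta L nuL kappa).
Proof.
apply: is_interval_measurable => x y Hx Hy z /andP[xz zy].
by apply: Phi_L_kappa_le zy Hy; apply: le_trans xz; case: Hx.
Qed.

End PhiIntervals.

(** * Distinct components are uncorrelated *)

Section Decomposition.
Context {R : realType}.
Context {d} {T : measurableType d} (P : probability T R) (M : R -> {RV P >-> R}).
Hypothesis levyM : levy_process M.
Variables (beta eta x : R).
Hypotheses (beta0 : 0 < beta) (x0 : 0 <= x).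

Definition Vol0 t w := Vol beta (YM M eta x) (fun=> 0) w t.

Let cM w : cadlag (M ^~ w). Proof. by case: levyM. Qed.

Lemma Vol0_ge0 t w : 0 <= Vol0 t w.
Proof. by apply: Vol_ge0 => // {}w s; exact: YM_gt0. Qed.

Lemma sigma_Vol0 t : measurable_fun (setT : set (process_type (fun t => M t : T -> R))) (Vol0 t).
Proof.
pose X : R -> T -> R := fun t => M t.
have gen d' (T' : measurableType d') (Z : R -> T' -> R) : (forall r, 0 <= r -> measurable_fun setT (Z r)) ->
    (forall w, cadlag (Z ^~ w)) ->
    measurable_fun setT (fun w => Vol beta (fun w s => Yp eta x (Z ^~ w) s) (fun=> 0) w t).
  move=> mZ cZ; apply: measurable_Vol => //; first exact: measurable_Yp2.
  by move=> w s; exact: expR_gt0.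
exact: (gen _ (process_type X) X (@measurable_process _ _ _ X) cM).
Qed.

Lemma measurable_Vol0 t : measurable_fun setT (Vol0 t).
Proof.
by apply: measurable_Vol => //; [exact: measurable_YM2|move=> w s; exact: YM_gt0].
Qed.

(** The powers 1 and 0 give both summands the common form: functional of the process times a power
    of the start. *)
Lemma Vol_split (v0 : T -> R) t w :
  Vol beta (YM M eta x) v0 w t = YM M eta x w t * v0 w ^+ 1 + Vol0 t w * v0 w ^+ 0.
Proof. by rewrite /Vol0 /Vol expr0 expr1; ring. Qed.

End Decomposition.

Section Cross.
Context {R : realType}.
Context {d} {T : measurableType d} (P : probability T R).
Variables (M : nat -> R -> {RV P >-> R}) (v0 : nat -> {RV P >-> R}).
Hypothesis v00 : forall i w, 0 <= v0 i w.
Hypothesis indep : independent_sigma P (fun k : (nat + nat)%type =>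
    match k with
    | inl i => sigma_process (M i)
    | inr i => g_sigma_algebra_preimage (v0 i)
    end).

Lemma indep_process_start i E F : sigma_process (M i) E -> g_sigma_algebra_preimage (v0 i) F ->
  P (E `&` F) = (P E * P F)%E.
Proof.
move=> HE HF; have := indep (J := [:: inl i; inr i]) (E := fun k => if k is inl _ then E else F) isT.
rewrite !big_cons big_nil mule1 => <-; last first.
  by move=> k; rewrite !inE => /orP[] /eqP ->.
congr (P _); apply/seteqP; split => [w [H1 H2] k|w H].
  by rewrite /= !inE => /orP[] /eqP ->.
by split; [apply: (H (inl i))|apply: (H (inr i))]; rewrite /= !inE eqxx ?orbT.
Qed.

Variables (i j : nat).
Hypothesis ij : i <> j.

Lemma integral_cross (X1 X2 : T -> R) n1 n2 :
  (forall B, measurable B -> sigma_process (M i) (X1 @^-1` B)) ->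
  (forall B, measurable B -> sigma_process (M j) (X2 @^-1` B)) ->
  measurable_fun setT X1 -> measurable_fun setT X2 ->
  (forall w, 0 <= X1 w) -> (forall w, 0 <= X2 w) ->
  (\int[P]_w (X1 w)%:E < +oo)%E -> (\int[P]_w (X2 w)%:E < +oo)%E ->
  (\int[P]_w (v0 i w ^+ n1)%:E < +oo)%E -> (\int[P]_w (v0 j w ^+ n2)%:E < +oo)%E ->
  (\int[P]_w (X1 w * v0 i w ^+ n1 * (X2 w * v0 j w ^+ n2))%:E =
   (\int[P]_w (X1 w)%:E * \int[P]_w (v0 i w ^+ n1)%:E) *
   (\int[P]_w (X2 w)%:E * \int[P]_w (v0 j w ^+ n2)%:E))%E.
Proof.
move=> s1 s2 m1 m2 X10 X20 F1 F2 G1 G2.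
have ji : (j == i) = false by apply/negbTE/eqP => /esym.
pose f (k : nat + nat) : T -> R := match k with
  | inl a => if a == i then X1 else X2
  | inr a => if a == i then (fun w => v0 i w ^+ n1) else (fun w => v0 j w ^+ n2) end.
pose J : seq (nat + nat) := [:: inl i; inr i; inl j; inr j].
have uJ : uniq J.
  have e1 : (inl i == inl j :> nat + nat) = false by apply/negbTE/eqP => -[].
  have e2 : (inr i == inr j :> nat + nat) = false by apply/negbTE/eqP => -[].
  by rewrite /J /= !inE e1 e2.
have := @integral_prod_indep _ _ _ P (nat + nat)%type J f uJ.
rewrite /J !big_cons !big_nil/= !eqxx !ji mule1 muleA => <-; last first.
- move=> B mB; apply: (indep (J := J) (E := fun k => f k @^-1` B k)) => // k.
  by rewrite /J !inE => /or4P[] /eqP-> /=; rewrite ?eqxx ?ji; [exact: s1|exact: sigma_v0|exact: s2|exact: sigma_v0].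
- by move=> k; rewrite !inE => /or4P[] /eqP-> /=; rewrite ?eqxx ?ji.
- by case=> a w /=; case: ifP => _ //; exact: exprn_ge0.
- by case=> a /=; case: ifP => _ //; apply: measurable_funX; exact: measurable_funPT.
by apply: eq_integral => w _; rewrite !big_cons big_nil/= !eqxx !ji mulr1 !mulrA.
Qed.

End Cross.

Section CrossCogarch.
Context {R : realType}.
Context {d0} {T0 : measurableType d0} (P0 : probability T0 R) (L : R -> {RV P0 >-> R}).
Context (nuL : {measure set R -> \bar R}).
Hypothesis levyL : levy_process L.
Hypothesis nuLE : levy_measure L nuL.
Variables (beta eta : R).
Hypotheses (beta0 : 0 < beta) (eta0 : 0 < eta).
Context {d} {T : measurableType d} (P : probability T R).
Variables (M : nat -> R -> {RV P >-> R}) (v0 : nat -> {RV P >-> R}) (phi : nat -> R).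
Hypothesis copies : forall i, levy_copy L (M i).
Hypothesis v00 : forall i w, 0 <= v0 i w.
Hypothesis indep : independent_sigma P (fun k : (nat + nat)%type =>
    match k with
    | inl i => sigma_process (M i)
    | inr i => g_sigma_algebra_preimage (v0 i)
    end).

Let levyM i : levy_process (M i) := proj1 (copies i).

Lemma integral_YM_lty i t : 0 <= t -> Phi_L_kappa beta eta L nuL 2 (phi i) ->
  (\int[P]_w (YM (M i) eta (phi i) w t)%:E < +oo)%E.
Proof.
move=> t0 /(kappa2_facts levyL nuLE beta0 eta0)[x0 Hphi mf _ _].
have finL := levy_copy_finite_jumps levyL nuLE (levy_copy_refl levyL) Hphi.
have finM := levy_copy_finite_jumps levyL nuLE (copies i) Hphi.
pose u (n : nat) := (if n is 0%N then 0 else t).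
have um : {homo u : m n / (m <= n)%N >-> m <= n} by move=> [|k] [|l].
have := moment_Y (levyM i) levyL (levy_copy_marg (copies i)) finM finL eta x0
  (gam_rate1 levyL finL x0 mf) (K := 1%N) (e := fun=> 1%N) (lexx 0 : 0 <= u 0%N) um (fun _ _ => leqnn 1).
rewrite big_nat1 => H.
have -> : (\int[P]_w (YM (M i) eta (phi i) w t)%:E = (expR (rate eta (grate L (phi i)) 1 * (u 1%N - u 0%N)))%:E)%E.
  by rewrite -H; apply: eq_integral => w _; rewrite big_nat1 expr1 /= Yp_0 divr1.
by rewrite ltry.
Qed.

Variables (i j : nat) (s t : R).
Hypothesis ij : i <> j.
Hypotheses (s0 : 0 <= s) (t0 : 0 <= t).
Hypothesis Hi : Phi_L_kappa beta eta L nuL 2 (phi i).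
Hypothesis Hj : Phi_L_kappa beta eta L nuL 2 (phi j).
Hypothesis stati : stationary_law beta eta L (phi i) P (v0 i).
Hypothesis statj : stationary_law beta eta L (phi j) P (v0 j).

Let V k := cogarch beta eta (phi k) (v0 k) (M k).

(** Splitting each volatility by [Vol_split] gives four products, each of which factors because two
    processes and two starting variables with different indices are independent. Resumming yields
    the product of the means. *)
Lemma integral_cogarch_cross :
  (\int[P]_w (V i s w * V j t w)%:E = (statmean L beta eta (phi i) * statmean L beta eta (phi j))%:E)%E.
Proof.
have x0i : 0 <= phi i by case: Hi.
have x0j : 0 <= phi j by case: Hj.
pose A k r w := YM (M k) eta (phi k) w r.
pose B k r w := Vol0 (M k) beta eta (phi k) r w.
have VE k r w : V k r w = A k r w * v0 k w ^+ 1 + B k r w * v0 k w ^+ 0.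
  by rewrite /V (cogarchE beta eta) Vol_split.
have A0 k r w : 0 <= A k r w by rewrite ltW// YM_gt0.
have B0 k r w : 0 <= B k r w by exact: Vol0_ge0.
have v0n k n w : 0 <= v0 k w ^+ n by exact: exprn_ge0.
have props k r : 0 <= phi k -> [/\ measurable_fun setT (A k r), measurable_fun setT (B k r),
    (forall C, measurable C -> sigma_process (M k) (A k r @^-1` C)) &
    (forall C, measurable C -> sigma_process (M k) (B k r @^-1` C))].
  move=> x0; split.
  - exact: (measurableT_comp (measurable_YM2 (levyM k) eta x0)
      (measurable_fun_pair (@measurable_id _ _ _) (measurable_cst r))).
  - exact: measurable_Vol0.
  - by apply: sigma_process_preimage; exact: sigma_YM.
  - by apply: sigma_process_preimage; exact: sigma_Vol0.
have [mAi mBi sAi sBi] := props i s x0i.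
have [mAj mBj sAj sBj] := props j t x0j.
have mv k n : measurable_fun setT (fun w => v0 k w ^+ n) by apply: measurable_funX; exact: measurable_funPT.
have EV k r : 0 <= r -> 0 <= phi k -> Phi_L_kappa beta eta L nuL 2 (phi k) ->
    stationary_law beta eta L (phi k) P (v0 k) ->
    (\int[P]_w (V k r w)%:E = (statmean L beta eta (phi k))%:E)%E.
  move=> r0 x0 Hk statk.
  by have [] := E_cogarch_prod levyL nuLE beta0 eta0 (copies k) (v00 k)
    (indep_process_start indep (i := k)) statk x0 Hk r0 (lexx r).
have Ev k : 0 <= phi k -> Phi_L_kappa beta eta L nuL 2 (phi k) ->
    stationary_law beta eta L (phi k) P (v0 k) -> forall n, (n <= 1)%N -> (\int[P]_w (v0 k w ^+ n)%:E < +oo)%E.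
  move=> x0 Hk statk [|[|]]// _; first by under eq_integral do rewrite expr0; rewrite integral_one ltry.
  under eq_integral do rewrite expr1.
  by rewrite (integral_v0 levyL beta0 (v00 k) statk x0) (kappa2_mean levyL nuLE beta0 eta0 x0 Hk) ltry.
have split_E k r : 0 <= r -> 0 <= phi k -> Phi_L_kappa beta eta L nuL 2 (phi k) ->
    stationary_law beta eta L (phi k) P (v0 k) ->
    (\int[P]_w (B k r w)%:E < +oo /\ (\int[P]_w (A k r w)%:E * \int[P]_w (v0 k w ^+ 1)%:E +
     \int[P]_w (B k r w)%:E * \int[P]_w (v0 k w ^+ 0)%:E = (statmean L beta eta (phi k))%:E))%E.
  move=> r0 x0 Hk statk; have [mA mB sA sB] := props k r x0.
  (* [B] is dominated by [V], whose mean is finite. *)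
  have Boo : (\int[P]_w (B k r w)%:E < +oo)%E.
    apply: le_lt_trans (ltry (statmean L beta eta (phi k))); rewrite -(EV k r)//.
    apply: ge0_le_integral => //.
    - by move=> w _; rewrite lee_fin.
    - exact/measurable_EFinP.
    - by apply/measurable_EFinP; apply: measurable_cogarch.
    - by move=> w _; rewrite lee_fin VE expr0 mulr1 lerDr mulr_ge0.
  split => //; rewrite -(EV k r)//.
  have I2 (X : T -> R) n : measurable_fun (setT : set (process_type (fun t => M k t : T -> R))) X ->
      measurable_fun setT X -> (forall w, 0 <= X w) -> (\int[P]_w (X w)%:E < +oo)%E -> (n <= 1)%N ->
      (\int[P]_w (X w)%:E * \int[P]_w (v0 k w ^+ n)%:E = \int[P]_w (X w * v0 k w ^+ n)%:E)%E.
    move=> sX mX X0 Xoo n1; rewrite muleC.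
    rewrite -(integral_indep2 (v00 k) (indep_process_start indep (i := k)) sX mX X0 Xoo)//; last exact: Ev.
    by apply: eq_integral => w _; rewrite mulrC.
  rewrite (I2 (A k r) 1%N (@sigma_YM _ _ _ _ (M k) (levyM k) eta (phi k) x0 r) mA (A0 k r) (integral_YM_lty r0 Hk) (leqnn 1)).
  rewrite (I2 (B k r) 0%N (@sigma_Vol0 _ _ _ _ (M k) (levyM k) beta eta (phi k) x0 r) mB (B0 k r) Boo (leq0n 1)).
  rewrite -ge0_integralD//.
  - by apply: eq_integral => w _; rewrite VE EFinD.
  - by move=> w _; rewrite lee_fin mulr_ge0.
  - by apply/measurable_EFinP; exact: measurable_funM.
  - by move=> w _; rewrite lee_fin mulr_ge0.
  - by apply/measurable_EFinP; exact: measurable_funM.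
have [Bi Ei] := split_E i s s0 x0i Hi stati.
have [Bj Ej] := split_E j t t0 x0j Hj statj.
have Ai : (\int[P]_w (A i s w)%:E < +oo)%E by exact: integral_YM_lty s0 Hi.
have Aj : (\int[P]_w (A j t w)%:E < +oo)%E by exact: integral_YM_lty t0 Hj.
have vi := Ev i x0i Hi stati; have vj := Ev j x0j Hj statj.
rewrite EFinM -Ei -Ej; clear Ei Ej props split_E; clearbody A B.
(* The boolean selects the coefficient and, read as 0 or 1, is also the exponent of the starting
   variable. *)
pose X1 (b : bool) := if b then A i s else B i s.
pose X2 (b : bool) := if b then A j t else B j t.
have P1 b : [/\ forall C, measurable C -> sigma_process (M i) (X1 b @^-1` C),
    measurable_fun setT (X1 b), forall w, 0 <= X1 b w & (\int[P]_w (X1 b w)%:E < +oo)%E].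
  case: b; [exact: (And4 sAi mAi (@A0 i s) Ai)|exact: (And4 sBi mBi (@B0 i s) Bi)].
have P2 b : [/\ forall C, measurable C -> sigma_process (M j) (X2 b @^-1` C),
    measurable_fun setT (X2 b), forall w, 0 <= X2 b w & (\int[P]_w (X2 b w)%:E < +oo)%E].
  case: b; [exact: (And4 sAj mAj (@A0 j t) Aj)|exact: (And4 sBj mBj (@B0 j t) Bj)].
have IC b c : (\int[P]_w (X1 b w * v0 i w ^+ b * (X2 c w * v0 j w ^+ c))%:E =
   (\int[P]_w (X1 b w)%:E * \int[P]_w (v0 i w ^+ b)%:E) *
   (\int[P]_w (X2 c w)%:E * \int[P]_w (v0 j w ^+ c)%:E))%E.
  have [sX mX X0 Xoo] := P1 b; have [sX' mX' X0' Xoo'] := P2 c.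
  exact: (integral_cross v00 indep ij sX sX' mX mX' X0 X0' Xoo Xoo' (vi _ (leq_b1 b)) (vj _ (leq_b1 c))).
have mW b c : measurable_fun setT (fun w => (X1 b w * v0 i w ^+ b * (X2 c w * v0 j w ^+ c))%:E).
  have [_ mX _ _] := P1 b; have [_ mX' _ _] := P2 c.
  apply/measurable_EFinP; apply: measurable_funM; apply: measurable_funM => //; exact: mv.
have W0 b c w : (0 <= (X1 b w * v0 i w ^+ b * (X2 c w * v0 j w ^+ c))%:E)%E.
  have [_ _ X0 _] := P1 b; have [_ _ X0' _] := P2 c.
  by rewrite lee_fin mulr_ge0// mulr_ge0.
have e0 k (X : T -> R) n : (forall w, 0 <= X w) -> (0 <= \int[P]_w (X w)%:E * \int[P]_w (v0 k w ^+ n)%:E)%E.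
  by move=> X0; rewrite mule_ge0//; apply: integral_ge0 => w _; rewrite lee_fin.
pose W b c w := X1 b w * v0 i w ^+ b * (X2 c w * v0 j w ^+ c).
transitivity (\int[P]_w (W true true w)%:E + \int[P]_w (W true false w)%:E +
    (\int[P]_w (W false true w)%:E + \int[P]_w (W false false w)%:E))%E; last first.
  have D (a b c e : \bar R) : (0 <= a -> 0 <= b -> 0 <= c -> 0 <= e ->
      (a + b) * (c + e) = a * c + a * e + (b * c + b * e))%E.
    by move=> a0 b0 c0 e0'; rewrite ge0_muleDl ?adde_ge0// !ge0_muleDr.
  have D' := D _ _ _ _ (e0 i (A i s) 1%N (@A0 i s)) (e0 i (B i s) 0%N (@B0 i s))
    (e0 j (A j t) 1%N (@A0 j t)) (e0 j (B j t) 0%N (@B0 j t)).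
  rewrite D'; congr (_ + _ + (_ + _))%E;
    [exact: (IC true true)|exact: (IC true false)|exact: (IC false true)|exact: (IC false false)].
have DD : forall f1 f2 : T -> \bar R, measurable_fun setT f1 -> measurable_fun setT f2 ->
    (forall w, 0 <= f1 w)%E -> (forall w, 0 <= f2 w)%E ->
    (\int[P]_w f1 w + \int[P]_w f2 w = \int[P]_w (f1 w + f2 w))%E.
  by move=> f1 f2 mf1 mf2 f10 f20; rewrite ge0_integralD.
rewrite (DD _ _ (mW true true) (mW true false) (W0 true true) (W0 true false)).
rewrite (DD _ _ (mW false true) (mW false false) (W0 false true) (W0 false false)).
rewrite DD.
- by apply: eq_integral => w _; rewrite !VE /X1 /X2 -!EFinD; congr EFin; rewrite /=; ring.
- by apply: emeasurable_funD; [exact: (mW true true)|exact: (mW true false)].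
- by apply: emeasurable_funD; [exact: (mW false true)|exact: (mW false false)].
- by move=> w; rewrite adde_ge0.
- by move=> w; rewrite adde_ge0.
Qed.

End CrossCogarch.

(** * Covariance of two series with uncorrelated off-diagonal terms *)

Section CovarianceSeries.
Context {R : realType} {d : measure_display} {T : measurableType d} (P : probability T R).
Local Open Scope ereal_scope.

Lemma integral_series (X : nat -> T -> R) : (forall i, measurable_fun setT (X i)) ->
  (forall i w, 0 <= X i w)%R ->
  \int[P]_w (\sum_(0 <= i <oo) (X i w)%:E) = \sum_(0 <= i <oo) \int[P]_w (X i w)%:E.
Proof.
move=> mX X0; rewrite integral_nneseries// => [i|i w _]; last by rewrite lee_fin.
exact/measurable_EFinP.
Qed.

Variables (X Y : nat -> T -> R) (a b : nat -> R).
Hypotheses (mX : forall i, measurable_fun setT (X i)) (mY : forall i, measurable_fun setT (Y i)).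
Hypotheses (X0 : forall i w, (0 <= X i w)%R) (Y0 : forall i w, (0 <= Y i w)%R).
Hypotheses (a0 : forall i, (0 <= a i)%R) (b0 : forall i, (0 <= b i)%R).
Hypothesis aoo : \sum_(0 <= i <oo) (a i)%:E < +oo.
Hypothesis EX : forall i, \int[P]_w (X i w)%:E = (a i)%:E.
Hypothesis EY : forall i, \int[P]_w (Y i w)%:E = (a i)%:E.
Hypothesis EXY : forall i j, \int[P]_w (X i w * Y j w)%:E =
  (a i * a j + (if i == j then b i else 0))%:E.

Lemma ae_series_fin (Z : nat -> T -> R) : (forall i, measurable_fun setT (Z i)) ->
  (forall i w, 0 <= Z i w)%R -> (forall i, \int[P]_w (Z i w)%:E = (a i)%:E) ->
  {ae P, forall w, \sum_(0 <= i <oo) (Z i w)%:E \is a fin_num}.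
Proof.
move=> mZ Z0 EZ.
have mS : measurable_fun setT (fun w => \sum_(0 <= i <oo) (Z i w)%:E).
  by apply: (ge0_emeasurable_sum (P := xpredT)) => [k w _ _|k _]; [rewrite lee_fin|exact/measurable_EFinP].
have S0 w : 0 <= \sum_(0 <= i <oo) (Z i w)%:E by apply: nneseries_ge0 => i _ _; rewrite lee_fin.
have : {ae P, forall w, setT w -> \sum_(0 <= i <oo) (Z i w)%:E \is a fin_num}.
  apply: integrable_ae => //; apply/integrableP; split => //.
  rewrite (eq_integral (fun w => \sum_(0 <= i <oo) (Z i w)%:E)); last by move=> w _; rewrite gee0_abs.
  by rewrite integral_series//; under eq_eseriesr do rewrite EZ.
by apply: filterS => w; apply.
Qed.

(** By Tonelli the mean of the product is the double series, whose row [i] sums to [a i] times A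
    plus [b i], where A is the sum of the means. The total is A^2 plus the sum of the [b i], which
    may be infinite. *)
Lemma covariance_series :
  covariance P (fine \o (fun w => \sum_(0 <= i <oo) (X i w)%:E))
               (fine \o (fun w => \sum_(0 <= i <oo) (Y i w)%:E)) =
  \sum_(0 <= i <oo) (b i)%:E.
Proof.
have S0 (Z : nat -> T -> R) w : (forall i w, 0 <= Z i w)%R -> 0 <= \sum_(0 <= i <oo) (Z i w)%:E.
  by move=> Z0; apply: nneseries_ge0 => i _ _; rewrite lee_fin.
have mS (Z : nat -> T -> R) : (forall i, measurable_fun setT (Z i)) -> (forall i w, 0 <= Z i w)%R ->
    measurable_fun setT (fine \o (fun w => \sum_(0 <= i <oo) (Z i w)%:E)).
  move=> mZ Z0; apply: measurableT_comp; first exact: fine_measurable.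
  by apply: (ge0_emeasurable_sum (P := xpredT)) => [k w _ _|k _]; [rewrite lee_fin|exact/measurable_EFinP].
have ES (Z : nat -> T -> R) : (forall i, measurable_fun setT (Z i)) ->
    (forall i w, 0 <= Z i w)%R -> (forall i, \int[P]_w (Z i w)%:E = (a i)%:E) ->
    \int[P]_w (fine (\sum_(0 <= i <oo) (Z i w)%:E))%:E = \sum_(0 <= i <oo) (a i)%:E.
  move=> mZ Z0 EZ; transitivity (\int[P]_w \sum_(0 <= i <oo) (Z i w)%:E).
    by apply: ae_integral; apply: filterS (ae_series_fin mZ Z0 EZ) => w fw _; rewrite fineK.
  by rewrite integral_series//; apply: eq_eseriesr => i _; exact: EZ.
set A := \sum_(0 <= i <oo) (a i)%:E.
have A0 : 0 <= A by apply: nneseries_ge0 => i _ _; rewrite lee_fin.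
have Af : A \is a fin_num by rewrite ge0_fin_numE.
rewrite covariance_nneg; first last.
- by rewrite /= ES.
- by rewrite /= ES.
- by move=> w; apply: fine_ge0; exact: S0.
- by move=> w; apply: fine_ge0; exact: S0.
- exact: mS.
- exact: mS.
rewrite /= !ES// -/A.
have -> : \int[P]_w (fine (\sum_(0 <= i <oo) (X i w)%:E) * fine (\sum_(0 <= i <oo) (Y i w)%:E))%:E =
    \int[P]_w \sum_(0 <= i <oo) \sum_(0 <= j <oo) (X i w * Y j w)%:E.
  apply: ae_integral; apply: filterS2 (ae_series_fin mX X0 EX) (ae_series_fin mY Y0 EY) => w fX fY _.
  rewrite EFinM (fineK fX) muleC -nneseriesZl; last by move=> i _; rewrite lee_fin.
  apply: eq_eseriesr => i _; rewrite (fineK fY) muleC -nneseriesZl; last by move=> j _; rewrite lee_fin.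
  by apply: eq_eseriesr => j _; rewrite EFinM.
have XY0 i j w : 0 <= (X i w * Y j w)%:E by rewrite lee_fin mulr_ge0.
have mXY i j : measurable_fun setT (fun w => (X i w * Y j w)%:E).
  by apply/measurable_EFinP; exact: measurable_funM.
rewrite integral_nneseries//; first last.
- by move=> i w _; apply: nneseries_ge0 => j _ _.
- by move=> i; apply: (ge0_emeasurable_sum (P := xpredT)) => // j w _ _.
have E i : \int[P]_w (\sum_(0 <= j <oo) (X i w * Y j w)%:E) = (a i)%:E * A + (b i)%:E.
  rewrite integral_nneseries//.
  under eq_eseriesr do rewrite EXY EFinD EFinM.
  rewrite nneseriesD; last 2 first.
  - by move=> j _ _; rewrite -EFinM lee_fin mulr_ge0.
  - by move=> j _ _; rewrite lee_fin; case: ifP.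
  congr (_ + _); first by rewrite nneseriesZl// => j _; rewrite lee_fin.
  rewrite (@nneseriesD1 _ _ i)//; last by move=> j _; rewrite lee_fin; case: ifP.
  rewrite eqxx eseries0 ?adde0// => j _ /= /negbTE ji.
  by rewrite eq_sym ji.
under eq_eseriesr do rewrite E.
rewrite nneseriesD; last 2 first.
- by move=> i _ _; rewrite mule_ge0// lee_fin.
- by move=> i _ _; rewrite lee_fin.
have -> : \sum_(0 <= i <oo) ((a i)%:E * A) = A * A.
  rewrite -{1}(fineK Af); under eq_eseriesr do rewrite muleC.
  by rewrite nneseriesZl ?fineK// => i _; rewrite lee_fin.
(* A^2 cancels because A is finite. *)
rewrite addeAC subee ?add0e// fin_numM//.
Qed.

End CovarianceSeries.

(** * Moments of the superposition *)

Section SupCogarch.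
Context {R : realType}.
Context {d0} {T0 : measurableType d0} (P0 : probability T0 R) (L : R -> {RV P0 >-> R}).
Context (nuL : {measure set R -> \bar R}).
Hypothesis levyL : levy_process L.
Hypothesis nuLE : levy_measure L nuL.
Variables (beta eta : R).
Hypotheses (beta0 : 0 < beta) (eta0 : 0 < eta).
Variables (p phi : nat -> R) (mix : probability R R).
Hypothesis p_ge0 : forall i, 0 <= p i.
Hypothesis phi_ge0 : forall i, 0 <= phi i.
Hypothesis mixE : forall A : set R, measurable A ->
  mix A = (\sum_(0 <= i <oo) ((p i)%:E * \d_(phi i) A))%E.
Context {d} {T : measurableType d} (P : probability T R).
Variables (M : nat -> R -> {RV P >-> R}) (v0 : nat -> {RV P >-> R}).
Hypothesis copies : forall i, levy_copy L (M i).
Hypothesis v00 : forall i w, 0 <= v0 i w.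
Hypothesis indep : independent_sigma P (fun k : (nat + nat)%type =>
    match k with
    | inl i => sigma_process (M i)
    | inr i => g_sigma_algebra_preimage (v0 i)
    end).
Hypothesis stat : forall i, 0 < p i -> stationary_law beta eta L (phi i) P (v0 i).

Local Notation V i := (cogarch beta eta (phi i) (v0 i) (M i)).
Local Notation m i := (statmean L beta eta (phi i)).
Local Notation mu1 := (mean1 L 1).

Let V0 i t w : 0 <= V i t w.
Proof. exact: cogarch_ge0. Qed.

Let mV i t : measurable_fun setT (V i t).
Proof. exact: (measurable_cogarch beta eta (v0 i) (copies i) (phi_ge0 i) t). Qed.

Let pV0 i t w : 0 <= p i * V i t w. Proof. exact: mulr_ge0. Qed.

Let mpV i t : measurable_fun setT (fun w => p i * V i t w).
Proof. exact: measurable_funM. Qed.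

(** The mixing measure and the stationarity assumption give information only at indices of positive
    weight; the others enter with factor 0. *)
Let p_case i : p i = 0 \/ 0 < p i.
Proof. by move: (p_ge0 i); rewrite le_eqVlt => /predU1P[<-|]; [left|right]. Qed.

Let scaled_mean i t : (0 < p i -> (\int[P]_w (V i t w)%:E = (m i)%:E)%E) ->
  (\int[P]_w (p i * V i t w)%:E = (p i * m i)%:E)%E.
Proof.
case: (p_case i) => [-> _|pi /(_ pi) H].
  by under eq_integral do rewrite mul0r; rewrite integral0 mul0r.
under eq_integral do rewrite EFinM.
rewrite ge0_integralZl_EFin//; last 2 first.
- by move=> w _; rewrite lee_fin.
- exact/measurable_EFinP.
by rewrite H.
Qed.

Section Mean.
Hypothesis mix1 : mix (Phi_L_kappa beta eta L nuL 1) = 1%E.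

Let K1 i : 0 < p i -> Phi_L_kappa beta eta L nuL 1 (phi i).
Proof. exact: (mix_support p_ge0 mixE (measurable_Phi_L_kappa L nuL beta eta _) mix1). Qed.

Lemma integral_supcogarch t : 0 <= t ->
  (\int[P]_w supcogarch1 beta eta p phi v0 M t w = \sum_(0 <= i <oo) (p i * m i)%:E)%E.
Proof.
move=> t0; rewrite (integral_series P (fun i => mpV i t) (fun i => pV0 i t)).
apply: eq_eseriesr => i _; apply: scaled_mean => pi.
exact: (E_cogarch levyL nuLE beta0 eta0 (copies i) (v00 i) (indep_process_start indep (i := i))
  (stat pi) (phi_ge0 i) (K1 pi) t0).
Qed.

Lemma integral_mix_mean :
  (\int[mix]_(x in Phi_L eta nuL) \int[P0]_w Vinf beta eta L x w = \sum_(0 <= i <oo) (p i * m i)%:E)%E.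
Proof.
have mK : measurable (Phi_L_kappa beta eta L nuL 1) := measurable_Phi_L_kappa L nuL beta eta 1.
(* A measurable nonnegative function on the whole line that agrees with [statmean] where eta - x mu1
   > 0, hence on the set of full measure [Phi_L_kappa] of order 1. *)
pose g (x : R) := beta * expR (- ln (eta - x * mu1)).
have gE x : Phi_L_kappa beta eta L nuL 1 x -> g x = statmean L beta eta x.
  move=> /(kappa1_facts levyL nuLE beta0 eta0)[_ _ _ _ H].
  by rewrite /g expRN lnK// posrE subr_gt0.
have null : mix (~` Phi_L_kappa beta eta L nuL 1) = 0%E by rewrite probability_setC// mix1 subee.
transitivity (\int[mix]_(x in Phi_L eta nuL) (g x)%:E)%E.
  apply: ae_integral; exists (~` Phi_L_kappa beta eta L nuL 1); split.
  - exact: measurableC.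
  - exact: null.
  move=> x /= /not_implyP[_ H] Kx; apply: H.
  by rewrite (integral_Vinf_kappa1 levyL nuLE beta0 eta0 Kx) gE.
have mg : measurable_fun setT g.
  apply: measurable_funM => //; apply: (measurableT_comp (@measurable_expR R)).
  apply: measurableT_comp => //; apply: measurableT_comp; first exact: measurable_ln.
  by apply: measurable_funB => //; exact: measurable_funM.
rewrite (integral_mix p_ge0 mixE (measurable_Phi_L nuL eta)); first last.
- by move=> x _; rewrite lee_fin mulr_ge0 ?ltW// expR_gt0.
- by apply: measurable_funTS; exact/measurable_EFinP.
apply: eq_eseriesr => i _; case: (p_case i) => [->|pi]; first by rewrite mul0e mul0r.
have [_ Hi _ _ _] := kappa1_facts levyL nuLE beta0 eta0 (K1 pi).
by rewrite diracE mem_set// mul1e gE ?EFinM//; exact: K1.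
Qed.

Lemma sum_mean_explicit : (\sum_(0 <= i <oo) (p i * m i)%:E =
  beta%:E * \sum_(0 <= i <oo) (p i / (eta - phi i * mu1))%:E)%E.
Proof.
rewrite -nneseriesZl => [|i _].
  by apply: eq_eseriesr => i _; rewrite -EFinM /statmean mulrCA.
case: (p_case i) => [->|pi]; first by rewrite mul0r.
have [_ _ _ _ H] := kappa1_facts levyL nuLE beta0 eta0 (K1 pi).
by rewrite lee_fin divr_ge0// subr_ge0 ltW.
Qed.

End Mean.

Section Covariance.
Hypothesis mix2 : mix (Phi_L_kappa beta eta L nuL 2) = 1%E.

Let K2 i : 0 < p i -> Phi_L_kappa beta eta L nuL 2 (phi i).
Proof. exact: (mix_support p_ge0 mixE (measurable_Phi_L_kappa L nuL beta eta _) mix2). Qed.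

Let m0 i : 0 < p i -> 0 <= m i.
Proof.
move=> /K2/(kappa2_facts levyL nuLE beta0 eta0)[_ _ _ _ [H _]].
by rewrite /statmean divr_ge0 ?ltW// subr_gt0.
Qed.

Let pm0 i : 0 <= p i * m i.
Proof. by case: (p_case i) => [->|pi]; [rewrite mul0r|rewrite mulr_ge0// m0]. Qed.

(** The means are bounded by [statmean_bound] and the weights sum to 1. An index of positive weight
    supplies the required moments of S_1. *)
Let sum_mean_lty : (\sum_(0 <= i <oo) (p i * m i)%:E < +oo)%E.
Proof.
have [i pi] : exists i, 0 < p i.
  apply: contrapT => H; have := sum_mix mixE.
  rewrite eseries0 => [/eqP|i _ _]; first by rewrite eq_sym onee_eq0.
  by case: (p_case i) => [->//|pi]; case: H; exists i.
have [_ Hphi mf m2f _] := kappa2_facts levyL nuLE beta0 eta0 (K2 pi).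
have finL := levy_copy_finite_jumps levyL nuLE (levy_copy_refl levyL) Hphi.
have [K K0 HK] := statmean_bound levyL finL mf m2f eta0 beta0.
apply: (@le_lt_trans _ _ (\sum_(0 <= i <oo) (K%:E * (p i)%:E))%E).
  apply: lee_nneseries => [j _ _|j _]; first by rewrite lee_fin.
  rewrite -EFinM lee_fin; case: (p_case j) => [->|pj]; first by rewrite mul0r mulr0.
  have [xj _ _ _ [H1 H2]] := kappa2_facts levyL nuLE beta0 eta0 (K2 pj).
  by rewrite mulrC ler_wpM2r// HK.
rewrite nneseriesZl; last by move=> j _; rewrite lee_fin.
by rewrite (sum_mix mixE) mule1 ltry.
Qed.

Let b h i : R := p i ^+ 2 *
  (expR (h * (phi i * mu1 - eta)) * (statmean2 L beta eta (phi i) - m i ^+ 2)).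

Let b0 h i : 0 <= b h i.
Proof.
rewrite /b; case: (p_case i) => [->|pi]; first by rewrite expr0n mul0r.
rewrite mulr_ge0 ?sqr_ge0// mulr_ge0 ?expR_ge0//.
rewrite (statvarE levyL nuLE beta0 eta0 (K2 pi)).
have [_ Hphi mf m2f [H1 H2]] := kappa2_facts levyL nuLE beta0 eta0 (K2 pi).
have finL := levy_copy_finite_jumps levyL nuLE (levy_copy_refl levyL) Hphi.
have v0' := var1_ge0 levyL finL mf m2f.
apply: divr_ge0.
  by apply: mulr_ge0 => //; apply: mulr_ge0; exact: sqr_ge0.
apply: mulr_ge0; first exact: sqr_ge0.
lra.
Qed.

Let meanV i t : 0 <= t -> (\int[P]_w (p i * V i t w)%:E = (p i * m i)%:E)%E.
Proof.
move=> t0; apply: scaled_mean => pi.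
by have [] := E_cogarch_prod levyL nuLE beta0 eta0 (copies i) (v00 i)
  (indep_process_start indep (i := i)) (stat pi) (phi_ge0 i) (K2 pi) t0 (lexx t).
Qed.

(** The diagonal comes from [E_cogarch_prod], the rest from [integral_cogarch_cross]; the shape is
    the one [covariance_series] takes. *)
Let meanVV i j t h : 0 <= t -> 0 <= h ->
  (\int[P]_w (p i * V i t w * (p j * V j (t + h) w))%:E =
   (p i * m i * (p j * m j) + (if i == j then b h i else 0))%:E)%E.
Proof.
move=> t0 h0; have th0 : 0 <= t + h by rewrite addr_ge0.
have tth : t <= t + h by rewrite lerDl.
case: (p_case i) => [pi|pi].
  rewrite /b pi expr0n !mul0r add0r if_same.
  by under eq_integral do rewrite !mul0r; rewrite integral0.
case: (p_case j) => [pj|pj].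
  under eq_integral do rewrite pj mul0r mulr0.
  rewrite integral0 pj mul0r mulr0 add0r; case: eqP => // ij.
  by move: pi; rewrite ij pj ltxx.
have -> : (\int[P]_w (p i * V i t w * (p j * V j (t + h) w))%:E =
    (p i * p j)%:E * \int[P]_w (V i t w * V j (t + h) w)%:E)%E.
  rewrite -ge0_integralZl_EFin ?mulr_ge0//.
  - by apply: eq_integral => w _; rewrite -EFinM mulrACA.
  - by move=> w _; rewrite lee_fin mulr_ge0.
  - by apply/measurable_EFinP; exact: measurable_funM.
case: eqP => [ij|ij].
  rewrite -ij.
  have [_ ->] := E_cogarch_prod levyL nuLE beta0 eta0 (copies i) (v00 i)
    (indep_process_start indep (i := i)) (stat pi) (phi_ge0 i) (K2 pi) t0 tth.
  have -> : t + h - t = h by rewrite addrC addKr.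
  by rewrite -EFinM /b; congr EFin; ring.
rewrite (integral_cogarch_cross levyL nuLE beta0 eta0 copies v00 indep ij t0 th0 (K2 pi) (K2 pj)
  (stat pi) (stat pj)).
by rewrite -EFinM addr0 mulrACA.
Qed.

Lemma covariance_start i h : 0 < p i -> 0 <= h ->
  covariance P (v0 i) (V i h) =
  (expR (h * (phi i * mu1 - eta)) * (statmean2 L beta eta (phi i) - m i ^+ 2))%:E.
Proof.
move=> pi h0; have := covariance_cogarch levyL nuLE beta0 eta0 (copies i) (v00 i)
  (indep_process_start indep (i := i)) (stat pi) (phi_ge0 i) (K2 pi) (lexx 0) h0.
rewrite subr0 => <-; congr covariance.
by apply/funext => w; rewrite cogarch0.
Qed.

Lemma covariance_supcogarch t h : 0 <= t -> 0 <= h ->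
  (covariance P (fine \o supcogarch1 beta eta p phi v0 M t)
              (fine \o supcogarch1 beta eta p phi v0 M (t + h)%R) =
   \sum_(0 <= i <oo) ((p i ^+ 2)%:E * covariance P (v0 i) (V i h)))%E.
Proof.
move=> t0 h0; have th0 : 0 <= t + h by rewrite addr_ge0.
have := covariance_series (fun i => mpV i t) (fun i => mpV i (t + h)) (fun i => pV0 i t)
  (fun i => pV0 i (t + h)) pm0 (b0 h) sum_mean_lty (fun i => meanV i t0) (fun i => meanV i th0)
  (fun i j => meanVV i j t0 h0).
move=> ->; apply: eq_eseriesr => i _; rewrite /b.
case: (p_case i) => [->|pi]; first by rewrite expr0n mul0r mul0e.
by rewrite EFinM covariance_start.
Qed.

Lemma variance_supcogarch t : 0 <= t ->
  ('V_P[fine \o supcogarch1 beta eta p phi v0 M t] =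
   \sum_(0 <= i <oo) ((p i ^+ 2)%:E * 'V_P[v0 i]))%E.
Proof.
move=> t0; rewrite /variance -{2}[t]addr0 covariance_supcogarch//.
apply: eq_eseriesr => i _; congr (_ * covariance _ _ _)%E.
by apply/funext => w; rewrite cogarch0.
Qed.

End Covariance.
End SupCogarch.

(** Variance and covariance are those of real variables, hence the [fine] around the series, which
    is almost surely finite under the assumption of (b) because its mean is. The closed forms
    concern one parameter at a time and are stated apart from the superposition. *)
Theorem proposition3p4 (R : realType) (beta eta : R)
  (beta_gt0 : 0 < beta) (eta_gt0 : 0 < eta)
  (* the Levy process L and its Levy measure *)
  (d0 : measure_display) (T0 : measurableType d0) (P0 : probability T0 R)
  (L : R -> {RV P0 >-> R}) (nuL : {measure set R -> \bar R})
  (levyL : levy_process L) (nuLE : levy_measure L nuL)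
  (* the mixing measure *)
  (p phi : nat -> R) (p_ge0 : forall i, 0 <= p i)
  (phi_ge0 : forall i, 0 <= phi i) (phi_inj : injective phi)
  (mix : probability R R)
  (mixE : forall A : set R, measurable A ->
    mix A = (\sum_(0 <= i <oo) ((p i)%:E * \d_(phi i) A))%E)
  (mix_Phi_L : mix (Phi_L eta nuL) = 1%E)
  (* the driving processes and the starting variables *)
  (d : measure_display) (T : measurableType d) (P : probability T R)
  (M : nat -> R -> {RV P >-> R}) (v0 : nat -> {RV P >-> R})
  (copies : forall i, levy_copy L (M i))
  (v0_ge0 : forall i w, 0 <= v0 i w)
  (indep : independent_sigma P (fun k : (nat + nat)%type =>
    match k with
    | inl i => sigma_process (M i)
    | inr i => g_sigma_algebra_preimage (v0 i)
    end))
  (stationary : forall i, 0 < p i -> stationary_law beta eta L (phi i) P (v0 i))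
  (finite0 : {ae P, forall w, (\sum_(0 <= i <oo) (p i * v0 i w)%:E < +oo)%E}) :
  let Vbar := supcogarch1 beta eta p phi v0 M in
  let V i := cogarch beta eta (phi i) (v0 i) (M i) in
  let ES1 := fine 'E_P0[subordinator L 1] in
  let VarS1 := fine 'V_P0[subordinator L 1] in
  (mix (Phi_L_kappa beta eta L nuL 1) = 1%E ->
    forall t : R, 0 <= t ->
      (\int[P]_w Vbar t w =
       \int[mix]_(x in Phi_L eta nuL) \int[P0]_w Vinf beta eta L x w)%E /\
      (\int[mix]_(x in Phi_L eta nuL) \int[P0]_w Vinf beta eta L x w =
       beta%:E * \sum_(0 <= i <oo) (p i / (eta - phi i * ES1))%:E)%E) /\
  (mix (Phi_L_kappa beta eta L nuL 2) = 1%E ->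
    (forall t h : R, 0 <= t -> 0 <= h ->
      ('V_P[fine \o Vbar t] =
       \sum_(0 <= i <oo) ((p i ^+ 2)%:E * 'V_P[v0 i]))%E /\
      (covariance P (fine \o Vbar t) (fine \o Vbar (t + h)%R) =
       \sum_(0 <= i <oo) ((p i ^+ 2)%:E * covariance P (v0 i) (V i h)))%E) /\
    (forall x, Phi_L_kappa beta eta L nuL 2 x ->
     forall (d1 : measure_display) (T1 : measurableType d1)
       (P1 : probability T1 R) (N : R -> {RV P1 >-> R}) (u0 : {RV P1 >-> R}),
     stationary_cogarch beta eta L x N u0 ->
     'V_P1[u0] =
       (beta ^+ 2 * x ^+ 2 * VarS1 /
        ((x * ES1 - eta) ^+ 2 *
         (2 * eta - 2 * x * ES1 - x ^+ 2 * VarS1)))%:E /\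
     forall h : R, 0 <= h ->
       covariance P1 u0 (cogarch beta eta x u0 N h) =
       ((expR (h * (x * ES1 - eta)))%:E * 'V_P1[u0])%E)).
Proof.
have indepE x d1 (T1 : measurableType d1) (P1 : probability T1 R) (N : R -> {RV P1 >-> R})
    (u0 : {RV P1 >-> R}) : stationary_cogarch beta eta L x N u0 ->
    forall E F, sigma_process N E -> g_sigma_algebra_preimage u0 F -> P1 (E `&` F) = (P1 E * P1 F)%E.
  move=> [_ _ H _] E F HE HF.
  have := H [:: true; false] (fun b : bool => if b then E else F) isT.
  rewrite !big_cons big_nil mule1 => <-; last by case.
  congr (P1 _); apply/seteqP; split => [w [H1 H2] []//|w Hw].
  by split; [apply: (Hw true)|apply: (Hw false)]; rewrite /= !inE.
move=> Vbar V ES1 VarS1; rewrite /Vbar /V.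
have ES1E : ES1 = mean1 L 1 by rewrite /ES1 expectation_subordinator.
split => [mix1 t t0|mix2]; last split => [t h t0 h0|x Kx d1 T1 P1 N u0 SC].
- have E := integral_mix_mean levyL nuLE beta_gt0 eta_gt0 p_ge0 mixE mix1.
  rewrite E; split.
    exact: (integral_supcogarch levyL nuLE beta_gt0 eta_gt0 p_ge0 phi_ge0 mixE copies v0_ge0 indep stationary mix1 t0).
  by rewrite ES1E; exact: (sum_mean_explicit levyL nuLE beta_gt0 eta_gt0 p_ge0 mixE mix1).
- split.
    exact: (variance_supcogarch levyL nuLE beta_gt0 eta_gt0 p_ge0 phi_ge0 mixE copies v0_ge0 indep stationary mix2 t0).
  exact: (covariance_supcogarch levyL nuLE beta_gt0 eta_gt0 p_ge0 phi_ge0 mixE copies v0_ge0 indep stationary mix2 t0 h0).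
have [copyN u00 _ statN] := SC.
have [x0 Hphi mf m2f _] := kappa2_facts levyL nuLE beta_gt0 eta_gt0 Kx.
have finL := levy_copy_finite_jumps levyL nuLE (levy_copy_refl levyL) Hphi.
have VarS1E : VarS1 = var1 L.
  have := variance_sqsum levyL finL mf m2f ler01; rewrite /VarS1 /var1.
  by rewrite (_ : sqsum L 0 1 = subordinator L 1)// => ->.
have HV := variance_v0 levyL nuLE beta_gt0 eta_gt0 copyN u00 (indepE _ _ _ _ _ _ SC) statN x0 Kx.
rewrite HV ES1E VarS1E; split; first by rewrite (statvarE levyL nuLE beta_gt0 eta_gt0 Kx).
move=> h h0.
have := covariance_cogarch levyL nuLE beta_gt0 eta_gt0 copyN u00 (indepE _ _ _ _ _ _ SC) statN x0 Kx (lexx 0) h0.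
rewrite subr0 EFinM => <-; congr covariance.
by apply/funext => w; rewrite cogarch0.
Qed.
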